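(* Let $\psi\in AM(\mathscr{C}_{A_1\times A_2})$ be such that $P(\log\psi)=0$ and $\psi$ is the restriction to $\mathscr{C}_{A_1\times A_2}$ of its Gibbs measure $\mu_\psi$. For $q\in\mathbb{R}$ let $$\mathcal{T}_\psi(q)=-\frac{P\big(s\log I_{\psi,q}\big)}{\log r_1}=-\frac{1}{\log r_1}\lim_{n\to\infty}\frac1n\log\sum_{w_1\in A_1^n}I_{\psi,q}([w_1])^s,\qquad s=\frac{\log r_1}{\log r_2},$$ and for $\alpha\ge 0$ let $$E_\psi(\alpha)=\Big\{(x,y)\in\operatorname{supp}(\psi):\ \lim_{n\to\infty}\frac{\log_{r_2}\psi([x|n]\times[y|n])}{-n}=\alpha\Big\},\qquad \mathcal{T}_\psi^*(\alpha)=\inf_{q\in\mathbb{R}}\big(\alpha q-\mathcal{T}_\psi(q)\big).$$ Then: (i) The concave function $\mathcal{T}_\psi$ is differentiable and non-decreasing on $\mathbb{R}$. (ii) For every $\alpha\in\mathbb{R}_+$, $\dim E_\psi(\alpha)=\mathcal{T}_\psi^*(\alpha)$ if $\mathcal{T}_\psi^*(\alpha)>0$, and $E_\psi(\alpha)=\emptyset$ if $\mathcal{T}_\psi^*(\alpha)<0$.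
   Context: **Symbolic spaces.** $2\le r_1\le r_2$ are integers; for $i\in\{1,2\}$, $A_i=\{0,\dots,r_i-1\}$ and $\mathbb{A}_i=A_i^{\mathbb{N}^*}$ is the one-sided symbolic space, with shift $\sigma_i$. The symbolic space over $A_1\times A_2$ is identified with $\mathbb{A}_1\times\mathbb{A}_2$, with shift $\sigma=(\sigma_1,\sigma_2)$. For a finite word $w$, $[w]$ is the cylinder of infinite words with prefix $w$; $|w|$ is the length of $w$; $x|n$ is the prefix of length $n$ of $x$. $\mathscr{C}_A$ denotes the set of cylinders over a finite alphabet $A$ (including that of the empty word), with concatenation $[w]\cdot[w']=[w\cdot w']$; elements of $\mathscr{C}_{A_1\times A_2}$ are the sets $[w_1]\times[w_2]$ with $w_1\in A_1^n$, $w_2\in A_2^n$, $n\ge 0$. $\mathbb{A}_i$ has the metric $d_i(z,z')=r_i^{-|z\wedge z'|}$, where $z\wedge z'$ is the longest common prefix, and $\mathbb{A}_1\times\mathbb{A}_2$ has the metric $d((x,y),(x',y'))=\max(d_1(x,x'),d_2(y,y'))$. $\dim$ is the Hausdorff dimension with respect to $d$. **Almost-multiplicative functions.** For a finite alphabet $A$ with $\#A\ge 2$, $AM(\mathscr{C}_A)$ is the set of non-zero functions $\psi:\mathscr{C}_A\to\mathbb{R}_+$ for which there is $C>0$ with $C^{-1}\psi([w])\psi([w'])\le\psi([w]\cdot[w'])\le C\psi([w])\psi([w'])$ for all $[w],[w']\in\mathscr{C}_A$. Its support is $\operatorname{supp}(\psi)=\{z\in A^{\mathbb{N}^*}:\forall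 n\ge 0,\ \psi([z|n])>0\}$. Its topological pressure is $P(\log\psi)=\lim_{n\to\infty}\frac1n\log\sum_{w\in A^n}\psi([w])$ (the limit exists). **Gibbs measure.** For $\psi\in AM(\mathscr{C}_A)$ there is a unique ergodic $\sigma$-invariant probability measure $\mu_\psi$ on $\operatorname{supp}(\psi)$ (extended by $0$ outside) such that, for some $C>0$, $C^{-1}e^{-nP(\log\psi)}\psi([w])\le\mu_\psi([w])\le Ce^{-nP(\log\psi)}\psi([w])$ for all $n\ge 1$, $w\in A^n$. It is called the Gibbs measure of $\psi$. That $\psi$ is the restriction of its Gibbs measure means $\psi([w])=\mu_\psi([w])$ for all cylinders. **Conventions.** $0^\gamma=0$ for all $\gamma\in\mathbb{R}$. For $\psi\in AM(\mathscr{C}_{A_1\times A_2})$ and $q\in\mathbb{R}$, $I_{\psi,q}:\mathscr{C}_{A_1}\to\mathbb{R}_+$ is $I_{\psi,q}([w_1])=\sum_{w_2\in A_2^{|w_1|}}\psi([w_1]\times[w_2])^q$. *)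

(* Defs.v *)
From HB Require Import structures.
From mathcomp Require Import all_boot all_order all_algebra.
From mathcomp Require Import all_classical all_reals all_analysis.
Import Order.TTheory GRing.Theory Num.Theory.
Import numFieldNormedType.Exports.

Set Implicit Arguments.
Unset Strict Implicit.
Unset Printing Implicit Defensive.

Local Open Scope classical_set_scope.
Local Open Scope ring_scope.

(* A point of A^{N^*} is a function x : nat -> A, whose (n+1)-st letter is
   x n. A cylinder [w] is represented by its word w : seq A; as soon as A has
   two letters, w |-> [w] is injective, and [w].[w'] is w ++ w'. *)
Section Words.
Context {A : finType}.

Definition prefix_of (x : nat -> A) (n : nat) : seq A := mkseq x n.

Definition cylinder (w : seq A) : set (nat -> A) :=
  [set x | prefix_of x (size w) = w].

Definition cylinders : set (set (nat -> A)) := range cylinder.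

Definition shift (x : nat -> A) : nat -> A := fun n => x n.+1.

End Words.
Arguments cylinders : clear implicits.

(* x ^ a with the convention 0 ^ a = 0 for every a, including a = 0
   (the library has 0 `^ 0 = 1). *)
Definition pow0 {R : realType} (x a : R) : R := if x == 0 then 0 else x `^ a.

Section AlmostMultiplicative.
Context {R : realType} {A : finType}.
Implicit Type psi : seq A -> R.

Definition almost_multiplicative psi : Prop :=
  [/\ forall w, 0 <= psi w,
      exists w, psi w != 0 &
      exists2 C : R, 0 < C & forall w w',
        C^-1 * psi w * psi w' <= psi (w ++ w') <= C * psi w * psi w'].

Definition supp psi : set (nat -> A) :=
  [set z | forall n, 0 < psi (prefix_of z n)].

(* P(log psi). The limit exists when psi is almost multiplicative and psi w > 0
   for some nonempty w; all the sums under ln are then positive. *)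
Definition pressure psi : R :=
  limn (fun n : nat => n%:R^-1 * ln (\sum_(w : n.-tuple A) psi w)).

End AlmostMultiplicative.

Section MeasurePreserving.
Context {d : measure_display} {T : measurableType d} {R : realType}.
Variables (mu : probability T R) (f : T -> T).

Definition invariant_measure : Prop :=
  forall B, measurable B -> mu (f @^-1` B) = mu B.

Definition ergodic : Prop :=
  forall B, measurable B -> f @^-1` B = B -> mu B = 0%E \/ mu B = 1%E.

End MeasurePreserving.

(* {0, ..., r-1} for r >= 1; this form is inhabited for every r, so that the
   space of sequences is a pointedType, as measurable types require. *)
Notation letter r := 'I_r.-1.+1.

HB.instance Definition _ (n : nat) := isPointed.Build 'I_n.+1 ord0.

(* (A_1 x A_2)^{N^*} with the sigma-algebra generated by the cylinders. *)
Notation symbolic_space r1 r2 :=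
  (g_sigma_algebraType (cylinders (letter r1 * letter r2)%type)).

Section ProductSpace.
Context {R : realType}.
Variables r1 r2 : nat.
Let A1 := letter r1.
Let A2 := letter r2.
Implicit Type psi : seq (A1 * A2) -> R.

Definition is_gibbs_measure psi
    (mu : probability (symbolic_space r1 r2) R) : Prop :=
  [/\ invariant_measure mu shift,
      ergodic mu shift,
      mu (supp psi) = 1%E &
      exists2 C : R, 0 < C & forall w : seq (A1 * A2), (1 <= size w)%N ->
        ((C^-1 * expR (- (size w)%:R * pressure psi) * psi w)%:E
           <= mu (cylinder w)
           <= (C * expR (- (size w)%:R * pressure psi) * psi w)%:E)%E].

(* The identification of A_1^{N^*} x A_2^{N^*} with (A_1 x A_2)^{N^*}; on
   words of equal length, [w_1] x [w_2] corresponds to zip w_1 w_2. *)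
Definition pair_seq (z : (nat -> A1) * (nat -> A2)) : nat -> A1 * A2 :=
  fun n => (z.1 n, z.2 n).

Definition I_psi psi (q : R) (w1 : seq A1) : R :=
  \sum_(w2 : (size w1).-tuple A2) pow0 (psi (zip w1 w2)) q.

Definition T_psi psi (q : R) : R :=
  let s := ln r1%:R / ln r2%:R in
  - (pressure (fun w1 => pow0 (I_psi psi q w1) s) / ln r1%:R).

Definition E_psi psi (alpha : R) : set ((nat -> A1) * (nat -> A2)) :=
  [set z | supp psi (pair_seq z) /\
    (fun n : nat =>
       ln (psi (zip (prefix_of z.1 n) (prefix_of z.2 n))) / ln r2%:R / - n%:R)
      @ \oo --> alpha].

End ProductSpace.

Definition legendre {R : realType} (T : R -> R) (alpha : R) : \bar R :=
  ereal_inf [set (alpha * q - T q)%:E | q in [set: R]].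

(* r ^ (- |x /\ y|), where |x /\ y| is the first index at which x and y
   differ (the distance is 0 when there is none). *)
Definition symb_dist {R : realType} {A : finType} (r : nat)
    (x y : nat -> A) : R :=
  if pselect (exists n, x n != y n) is left h then r%:R ^- ex_minn h else 0.

Definition prod_dist {R : realType} (r1 r2 : nat)
    (z z' : (nat -> letter r1) * (nat -> letter r2)) : R :=
  Num.max (symb_dist r1 z.1 z'.1) (symb_dist r2 z.2 z'.2).
Arguments prod_dist {R} r1 r2 z z'.

Section Hausdorff.
Context {R : realType} {T : Type}.
Variable dist : T -> T -> R.
Local Open Scope ereal_scope.

Definition diameter (U : set T) : \bar R :=
  maxe 0 (ereal_sup [set (dist z.1 z.2)%:E | z in U `*` U]).

(* diam(U) ^ t, with diam(U) ^ 0 = 1 for U nonempty, and 0 for U empty. *)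
Definition gauge (t : R) (U : set T) : \bar R :=
  if U == set0 then 0 else poweR (diameter U) t.

Definition hausdorff_premeasure (t delta : R) (E : set T) : \bar R :=
  ereal_inf [set \sum_(i <oo) gauge t (U i) | U in
    [set U : nat -> set T | E `<=` \bigcup_i U i /\
                            forall i, diameter (U i) <= delta%:E]].

Definition hausdorff_measure (t : R) (E : set T) : \bar R :=
  ereal_sup [set hausdorff_premeasure t delta E | delta in [set e | (0 < e)%R]].

Definition hausdorff_dim (E : set T) : \bar R :=
  ereal_inf [set t%:E | t in [set t | (0 <= t)%R /\ hausdorff_measure t E = 0]].

End Hausdorff.

(* Main.v *)
Require Import Defs.
From mathcomp Require Import all_boot all_order all_algebra.
From mathcomp Require Import all_classical all_reals all_analysis.
From mathcomp Require Import ring lra zify.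
Import Order.TTheory GRing.Theory Num.Theory.
Import numFieldNormedType.Exports.
Local Open Scope classical_set_scope.
Local Open Scope ring_scope.

(** Write P(q) for the pressure of I_q^s, so that
    T = - P / log r1.

    Differentiability.  For a quasi-multiplicative weight g and an almost
    additive X, the pressure p(t) of g e^(tX) satisfies
    sum g e^(tX) = e^(n p(t)) up to factors independent of n.  If the two
    one-sided slopes a < b of p at 0 differed, X / n would be close to a, and also
    close to b, on sets of words of mass bounded below; concatenating words of both
    kinds in varying proportions would give arbitrarily many disjoint sets of words
    of mass bounded below.  Applied to g = I_q^(s-1) psi^q and X = log psi, and
    combined with Hoelder's inequality
    sum I_(q+t)^s <= (sum I_q^s)^(1-s) (sum I_q^(s-1) I_(q+t))^s,
    this bounds the convex function P from above near q by a differentiable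
    function with the same value at q.

    Upper bound.  In the metric d, balls are approximate squares [u] x [v] with
    |v| = n and |u| = l(n) close to n / s.  The weights
    e^(- l P) psi(u|n, v)^q I_q(u)^s / I_q(u|n) have bounded sum at each scale, and
    for (x, y) in E(alpha) they exceed e^(- n log r2 (alpha q - T(q)) - o(n)) at
    infinitely many scales, because s log I_q(x|l(n)) - log I_q(x|n) >= - o(n)
    infinitely often.

    Lower bound.  Minimising alpha q - T(q) + eta |q| gives q with T'(q) close to
    alpha and T'(q) q - T(q) >= T*(alpha), also when alpha is an endpoint of the
    range of T'.  The weights I_q^(s-1) psi^q restricted to the typical words of a
    large length are the blocks of a Moran set contained in E(alpha); letting the
    block length grow slowly and keeping the projected and fibered entropies of the
    blocks convergent, the mass of an approximate square is at most
    e^(- n log r2 T*(alpha) + o(n)).  Koenig's lemma replaces the construction of a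
    measure. *)

(** * Sums over words *)

Set Implicit Arguments.
Unset Strict Implicit.
Unset Printing Implicit Defensive.

Section WordSums.
Context {R : realType}.
Implicit Types A B : finType.

(** The summand takes plain sequences rather than tuples, so that concatenation, [zip] and [take]
    need no casts between lengths. *)
Definition ws A (n : nat) (F : seq A -> R) : R := \sum_(w : n.-tuple A) F w.

Lemma ws0 A (F : seq A -> R) : ws 0 F = F [::].
Proof.
rewrite /ws (eq_bigr (fun=> F [::])); last by move=> w _; rewrite tuple0.
by rewrite sumr_const card_tuple expn0 mulr1n.
Qed.

Lemma wsS A n (F : seq A -> R) :
  ws n.+1 F = \sum_(a : A) ws n (fun w => F (a :: w)).
Proof.
rewrite /ws pair_big /=.
rewrite (reindex (fun p : A * n.-tuple A => [tuple of p.1 :: p.2])) //=.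
exists (fun w : n.+1.-tuple A => (thead w, [tuple of behead w])).
- by move=> [a w] _ /=; apply/eqP; rewrite xpair_eqE; apply/andP; split; apply/eqP;
    [rewrite /thead /tnth /= | exact: val_inj].
- by move=> w _ /=; rewrite [RHS]tuple_eta.
Qed.

Lemma eq_ws A n (F G : seq A -> R) :
  (forall w, size w = n -> F w = G w) -> ws n F = ws n G.
Proof. by move=> h; apply: eq_bigr => w _; rewrite h ?size_tuple. Qed.

Lemma ler_ws A n (F G : seq A -> R) :
  (forall w, size w = n -> F w <= G w) -> ws n F <= ws n G.
Proof. by move=> h; apply: ler_sum => w _; rewrite h ?size_tuple. Qed.

Lemma ws_ge0 A n (F : seq A -> R) :
  (forall w, size w = n -> 0 <= F w) -> 0 <= ws n F.
Proof. by move=> h; apply: sumr_ge0 => w _; rewrite h ?size_tuple. Qed.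

Lemma ws_le_term A n (F : seq A -> R) u :
  (forall w, size w = n -> 0 <= F w) -> size u = n -> F u <= ws n F.
Proof.
move=> h /eqP su; rewrite /ws (bigD1 (Tuple su)) //= lerDl.
by apply: sumr_ge0 => w _; rewrite h ?size_tuple.
Qed.

Lemma wsZ A n c (F : seq A -> R) : ws n (fun w => c * F w) = c * ws n F.
Proof. by rewrite /ws mulr_sumr. Qed.

Lemma wsZr A n c (F : seq A -> R) : ws n (fun w => F w * c) = ws n F * c.
Proof. by rewrite /ws mulr_suml. Qed.

Lemma wsD A n (F G : seq A -> R) :
  ws n (fun w => F w + G w) = ws n F + ws n G.
Proof. by rewrite /ws big_split. Qed.

Lemma ws_sum A n (I : finType) (F : I -> seq A -> R) :
  ws n (fun w => \sum_(i : I) F i w) = \sum_(i : I) ws n (F i).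
Proof. by rewrite /ws exchange_big. Qed.

Lemma ws_cat A m n (F : seq A -> R) :
  ws (m + n) F = ws m (fun u => ws n (fun v => F (u ++ v))).
Proof.
elim: m F => [|m IH] F; first by rewrite add0n ws0.
by rewrite addSn !wsS; apply: eq_bigr => a _; rewrite IH.
Qed.

Lemma ws_zip A B n (F : seq (A * B) -> R) :
  ws n F = ws n (fun u => ws n (fun v => F (zip u v))).
Proof.
elim: n F => [|n IH] F; first by rewrite !ws0.
rewrite !wsS.
under [RHS]eq_bigr do (under eq_ws do rewrite wsS).
rewrite (eq_bigr (fun p : A * B => ws n (fun w => F ((p.1, p.2) :: w)))); last by case.
rewrite -(pair_bigA _ (fun a b => ws n (fun w => F ((a, b) :: w)))) /=.
apply: eq_bigr => a _; rewrite ws_sum; apply: eq_bigr => b _.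
by rewrite IH.
Qed.

Lemma ws_gt0_ex A n (F : seq A -> R) : 0 < ws n F ->
  exists2 w, size w = n & 0 < F w.
Proof.
move=> h; apply: contrapT => hn; move: h; apply/negP; rewrite -leNgt.
apply: sumr_le0 => w _; rewrite leNgt; apply/negP => Fw.
by apply: hn; exists w; rewrite ?size_tuple.
Qed.

Lemma ws_const A n (c : R) : ws n (fun _ : seq A => c) = #|A|%:R ^+ n * c.
Proof. by rewrite /ws sumr_const card_tuple -natrX mulr_natl. Qed.

End WordSums.

(** * Convexity, Hoelder's inequality and Archimedean arguments *)

Section RealInequalities.
Context {R : realType}.
Implicit Types x y t c : R.

(** The graph of exp lies above its tangent at [m]; averaging this at x and y cancels the linear
    terms. *)
Lemma convex_expR_le t x y : 0 <= t <= 1 ->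
  expR ((1 - t) * x + t * y) <= (1 - t) * expR x + t * expR y.
Proof.
move=> /andP[t0 t1]; set m := (1 - t) * x + t * y.
have h z : expR m * (1 + (z - m)) <= expR z.
  have -> : expR z = expR m * expR (z - m) by rewrite -expRD; congr expR; ring.
  by rewrite ler_pM2l ?expR_gt0// expR_ge1Dx.
have hx := h x; have hy := h y.
have -> : expR m = (1 - t) * (expR m * (1 + (x - m))) + t * (expR m * (1 + (y - m))).
  by rewrite /m; ring.
by apply: lerD; apply: ler_wpM2l => //; lra.
Qed.

(* The disjunction keeps ln away from its junk values at nonpositive reals. *)
Lemma hoelder_sum (I : finType) (f g h : I -> R) t : 0 <= t <= 1 ->
  (forall i, 0 <= f i) -> (forall i, 0 <= g i) ->
  (forall i, h i <= 0 \/ [/\ 0 < f i, 0 < g i &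
     h i <= expR ((1 - t) * ln (f i) + t * ln (g i))]) ->
  0 < \sum_i f i -> 0 < \sum_i g i ->
  \sum_i h i <= expR ((1 - t) * ln (\sum_i f i) + t * ln (\sum_i g i)).
Proof.
move=> t01 f0 g0 hfg; set F := \sum_i f i; set G := \sum_i g i => F0 G0.
set E := expR _.
have /andP[t0 t1] := t01.
(* After division by the total sums F and G, each term obeys the weighted arithmetic-geometric
   inequality, and the right-hand sides add up to E. *)
have H i : h i <= E * ((1 - t) * (f i / F) + t * (g i / G)).
  case: (hfg i) => [hi|[fi gi hi]].
    apply: (le_trans hi); rewrite mulr_ge0 ?expR_ge0//.
    by apply: addr_ge0; apply: mulr_ge0; rewrite ?divr_ge0 ?f0 ?g0 ?(ltW F0) ?(ltW G0)//;
      lra.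
  apply: (le_trans hi).
  have -> : (1 - t) * ln (f i) + t * ln (g i) =
     ((1 - t) * ln F + t * ln G) +
       ((1 - t) * ln (f i / F) + t * ln (g i / G)).
    by rewrite !ln_div ?posrE//; ring.
  rewrite expRD ler_pM2l ?expR_gt0//.
  apply: (le_trans (convex_expR_le _ _ t01)).
  by rewrite !lnK ?posrE ?divr_gt0.
apply: (le_trans (ler_sum _ (fun i _ => H i))).
rewrite -mulr_sumr big_split /= -!mulr_sumr -!mulr_suml -/F -/G.
by rewrite !divff ?gt_eqF// !mulr1 subrK mulr1.
Qed.

(** Turns comparisons valid up to a bounded error at every length into comparisons of growth
    rates. *)
Lemma ler_of_natmul x y c :
  (forall n : nat, (0 < n)%N -> n%:R * x <= n%:R * y + c) -> x <= y.
Proof.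
move=> h; rewrite leNgt; apply/negP => yx.
have d0 : 0 < x - y by lra.
set n := (Num.truncn (`|c| / (x - y))).+1.
have hn : `|c| / (x - y) < n%:R by apply: truncnS_gt.
have := h n isT.
rewrite ltr_pdivrMr// in hn.
have := ler_norm c; lra.
Qed.

Lemma lt_of_truncn x (n : nat) : (Num.truncn x < n)%N -> x < n%:R.
Proof. by move=> h; apply: (lt_le_trans (truncnS_gt _)); rewrite ler_nat. Qed.

End RealInequalities.

(** * Almost additive sequences *)

Section AlmostAdditiveSequence.
Context {R : realType}.
Variables (a : nat -> R) (c : R).
Hypothesis ha : forall m n, `|a (m + n)%N - a m - a n| <= c.

Let ha' m n : a m + a n - c <= a (m + n)%N <= a m + a n + c.
Proof. by have := ha m n; rewrite ler_norml => /andP[? ?]; apply/andP; split; lra. Qed.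

Let a_mul m n : `|a (m.+1 * n)%N - m.+1%:R * a n| <= m%:R * c.
Proof.
elim: m => [|m IH]; first by rewrite mul1n mul1r subrr normr0 mul0r.
rewrite mulSn; have := ha n (m.+1 * n)%N.
move: IH; rewrite !ler_norml -!natr1 => /andP[? ?] /andP[? ?].
by apply/andP; split; lra.
Qed.

Let c_ge0 : 0 <= c. Proof. exact: le_trans (normr_ge0 _) (ha 0 0). Qed.

(** Both quotients are compared through the value of [a] at m n, read once as m pieces of length n
    and once as n pieces of length m. *)
Let cross m n : (0 < m)%N -> (0 < n)%N ->
  (a n - c) / n%:R <= (a m + c) / m%:R.
Proof.
case: m => // m; case: n => // n _ _.
rewrite ler_pdivrMr// mulrAC ler_pdivlMr//.
have := a_mul m n.+1; have := a_mul n m.+1; rewrite [(n.+1 * _)%N]mulnC.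
rewrite !ler_norml -!natr1 => /andP[? ?] /andP[? ?].
have := c_ge0; lra.
Qed.

(** By [cross] the intervals with ends (a n - c) / n and (a n + c) / n meet pairwise, so the infimum
    of the right ends lies in all of them; this gives the bounded error and the limit at once. *)
Lemma almost_additive_lim :
  let p := limn (fun n : nat => n%:R^-1 * a n) in
  forall n, `|a n - n%:R * p| <= c.
Proof.
pose p0 : R := inf [set (a m.+1 + c) / m.+1%:R | m in [set: nat]].
have hinf : has_inf [set (a m.+1 + c) / m.+1%:R | m in [set: nat]].
  split; first by exists ((a 1 + c) / 1%:R); exists 0%N.
  exists ((a 1%N - c) / 1%:R) => _ [m _ <-].
  by rewrite (@cross m.+1 1).
have hp n : `|a n - n%:R * p0| <= c.
  case: n => [|n].
    by rewrite mul0r subr0; have := ha 0 0; rewrite addn0 subrr sub0r normrN.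
  rewrite ler_norml; apply/andP; split.
    suff : p0 <= (a n.+1 + c) / n.+1%:R by rewrite ler_pdivlMr//; lra.
    by apply: ge_inf; [case: hinf|exists n].
  suff : (a n.+1 - c) / n.+1%:R <= p0 by rewrite ler_pdivrMr//; lra.
  apply: lb_le_inf; first by case: hinf.
  by move=> _ [m _ <-]; apply: cross.
suff -> : limn (fun n : nat => n%:R^-1 * a n) = p0 by [].
apply: cvg_lim => //.
apply/cvgrPdist_le => e e0.
exists (Num.truncn (c / e)).+1 => // n /= hn.
have n0 : (0 : R) < n%:R by rewrite ltr0n (leq_trans _ hn).
have -> : p0 - n%:R^-1 * a n = - (n%:R^-1 * (a n - n%:R * p0)).
  by field; rewrite gt_eqF.
rewrite normrN normrM gtr0_norm ?invr_gt0// mulrC ler_pdivrMr//.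
apply: (le_trans (hp n)).
have : c / e < n%:R.
  by apply: (lt_le_trans (truncnS_gt _)); rewrite ler_nat.
by rewrite ltr_pdivrMr// mulrC => /ltW.
Qed.

End AlmostAdditiveSequence.

(** * Quasi-multiplicative functions and pressure *)

Section QuasiMultiplicative.
Context {R : realType} {A : finType}.
Implicit Types (S : pred A) (f g : seq A -> R) (X : seq A -> R) (c q : R).

(** Almost multiplicativity in logarithmic form. An almost multiplicative function is positive
    exactly on the words over a subalphabet, here [S]. Vanishing elsewhere is kept separate, since
    factors such as [expR (X w)] do not have it. *)
Definition quasi_mult_on c S f : Prop :=
  [/\ 0 <= c, forall w, all S w -> 0 < f w &
      forall u v, all S u -> all S v ->
        `|ln (f (u ++ v)) - ln (f u) - ln (f v)| <= c].

Definition quasi_mult c S f : Prop :=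
  quasi_mult_on c S f /\ forall w, ~~ all S w -> f w = 0.

Lemma quasi_mult_ge0 c S f : quasi_mult c S f -> forall w, 0 <= f w.
Proof.
move=> [[_ fp _] f0] w; have [Sw|Sw] := boolP (all S w); first exact/ltW/fp.
by rewrite f0.
Qed.

Lemma quasi_mult_cat c S f : quasi_mult c S f -> forall u v,
  f (u ++ v) <= expR c * (f u * f v) /\ f u * f v <= expR c * f (u ++ v).
Proof.
move=> [[c0 fp fc] f0] u v.
have [Su|Su] := boolP (all S u); last first.
  by rewrite (f0 _ Su) mul0r f0 ?all_cat ?negb_and ?Su// !mulr0.
have [Sv|Sv] := boolP (all S v); last first.
  by rewrite (f0 _ Sv) mulr0 f0 ?all_cat ?negb_and ?Sv ?orbT// !mulr0.
have := fc _ _ Su Sv; rewrite ler_norml => /andP[h1 h2].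
have fu := fp _ Su; have fv := fp _ Sv.
have fuv : 0 < f (u ++ v) by apply: fp; rewrite all_cat Su.
rewrite -[f (u ++ v)]lnK ?posrE// -[f u]lnK ?posrE// -[f v]lnK ?posrE//.
by rewrite -!expRD !ler_expR; split; lra.
Qed.

Lemma quasi_mult_intro c S f : 0 <= c ->
  (forall w, all S w -> 0 < f w) -> (forall w, ~~ all S w -> f w = 0) ->
  (forall u v, all S u -> all S v -> f (u ++ v) <= expR c * (f u * f v)) ->
  (forall u v, all S u -> all S v -> f u * f v <= expR c * f (u ++ v)) ->
  quasi_mult c S f.
Proof.
move=> c0 fp f0 h1 h2; split => //; split => // u v Su Sv.
have fu := fp _ Su; have fv := fp _ Sv.
have fuv : 0 < f (u ++ v) by apply: fp; rewrite all_cat Su.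
have := h1 _ _ Su Sv; have := h2 _ _ Su Sv.
rewrite -[f (u ++ v)]lnK ?posrE// -[f u]lnK ?posrE// -[f v]lnK ?posrE//.
rewrite -!expRD !ler_expR !expRK => ? ?.
by rewrite ler_norml; apply/andP; split; lra.
Qed.

Lemma pow0E x q : 0 < x -> pow0 x q = expR (q * ln x) :> R.
Proof. by move=> x0; rewrite /pow0 gt_eqF// /powR gt_eqF. Qed.

Lemma quasi_mult_on_expR c S X : 0 <= c ->
  (forall u v, all S u -> all S v -> `|X (u ++ v) - X u - X v| <= c) ->
  quasi_mult_on c S (fun w => expR (X w)).
Proof.
by move=> c0 h; split => // [w _|u v Su Sv]; rewrite ?expR_gt0// !expRK h.
Qed.

Lemma quasi_mult_on_eq c S f g : quasi_mult_on c S f ->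
  (forall w, all S w -> f w = g w) -> quasi_mult_on c S g.
Proof.
move=> [c0 fp fc] fg; split => // [w Sw|u v Su Sv].
  by rewrite -fg// fp.
by rewrite -!fg ?all_cat ?Su ?Sv// fc.
Qed.

Lemma quasi_mult_on_pow c S f q : quasi_mult_on c S f ->
  quasi_mult_on (`|q| * c) S (fun w => pow0 (f w) q).
Proof.
move=> [c0 fp fc].
apply: (@quasi_mult_on_eq _ _ (fun w => expR (q * ln (f w)))).
  apply: quasi_mult_on_expR; first by rewrite mulr_ge0.
  by move=> u v Su Sv; rewrite -!mulrBr normrM ler_wpM2l// fc.
by move=> w Sw; rewrite pow0E// fp.
Qed.

Lemma quasi_mult_pow c S f q : quasi_mult c S f ->
  quasi_mult (`|q| * c) S (fun w => pow0 (f w) q).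
Proof.
move=> [fq f0]; split; first exact: quasi_mult_on_pow.
by move=> w Sw; rewrite f0// /pow0 eqxx.
Qed.

Lemma quasi_mult_on_mul c d S f g :
  quasi_mult_on c S f -> quasi_mult_on d S g ->
  quasi_mult_on (c + d) S (fun w => f w * g w).
Proof.
move=> [c0 fp fc] [d0 gp gd]; split => [|w Sw|u v Su Sv].
- exact: addr_ge0.
- by rewrite mulr_gt0 ?fp ?gp.
- have Suv : all S (u ++ v) by rewrite all_cat Su.
  rewrite !lnM ?posrE ?fp ?gp//.
  have := fc _ _ Su Sv; have := gd _ _ Su Sv.
  rewrite !ler_norml => /andP[? ?] /andP[? ?].
  by apply/andP; split; lra.
Qed.

Lemma quasi_mult_mul c d S f g :
  quasi_mult_on c S f -> quasi_mult d S g ->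
  quasi_mult (c + d) S (fun w => f w * g w).
Proof.
move=> hf [hg g0]; split; first exact: quasi_mult_on_mul.
by move=> w Sw; rewrite g0// mulr0.
Qed.

(** Letters are split off one at a time, each at cost c. The final c covers the empty word, where f
    need not be 1. *)
Lemma quasi_mult_on_ln_bound c S f : quasi_mult_on c S f ->
  exists2 K : R, 0 <= K & forall w, all S w -> `|ln (f w)| <= K * (size w)%:R + c.
Proof.
move=> [c0 fp fc]; exists (\sum_(a : A) `|ln (f [:: a])| + c).
  by rewrite addr_ge0 ?sumr_ge0.
elim=> [|a w IH] /=.
  move=> _; have /= := fc [::] [::] isT isT; rewrite mulr0 add0r.
  by rewrite subrr sub0r normrN.
move=> /andP[Sa Sw]; have := IH Sw.
have := fc [:: a] w; rewrite /= andbT => /(_ Sa Sw).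
have : `|ln (f [:: a])| <= \sum_(a : A) `|ln (f [:: a])|.
  by rewrite (bigD1 a) //= lerDl sumr_ge0.
move: (\sum_ _ _) => K; rewrite -natr1 mulrDr.
by rewrite !ler_norml => /andP[? ?] /andP[? ?] /andP[? ?]; apply/andP; split; lra.
Qed.

Section Pressure.
Variables (c : R) (S : pred A) (f : seq A -> R) (a0 : A).
Hypothesis (hf : quasi_mult c S f) (Sa0 : S a0).

Lemma quasi_mult_ws_gt0 n : 0 < ws n f.
Proof.
have [[_ fp _] _] := hf.
have h : 0 < f (nseq n a0) by apply: fp; rewrite all_nseq Sa0 orbT.
apply: (lt_le_trans h); apply: ws_le_term; last by rewrite size_nseq.
by move=> w _; apply: quasi_mult_ge0 hf w.
Qed.

Lemma quasi_mult_ws_cat m n :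
  `|ln (ws (m + n) f) - ln (ws m f) - ln (ws n f)| <= c.
Proof.
have Zmn := quasi_mult_ws_gt0 (m + n).
have Zm := quasi_mult_ws_gt0 m; have Zn := quasi_mult_ws_gt0 n.
have prodE : ws m (fun u => ws n (fun v => f u * f v)) = ws m f * ws n f.
  by rewrite -wsZr; apply: eq_ws => u _; rewrite wsZ.
have h1 : ws (m + n) f <= expR c * (ws m f * ws n f).
  rewrite ws_cat -prodE -wsZ; apply: ler_ws => u _; rewrite -wsZ.
  by apply: ler_ws => v _; case: (quasi_mult_cat hf u v).
have h2 : ws m f * ws n f <= expR c * ws (m + n) f.
  rewrite ws_cat -prodE -wsZ; apply: ler_ws => u _; rewrite -wsZ.
  by apply: ler_ws => v _; case: (quasi_mult_cat hf u v).
move: h1 h2; rewrite -[X in X <= _]lnK ?posrE//.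
rewrite -[ws m f in X in X -> _]lnK ?posrE// -[ws n f in X in X -> _]lnK ?posrE//.
rewrite -!expRD ler_expR => h1.
rewrite -[ws m f in X in X -> _]lnK ?posrE// -[ws n f in X in X -> _]lnK ?posrE//.
rewrite -[ws (m + n) f in X in X -> _]lnK ?posrE// -!expRD ler_expR => h2.
by rewrite ler_norml; apply/andP; split; lra.
Qed.

(** The error is bounded and not only o(n); the second moment argument and the concatenation
    argument below depend on this. *)
Lemma pressure_bound n : `|ln (ws n f) - n%:R * pressure f| <= c.
Proof. exact: (@almost_additive_lim R (fun n => ln (ws n f)) c quasi_mult_ws_cat n). Qed.

Lemma pressure_upper n : ws n f <= expR (c + n%:R * pressure f).
Proof.
rewrite -[leLHS]lnK ?posrE ?quasi_mult_ws_gt0// ler_expR.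
by have := pressure_bound n; rewrite ler_norml => /andP[? ?]; lra.
Qed.

Lemma pressure_lower n : expR (n%:R * pressure f - c) <= ws n f.
Proof.
rewrite -[leRHS]lnK ?posrE ?quasi_mult_ws_gt0// ler_expR.
by have := pressure_bound n; rewrite ler_norml => /andP[? ?]; lra.
Qed.

End Pressure.

Lemma pressure_le_convex c d e S f g h a0 t : S a0 -> 0 <= t <= 1 ->
  quasi_mult c S f -> quasi_mult d S g -> quasi_mult e S h ->
  (forall n, ln (ws n h) <= (1 - t) * ln (ws n f) + t * ln (ws n g)) ->
  pressure h <= (1 - t) * pressure f + t * pressure g.
Proof.
move=> Sa t01 hf hg hh H.
apply: (@ler_of_natmul _ _ _ (e + c + d)) => n _.
have := pressure_bound hf Sa n; have := pressure_bound hg Sa n.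
have := pressure_bound hh Sa n; have := H n.
rewrite !ler_norml => h0 /andP[h1 h2] /andP[h3 h4] /andP[h5 h6].
have /andP[t0 t1] := t01; have [[c0 _ _] _] := hf; have [[d0 _ _] _] := hg.
have := ler_wpM2l t0 h4; have : 0 <= 1 - t by lra.
move=> t1'; have := ler_wpM2l t1' h6.
have : t * d <= d by nra.
have : (1 - t) * c <= c by nra.
lra.
Qed.

Lemma pressure_le c d S f g a0 : S a0 ->
  quasi_mult c S f -> quasi_mult d S g ->
  (forall n, ws n f <= ws n g) -> pressure f <= pressure g.
Proof.
move=> Sa hf hg H; apply: (@ler_of_natmul _ _ _ (c + d)) => n _.
have := pressure_bound hf Sa n; have := pressure_bound hg Sa n.
have Zf := quasi_mult_ws_gt0 hf Sa n; have Zg := quasi_mult_ws_gt0 hg Sa n.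
have := H n; rewrite -ler_ln ?posrE//.
move: (ln _) (ln _) (pressure _) (pressure _) => x y p p'.
rewrite !ler_norml => ? /andP[? ?] /andP[? ?]; lra.
Qed.

End QuasiMultiplicative.

(** * Differentiability of the pressure of an exponential family *)

Section ExponentialFamily.
Context {R : realType} {A : finType}.
Variables (c d : R) (S : pred A) (g X : seq A -> R) (a0 : A).
Hypothesis (hg : quasi_mult c S g) (Sa0 : S a0) (d0 : 0 <= d).
Hypothesis hX : forall u v, all S u -> all S v -> `|X (u ++ v) - X u - X v| <= d.

Definition tilt t (w : seq A) := g w * expR (t * X w).

Lemma quasi_mult_tilt t : quasi_mult (`|t| * d + c) S (tilt t).
Proof.
have h : quasi_mult_on (`|t| * d) S (fun w => expR (t * X w)).
  apply: quasi_mult_on_expR => [|u v Su Sv]; first by rewrite mulr_ge0.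
  by rewrite -!mulrBr normrM ler_wpM2l// hX.
have := quasi_mult_mul h hg.
by congr quasi_mult; apply/funext => w; rewrite mulrC.
Qed.

Lemma tilt0 : tilt 0 = g.
Proof. by apply/funext => w; rewrite /tilt mul0r expR0 mulr1. Qed.

Lemma pressure_tilt_convex x y t : 0 <= t <= 1 ->
  pressure (tilt ((1 - t) * x + t * y)) <=
  (1 - t) * pressure (tilt x) + t * pressure (tilt y).
Proof.
move=> t01; apply: (pressure_le_convex Sa0 t01) => [||| n]; try exact: quasi_mult_tilt.
have Zp z := quasi_mult_ws_gt0 (quasi_mult_tilt z) Sa0 n.
rewrite -ler_expR lnK ?posrE//; apply: hoelder_sum => //.
- by move=> w; apply: quasi_mult_ge0 (quasi_mult_tilt x) _.
- by move=> w; apply: quasi_mult_ge0 (quasi_mult_tilt y) _.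
- move=> w; have [Sw|Sw] := boolP (all S w); last first.
    by left; case: (quasi_mult_tilt ((1 - t) * x + t * y)) => _ ->.
  right; have gw : 0 < g w by case: hg => -[_ -> //].
  have tp z : 0 < tilt z w by rewrite mulr_gt0 ?expR_gt0.
  split => //; rewrite -[leLHS]lnK ?posrE// ler_expR /tilt.
  rewrite !lnM ?posrE ?expR_gt0// !expRK; lra.
- exact: Zp.
- exact: Zp.
Qed.

(** The limiting cumulant generating function of X under the normalised weights g. *)
Definition rate t := pressure (tilt t) - pressure (tilt 0).

Lemma rate_convex x y t : 0 <= t <= 1 ->
  rate ((1 - t) * x + t * y) <= (1 - t) * rate x + t * rate y.
Proof.
move=> t01; have := pressure_tilt_convex x y t01; rewrite /rate.
move: (pressure _) (pressure _) (pressure _) (pressure _) => p0 p1 p2 p3; lra.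
Qed.

Lemma rate0 : rate 0 = 0. Proof. exact: subrr. Qed.

(** The error c for g plus the error [|t| * d + c] for the tilt, when |t| <= 1. *)
Let K := 2 * c + d.

Let c0 : 0 <= c. Proof. by case: hg => -[]. Qed.

Lemma tilt_mass t n : `|t| <= 1 ->
  ws n (tilt t) <= expR (K + n%:R * rate t) * ws n g /\
  expR (n%:R * rate t - K) * ws n g <= ws n (tilt t).
Proof.
move=> t1.
have Zg : 0 < ws n g := quasi_mult_ws_gt0 hg Sa0 n.
have Zt : 0 < ws n (tilt t) := quasi_mult_ws_gt0 (quasi_mult_tilt t) Sa0 n.
rewrite -[ws n g]lnK ?posrE// -[ws n (tilt t)]lnK ?posrE// -!expRD !ler_expR.
have := pressure_bound hg Sa0 n.
have := pressure_bound (quasi_mult_tilt t) Sa0 n.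
have : `|t| * d <= d by rewrite ler_piMl.
rewrite /K /rate tilt0 !ler_norml => ? /andP[? ?] /andP[? ?].
by split; lra.
Qed.

Lemma rate_slope_mono t u : 0 < t -> 0 < u -> t <= u -> rate t <= t / u * rate u.
Proof.
move=> t0 u0 tu.
have h : 0 <= t / u <= 1 by rewrite divr_ge0 ?(ltW t0) ?(ltW u0)//= ler_pdivrMr// mul1r.
have := rate_convex 0 u h; rewrite rate0 mulr0 !add0r.
by rewrite divfK ?gt_eqF// mulr0 add0r.
Qed.

(** The right derivative of [rate] at 0: the slopes of chords from 0 are monotone. The range t <= 1
    is the one in which [tilt_mass] applies. *)
Definition right_slope := inf [set rate t / t | t in [set t | 0 < t <= 1]].

Let slopes_has_inf : has_inf [set rate t / t | t in [set t | 0 < t <= 1]].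
Proof.
split; first by exists (rate 1 / 1); exists 1 => //=; rewrite ltr01 lexx.
exists (- rate (- 1)) => _ [t /= /andP[t0 t1] <-].
rewrite ler_pdivlMr//.
(* The weight for which 0 is the barycentre of -1 and t; convexity then bounds the slope at t below
   by the slope of the chord from -1 to 0. *)
have h : 0 <= (1 + t)^-1 <= 1.
  by apply/andP; split; [rewrite invr_ge0; lra|rewrite invf_le1; lra].
have := rate_convex (-1) t h.
have -> : (1 - (1 + t)^-1) * -1 + (1 + t)^-1 * t = 0.
  by field; rewrite gt_eqF//; lra.
rewrite rate0; move: (rate (-1)) (rate t) => x y h2.
have : 0 <= (1 + t) * ((1 - (1 + t)^-1) * x + (1 + t)^-1 * y).
  by apply: mulr_ge0 => //; lra.
have -> : (1 + t) * ((1 - (1 + t)^-1) * x + (1 + t)^-1 * y) = t * x + y.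
  by field; rewrite gt_eqF//; lra.
lra.
Qed.

Lemma right_slope_le t : 0 < t <= 1 -> right_slope * t <= rate t.
Proof.
move=> /andP[t0 t1]; rewrite -ler_pdivlMr//.
by apply: ge_inf; [case: slopes_has_inf | exists t => //=; rewrite t0].
Qed.

Lemma right_slope_near eta : 0 < eta -> exists2 t0 : R, 0 < t0 <= 1 &
  forall t, 0 < t <= t0 -> rate t <= (right_slope + eta) * t.
Proof.
move=> eta0.
have [_ [u /= u01 <-] hu] := inf_adherent eta0 slopes_has_inf.
exists u => // t /andP[t0 tu]; have /andP[u0 _] := u01.
apply: (le_trans (rate_slope_mono t0 u0 tu)).
have -> : t / u * rate u = rate u / u * t by ring.
by rewrite ler_pM2r// ltW.
Qed.

(** Half of what the second moment method yields, so that [right_slope_mass] can still subtract the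
    words on which X is too large. *)
Definition kappa : R := expR (- (3 * K + 1)) / 8.

Lemma kappa_gt0 : 0 < kappa. Proof. by rewrite divr_gt0 ?expR_gt0. Qed.

(* The pressure bounds hold up to a factor independent of n, so tilting by lambda / n
   shows that the law of X / n charges every neighbourhood of the right slope by a
   fixed amount (second moment method). *)
Lemma right_slope_lower_mass (delta : R) : 0 < delta -> exists n0 : nat, forall n, (n0 <=
  n)%N ->
  2 * kappa * ws n g <=
  ws n (fun w => g w * (n%:R * (right_slope - delta) <= X w)%R%:R).
Proof.
move=> delta0; set b := right_slope.
have K0 : 0 <= K by rewrite /K; have := c0; move: d0; lra.
(* Below the threshold n (b - delta), the factor exp (lam X / n) is at most exp (lam b - K - 1),
   smaller by a factor e than the lower bound [E1] for its mean. *)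
pose lam := (K + 1) / delta.
have lam0 : 0 < lam by rewrite divr_gt0//; lra.
(* With this tolerance, n times the rate at 2 lam / n exceeds 2 lam b by at most 1. *)
have [|t0 /andP[t00 t01] ht0] := @right_slope_near (2 * lam)^-1.
  by rewrite invr_gt0 mulr_gt0.
pose n0 := (Num.truncn (2 * lam / t0)).+1.
exists n0 => n hn.
have n0' : (0 : R) < n%:R by rewrite ltr0n (leq_trans _ hn).
have hlam : 2 * lam / n%:R <= t0.
  have := lt_of_truncn hn; rewrite ltr_pdivrMr// ler_pdivrMr//; lra.
have h2l : 0 < 2 * lam / n%:R <= t0 by rewrite hlam divr_gt0// mulr_gt0.
have hl : 0 < lam / n%:R <= 1.
  rewrite divr_gt0//=; apply: (le_trans _ (le_trans hlam t01)).
  by rewrite ler_pM2r ?invr_gt0//; lra.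
set Z := ws n g; have Z0 : 0 < Z := quasi_mult_ws_gt0 hg Sa0 n.
have g0 w : 0 <= g w := quasi_mult_ge0 hg w.
have E1 : expR (lam * b - K) * Z <= ws n (tilt (lam / n%:R)).
  have /andP[l0 l1] := hl.
  have [|_] := @tilt_mass (lam / n%:R) n; first by rewrite gtr0_norm.
  apply: le_trans; rewrite ler_pM2r// ler_expR lerD2r.
  have := right_slope_le hl; rewrite -(ler_pM2l n0').
  by have -> : n%:R * (b * (lam / n%:R)) = lam * b by field; rewrite gt_eqF.
have E2 : ws n (tilt (2 * lam / n%:R)) <= expR (K + 1 + 2 * lam * b) * Z.
  have [l0 l1] := andP h2l.
  have [|+ _] := @tilt_mass (2 * lam / n%:R) n.
    by rewrite gtr0_norm//; apply: le_trans l1 t01.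
  move=> h; apply: (le_trans h); rewrite ler_pM2r// ler_expR.
  have -> : K + 1 + 2 * lam * b = K + (1 + 2 * lam * b) by rewrite addrA.
  rewrite lerD2l.
  have := ht0 _ h2l; rewrite -(ler_pM2l n0') -/b.
  have -> : n%:R * ((b + (2 * lam)^-1) * (2 * lam / n%:R)) = 1 + 2 * lam * b.
    by field; rewrite !gt_eqF.
  by [].
set k := expR (- K); set E := expR 1 : R; set U := expR (lam * b).
have k0 : 0 < k := expR_gt0 _; have U0 : 0 < U := expR_gt0 _.
have E2' : 2 <= E by rewrite /E; have := expR_ge1Dx (1 : R); lra.
have E0 : 0 < E by lra.
(* Makes the quadratic term of [pt] sum to at most a quarter of [U * k * Z]. The constant term takes
   at most a half, so a quarter is left for the event. *)
pose mu := k ^+ 2 / (2 * E * U).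
have mu0 : 0 < mu by rewrite divr_gt0 ?exprn_gt0 ?mulr_gt0.
set T := ws n (fun w => g w * _).
have T0 : 0 <= T by apply: ws_ge0 => w _; rewrite mulr_ge0.
(* On the event this is y <= mu y^2 / 2 + 1 / (2 mu); off the event y is at most U k / E by the
   choice of [lam]. *)
have pt w : tilt (lam / n%:R) w <= (U * k / E) * g w + mu / 2 * tilt (2 * lam / n%:R) w
    + (2 * mu)^-1 * (g w * (n%:R * (b - delta) <= X w)%R%:R).
  rewrite /tilt; set y := expR _.
  have -> : expR (2 * lam / n%:R * X w) = y ^+ 2.
    by rewrite /y -expRM_natl; congr expR; ring.
  suff h : y <= U * k / E + mu / 2 * y ^+ 2 + (2 * mu)^-1 * (n%:R * (b - delta) <= X
    w)%R%:R.
    by have := ler_wpM2l (g0 w) h; lra.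
  have UkE : 0 <= U * k / E by rewrite divr_ge0 ?mulr_ge0 ?ltW.
  case: (boolP (n%:R * (b - delta) <= X w)) => hXw.
    rewrite mulr1; suff : y <= mu / 2 * y ^+ 2 + (2 * mu)^-1 by lra.
    rewrite -subr_ge0.
    have -> : mu / 2 * y ^+ 2 + (2 * mu)^-1 - y = (2 * mu)^-1 * (mu * y - 1) ^+ 2.
      by field; rewrite gt_eqF.
    by rewrite mulr_ge0 ?sqr_ge0// invr_ge0 mulr_ge0 ?ltW.
  rewrite -ltNge in hXw; rewrite mulr0 addr0.
  have : y <= U * k / E.
    rewrite /y /U /k /E -expRD -expRB ler_expR.
    have -> : lam * b - K - 1 = lam / n%:R * (n%:R * (b - delta)).
      by rewrite /lam; field; rewrite !gt_eqF.
    by rewrite ler_pM2l ?(ltW hXw)//; case/andP: hl.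
  have : 0 <= mu / 2 * y ^+ 2 by rewrite mulr_ge0 ?sqr_ge0// divr_ge0 ?ltW.
  lra.
have := ler_ws (fun w (_ : size w = n) => pt w).
rewrite !wsD !wsZ -/Z -/T => h.
have h2 : U * k * Z <= U * k / E * Z + mu / 2 * (E * U ^+ 2 / k * Z) + (2 * mu)^-1 * T.
  have UkZ : U * k * Z <= ws n (tilt (lam / n%:R)) by move: E1; rewrite expRD.
  apply: (le_trans UkZ); apply: (le_trans h).
  rewrite lerD2r lerD2l; apply: ler_wpM2l; first by rewrite divr_ge0 ?(ltW mu0).
  have <- : expR (K + 1 + 2 * lam * b) = E * U ^+ 2 / k.
    by rewrite /k /E /U expRN invrK -expRM_natl -!expRD; congr expR; ring.
  exact: E2.
have h3 : mu / 2 * (E * U ^+ 2 / k * Z) = U * k * Z / 4.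
  by rewrite /mu; field; rewrite !gt_eqF.
have h4 : U * k / E * Z <= U * k * Z / 2.
  have -> : U * k / E * Z = U * k * Z / E by ring.
  by rewrite ler_pM2l ?mulr_gt0// lef_pV2 ?posrE.
have h5 : U * k * Z / 4 <= (2 * mu)^-1 * T.
  by move: h2 h4; rewrite h3; move: (U * k * Z) (U * k / E * Z) (_^-1 * T) => x y z; lra.
have -> : 2 * kappa = k ^+ 3 / (4 * E).
  rewrite /kappa /k /E -expRM_natl; have -> : - (3 * K + 1) = 3%:R * - K - 1 by ring.
  by rewrite expRB; field; rewrite gt_eqF ?expR_gt0.
have := h5; rewrite [leRHS]mulrC ler_pdivlMr ?(mulr_gt0 _ mu0)//.
have -> : U * k * Z / 4 * (2 * mu) = k ^+ 3 / (4 * E) * Z.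
  by rewrite /mu; field; rewrite !gt_eqF.
by [].
Qed.

(** Mass at least 2 kappa lies above n (b - delta), and an exponential Markov inequality with a
    small t > 0 leaves mass at most kappa above n (b + delta). *)
Lemma right_slope_mass (delta : R) : 0 < delta -> exists n0 : nat, forall n, (n0 <= n)%N ->
  kappa * ws n g <=
  ws n (fun w => g w * (`|X w - n%:R * right_slope| <= n%:R * delta)%R%:R).
Proof.
move=> delta0; set b := right_slope.
have [n1 h1] := right_slope_lower_mass delta0.
have [|t /andP[t0 t1] ht] := @right_slope_near (delta / 2).
  by rewrite divr_gt0.
pose x := (K - ln kappa) / (delta * t / 2).
exists (maxn n1 (Num.truncn x).+1) => n; rewrite geq_max => /andP[/h1 {}h1 hn].
set Z := ws n g in h1 *; have Z0 : 0 < Z := quasi_mult_ws_gt0 hg Sa0 n.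
have g0 w : 0 <= g w := quasi_mult_ge0 hg w.
set T := ws n (fun w => g w * _).
have pt w : g w * (n%:R * (b - delta) <= X w)%R%:R <=
    g w * (`|X w - n%:R * b| <= n%:R * delta)%R%:R +
    expR (- (t * (n%:R * (b + delta)))) * tilt t w.
  have e0 : 0 <= expR (- (t * (n%:R * (b + delta)))) * tilt t w.
    by rewrite mulr_ge0 ?expR_ge0// /tilt mulr_ge0 ?expR_ge0.
  case: (boolP (n%:R * (b - delta) <= X w)) => hX1; last first.
    by rewrite mulr0 addr_ge0 ?mulr_ge0.
  case: (boolP (`|X w - n%:R * b| <= n%:R * delta)) => hX2; first by rewrite lerDl.
  rewrite mulr0 add0r mulr1 /tilt mulrCA ler_peMr// -expRD -[leLHS]expR0 ler_expR.
  have : n%:R * (b + delta) <= X w.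
    move: hX2; rewrite ler_norml => /negP hX2.
    rewrite leNgt; apply/negP => hX3; apply: hX2; apply/andP; split; lra.
  by move=> /(ler_wpM2l (ltW t0)); lra.
have := ler_ws (fun w (_ : size w = n) => pt w).
rewrite wsD wsZ -/T => h2.
have [|h3 _] := @tilt_mass t n; first by rewrite gtr0_norm.
have h4 : expR (- (t * (n%:R * (b + delta)))) * ws n (tilt t) <= kappa * Z.
  apply: (le_trans (ler_wpM2l (expR_ge0 _) h3)).
  rewrite mulrA ler_pM2r// -expRD -[leRHS](@lnK _ kappa) ?posrE ?kappa_gt0// ler_expR.
  have hr : rate t <= (b + delta / 2) * t by apply: ht; rewrite t0 lexx.
  have : x <= n%:R by exact/ltW/lt_of_truncn.
  rewrite /x ler_pdivrMr ?divr_gt0 ?mulr_gt0//.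
  have := ler_wpM2l (ler0n R n) hr; lra.
lra.
Qed.

End ExponentialFamily.

Section TiltDerivative.
Context {R : realType} {A : finType}.
Variables (c d : R) (S : pred A) (g X : seq A -> R) (a0 : A).
Hypothesis (hg : quasi_mult c S g) (Sa0 : S a0) (d0 : 0 <= d).
Hypothesis hX : forall u v, all S u -> all S v -> `|X (u ++ v) - X u - X v| <= d.

(** The right slope for [Y] is minus the left slope for X, so differentiability at 0 means that the
    two right slopes add up to 0. *)
Let Y w := - X w.

Let hY u v : all S u -> all S v -> `|Y (u ++ v) - Y u - Y v| <= d.
Proof.
move=> Su Sv; rewrite -normrN /Y.
have -> : - (- X (u ++ v) - - X u - - X v) = X (u ++ v) - X u - X v by ring.
exact: hX.
Qed.

Lemma sum_disjoint_ind (n : nat) (P : pred 'I_n) :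
  (forall i j, P i -> P j -> i = j) -> \sum_(i < n) (P i)%:R <= 1 :> R.
Proof.
move=> h; have [/existsP[i Pi]|/existsPn h0] := boolP [exists i, P i].
  rewrite (bigD1 i) //= Pi big1 ?addr0// => j ji.
  by case: (boolP (P j)) => // Pj; rewrite (h _ _ Pi Pj) eqxx in ji.
by rewrite big1 // => i _; rewrite (negbTE (h0 i)).
Qed.

(* If the one-sided slopes differed, words made of a first part near one slope and a
   second part near the other would give J disjoint events of mass bounded below
   independently of J. *)
Lemma right_slope_opp : right_slope g X + right_slope g Y <= 0.
Proof.
have H1 := fun delta (h : 0 < delta) => right_slope_mass hg Sa0 d0 hX h.
have H2 := fun delta (h : 0 < delta) => right_slope_mass hg Sa0 d0 hY h.
move: H1 H2 (kappa_gt0 c d); move: (right_slope g X) (right_slope g Y) (kappa c d).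
move=> b b' k H1 H2 k0; rewrite leNgt; apply/negP => bb.
pose D := b + b'.
(* More events than this, each of relative mass at least k^2 e^(-2c), cannot be disjoint. *)
have [J hJ] : exists J : nat, expR (2 * c) / k ^+ 2 < J%:R.
  by exists (Num.truncn (expR (2 * c) / k ^+ 2)).+1; apply: truncnS_gt.
have J0 : (0 : R) < J.+1%:R by [].
(* With total length (J + 1) M the windows have half-width M D / 4 + d, which is less than half the
   spacing M D of their centres once 4 d < M D. *)
pose delta := D / (4 * J.+1%:R).
have delta0 : 0 < delta by rewrite divr_gt0 ?mulr_gt0.
have [n1 h1] := H1 _ delta0.
have [n2 h2] := H2 _ delta0.
have [M [M1 M2 MD]] : exists M : nat, [/\ (n1 <= M)%N, (n2 <= M)%N & 4 * d < M%:R * D].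
  exists (n1 + n2 + (Num.truncn (4 * d / D)).+1)%N; split; try lia.
  by rewrite -ltr_pdivrMr//; apply: lt_of_truncn; rewrite addnS ltnS leq_addl.
pose n := (J.+1 * M)%N.
set Z := fun n => ws n g.
have Z0 m : 0 < Z m := quasi_mult_ws_gt0 hg Sa0 m.
have g0 w : 0 <= g w := quasi_mult_ge0 hg w.
(* The expected value of X when the first (j + 1) M letters have slope b and the last (J - j) M
   letters have slope - b'. *)
pose ctr (j : 'I_J) : R := M%:R * (j.+1%:R * b - (J - j)%:R * b').
pose W (j : 'I_J) w := (`|X w - ctr j| <= n%:R * delta + d).
have nd : n%:R * delta = M%:R * D / 4.
  by rewrite /delta /n natrM; field; rewrite gt_eqF.
have ctrE (j : 'I_J) : ctr j = M%:R * (j.+1%:R * D - J.+1%:R * b').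
  rewrite /ctr natrB; last exact: ltnW.
  by rewrite -!natr1 /D; ring.
have disj w (i j : 'I_J) : W i w -> W j w -> i = j.
  have half (x y : 'I_J) : W x w -> W y w -> (x < y)%N -> False.
    rewrite /W !ctrE nd !ler_norml => /andP[? ?] /andP[? ?] xy.
    have : x.+2%:R <= y.+1%:R :> R by rewrite ler_nat.
    rewrite -natr1 -(ler_pM2l (lt_le_trans (_ : 0 < M%:R * D) (lexx _))).
      lra.
    have := d0; lra.
  move=> Wi Wj; apply/val_inj => /=; case: (ltngtP i j) => // ij; exfalso.
    exact: (half _ _ Wi Wj).
  exact: (half _ _ Wj Wi).
have lower (j : 'I_J) : expR (- (2 * c)) * k ^+ 2 * Z n <=
    ws n (fun w => g w * (W j w)%:R).
  have hj := ltn_ord j.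
  pose p1 := (j.+1 * M)%N; pose p2 := ((J - j) * M)%N.
  have np : n = (p1 + p2)%N by rewrite /n /p1 /p2 -mulnDl; congr (_ * _)%N; lia.
  have {}h1 := h1 p1 (leq_trans M1 (leq_pmull _ _)); move: h1 => /(_ isT) h1.
  have {}h2 := h2 p2 (leq_trans M2 (leq_pmull _ _)).
  have {}h2 := h2 (etrans (subn_gt0 _ _) hj).
  set I1 := fun w => _ in h1; set I2 := fun w => _ in h2.
  have I10 w : 0 <= I1 w by rewrite mulr_ge0.
  have I20 w : 0 <= I2 w by rewrite mulr_ge0.
  have prodE : ws p1 (fun u => ws p2 (fun v => I1 u * I2 v)) = ws p1 I1 * ws p2 I2.
    by rewrite -wsZr; apply: eq_ws => u _; rewrite wsZ.
  have step : expR (- c) * (ws p1 I1 * ws p2 I2) <= ws n (fun w => g w * (W j w)%:R).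
    rewrite np ws_cat -prodE -wsZ; apply: ler_ws => u su; rewrite -wsZ.
    apply: ler_ws => v sv; rewrite /I1 /I2.
    case: (boolP (`|X u - _| <= _)) => hu; last first.
      by rewrite mulr0 mul0r mulr0 mulr_ge0.
    case: (boolP (`|Y v - _| <= _)) => hv; last first.
      by rewrite !mulr0 mulr_ge0.
    rewrite !mulr1.
    have [Su|Su] := boolP (all S u); last first.
      by case: hg => _ /(_ _ Su) ->; rewrite mul0r mulr0 mulr_ge0.
    have [Sv|Sv] := boolP (all S v); last first.
      by case: hg => _ /(_ _ Sv) ->; rewrite !mulr0 mulr_ge0.
    have -> : W j (u ++ v).
      rewrite /W; have := hX Su Sv; move: hu hv; rewrite /Y np natrD /ctr /p1 /p2 !natrM.
      rewrite !ler_norml => /andP[? ?] /andP[? ?] /andP[? ?].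
      by apply/andP; split; lra.
    rewrite mulr1 expRN mulrC ler_pdivrMr ?expR_gt0// [leRHS]mulrC.
    by case: (quasi_mult_cat hg u v).
  apply: le_trans step.
  have zz : Z n <= expR c * (Z p1 * Z p2).
    have := quasi_mult_ws_cat hg Sa0 p1 p2; rewrite -np -/(Z n) -/(Z p1) -/(Z p2).
    rewrite -[Z n in X in _ -> X]lnK ?posrE// -[Z p1 in X in _ -> X]lnK ?posrE//.
    rewrite -[Z p2 in X in _ -> X]lnK ?posrE// -!expRD ler_expR.
    move: (ln (Z n)) (ln (Z p1)) (ln (Z p2)) => x y z.
    by rewrite ler_norml => /andP[? ?]; lra.
  have -> : - (2 * c) = - c - c by ring.
  rewrite expRB -mulrA -mulrA ler_pM2l ?expR_gt0//.
  have -> : (expR c)^-1 * (k ^+ 2 * Z n) = k ^+ 2 * (Z n / expR c) by ring.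
  apply: (@le_trans _ _ (k ^+ 2 * (Z p1 * Z p2))).
    by rewrite ler_pM2l ?exprn_gt0// ler_pdivrMr ?expR_gt0// mulrC.
  have -> : k ^+ 2 * (Z p1 * Z p2) = (k * Z p1) * (k * Z p2) by ring.
  by apply: ler_pM => //; rewrite mulr_ge0 ?ltW.
have : \sum_(j < J) (expR (- (2 * c)) * k ^+ 2 * Z n) <= Z n.
  apply: (le_trans (ler_sum _ (fun j _ => lower j))).
  rewrite -(ws_sum n (fun j w => g w * (W j w)%:R)); apply: ler_ws => w _.
  by rewrite -mulr_sumr ler_piMr// sum_disjoint_ind// => i j; apply: disj.
rewrite sumr_const card_ord -[leLHS]mulr_natl.
have -> : J%:R * (expR (- (2 * c)) * k ^+ 2 * Z n) =
    (J%:R * k ^+ 2 / expR (2 * c)) * Z n by rewrite expRN; ring.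
rewrite ger_pMl ?Z0// ler_pdivrMr ?expR_gt0// mul1r leNgt => /negP; apply.
by move: hJ; rewrite ltr_pdivrMr ?exprn_gt0.
Qed.

Lemma tilt_opp t : tilt g Y t = tilt g X (- t).
Proof. by apply/funext => w; rewrite /tilt /Y mulrN mulNr. Qed.

(** Only an upper bound is recorded. For convex functions it already gives differentiability, and it
    passes to a smaller function with the same value at the point, which is how it reaches the
    pressure of I_q^s. *)
Lemma pressure_tilt_near : exists b : R, forall eta : R, 0 < eta ->
  exists2 t0 : R, 0 < t0 & forall t, `|t| <= t0 ->
    pressure (tilt g X t) <= pressure g + b * t + eta * `|t|.
Proof.
exists (right_slope g X) => eta eta0.
have [t1 /andP[t10 _] h1] := right_slope_near hg Sa0 d0 hX eta0.
have [t2 /andP[t20 _] h2] := right_slope_near hg Sa0 d0 hY eta0.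
exists (Num.min t1 t2); first by rewrite lt_min t10.
move=> t; rewrite le_min => /andP[tt1 tt2].
case: (ltrgt0P t) tt1 tt2 => [t0|t0|->] tt1 tt2.
- have := h1 t; rewrite t0 tt1 /rate tilt0 => /(_ isT).
  move: (pressure _) (pressure _) (right_slope _ _) => p p' b; lra.
- have := h2 (- t); rewrite oppr_gt0 t0 tt2 /rate !tilt_opp opprK oppr0 tilt0 => /(_ isT).
  have := right_slope_opp.
  move: (pressure _) (pressure _) (right_slope _ _) (right_slope _ _) => p p' b b'; nra.
- by rewrite tilt0 !mulr0 !addr0.
Qed.

End TiltDerivative.

(** * The pressure of I_q^s *)

Section ConvexTangent.
Context {R : realType}.
Variables (P : R -> R) (q b : R).
Hypothesis P_convex : forall x y t, 0 <= t <= 1 ->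
  P ((1 - t) * x + t * y) <= (1 - t) * P x + t * P y.
Hypothesis P_near : forall eta : R, 0 < eta -> exists2 t0 : R, 0 < t0 &
  forall t, `|t| <= t0 -> P (q + t) <= P q + b * t + eta * `|t|.

(** If P were below the line at x, convexity would push it above the line on the opposite side of q,
    arbitrarily close to q, against [P_near]. *)
Lemma convex_tangent x : P q + b * (x - q) <= P x.
Proof.
have [->|xq] := eqVneq x q; first by rewrite subrr mulr0 addr0.
set h := x - q; have h0 : 0 < `|h| by rewrite normr_gt0 subr_eq0.
apply/ler_addgt0Pr => e e0.
have [t0 t00 ht] := P_near (divr_gt0 e0 h0).
pose th := Num.min 1 (t0 / `|h|).
have th0 : 0 < th by rewrite lt_min ltr01 divr_gt0.
have th1 : th <= 1 by rewrite ge_min lexx.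
have thh : `|- (th * h)| <= t0.
  rewrite normrN normrM gtr0_norm// -ler_pdivlMr//.
  by rewrite ge_min lexx orbT.
(* The weight (1 + th)^-1 makes q the barycentre of x and q - th h. *)
have := P_convex x (q - th * h) (t := (1 + th)^-1).
have -> : (1 - (1 + th)^-1) * x + (1 + th)^-1 * (q - th * h) = q.
  by rewrite /h; field; lra.
have cc : 0 <= (1 + th)^-1 <= 1.
  by apply/andP; split; [rewrite invr_ge0; lra|rewrite invf_le1; lra].
move=> /(_ cc).
have := ht _ thh; rewrite normrN normrM (gtr0_norm th0).
have -> : e / `|h| * (th * `|h|) = e * th by field; rewrite gt_eqF.
move: (P q) (P x) (P (q - th * h)) => Pq Px Pm h1 h2.
have h3 : (1 + th) * Pq <= th * Px + Pm.
  have -> : th * Px + Pm = (1 + th) * ((1 - (1 + th)^-1) * Px + (1 + th)^-1 * Pm).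
    by field; lra.
  by rewrite ler_pM2l//; lra.
have h4 : th * (Pq + b * h) <= th * (Px + e) by lra.
by move: h4; rewrite ler_pM2l.
Qed.

(** The difference quotient is squeezed between the supporting line and the bound of [P_near]. *)
Lemma convex_near_is_derive : is_derive q 1 P b.
Proof.
have D : (fun h => h^-1 *: ((P \o shift q) (h *: (1 : R)) - P q)) @ 0^' --> b.
  apply/cvgrPdist_le => e e0; have [t0 t00 ht] := P_near e0.
  rewrite /dnbhs /within /= near_withinE; apply/nbhs_ballP.
  exists t0 => // t /=; rewrite /ball /= sub0r normrN => tt0 tn0.
  have at0 : 0 < `|t| by rewrite normr_gt0.
  rewrite -(ler_pM2l at0) -normrM /GRing.scale /= mulr1 mulrBr mulrA divff// mul1r.
  have := ht _ (ltW tt0); have := convex_tangent (t + q).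
  rewrite [q + t]addrC addrK ler_norml => h1 h2.
  by apply/andP; split; lra.
apply: DeriveDef; first by apply/cvg_ex; exists b; exact: D.
exact: cvg_lim D.
Qed.

End ConvexTangent.

Lemma eq_pressure {R : realType} {A B : finType} (f : seq A -> R) (g : seq B -> R) :
  (forall n, ws n f = ws n g) -> pressure f = pressure g.
Proof.
move=> h; rewrite /pressure.
suff -> : (fun n : nat => n%:R^-1 * ln (\sum_(w : n.-tuple A) f w)) =
  (fun n : nat => n%:R^-1 * ln (\sum_(w : n.-tuple B) g w)) by [].
by apply/funext => n; congr (_ * ln _); exact: h.
Qed.

(** * Fiber sums and the skew weights *)

Section FiberSum.
Context {R : realType} {A1 A2 : finType}.
Implicit Types (f psi : seq (A1 * A2) -> R) (S : pred (A1 * A2)).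

Definition fiber_ws f (u : seq A1) : R := ws (size u) (fun v => f (zip u v)).

Definition proj1_pred S : pred A1 := fun a => [exists b, S (a, b)].

Lemma all_zip_proj1 S u v : size u = size v -> all S (zip u v) ->
  all (proj1_pred S) u.
Proof.
elim: u v => [|a u IH] [|b v] //= [suv] /andP[Sab Suv].
by rewrite (IH _ suv Suv) andbT; apply/existsP; exists b.
Qed.

Lemma all_proj1_zip S u : all (proj1_pred S) u ->
  exists2 v, size v = size u & all S (zip u v).
Proof.
elim: u => [|a u IH] /=; first by exists [::].
move=> /andP[/existsP[b Sab] /IH[v sv Sv]].
by exists (b :: v) => /=; rewrite ?sv ?Sab.
Qed.

(** The fiber over a concatenation is the product of the fibers, so the comparison holds term by
    term and the constant does not deteriorate. *)
Lemma quasi_mult_fiber c S f : quasi_mult c S f ->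
  quasi_mult c (proj1_pred S) (fiber_ws f).
Proof.
move=> hf; have f0 w : 0 <= f w := quasi_mult_ge0 hf w.
have [[c0 fp _] fz] := hf.
have prodE u u' : fiber_ws f u * fiber_ws f u' =
    ws (size u) (fun v => ws (size u') (fun v' => f (zip u v) * f (zip u' v'))).
  by rewrite /fiber_ws -wsZr; apply: eq_ws => v _; rewrite wsZ.
have catE u u' : fiber_ws f (u ++ u') =
    ws (size u) (fun v => ws (size u') (fun v' => f (zip u v ++ zip u' v'))).
  rewrite /fiber_ws size_cat ws_cat; apply: eq_ws => v sv; apply: eq_ws => v' sv'.
  by rewrite zip_cat.
apply: quasi_mult_intro => //.
- move=> u /all_proj1_zip[v sv Sv].
  apply: (lt_le_trans (fp _ Sv)).
  by apply: (ws_le_term (F := fun v => f (zip u v))) => // w _.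
- move=> u nS; rewrite /fiber_ws.
  have -> : ws (size u) (fun v => f (zip u v)) = ws (size u) (fun _ : seq A2 => 0).
    apply: eq_ws => v sv; apply: fz; apply: contra nS => /all_zip_proj1; apply.
    by rewrite sv.
  by rewrite ws_const mulr0.
- move=> u v _ _; rewrite catE prodE -wsZ; apply: ler_ws => w _; rewrite -wsZ.
  by apply: ler_ws => w' _; case: (quasi_mult_cat hf (zip u w) (zip v w')).
- move=> u v _ _; rewrite catE prodE -wsZ; apply: ler_ws => w _; rewrite -wsZ.
  by apply: ler_ws => w' _; case: (quasi_mult_cat hf (zip u w) (zip v w')).
Qed.

Variables (c s : R) (S : pred (A1 * A2)) (psi : seq (A1 * A2) -> R) (a0 : A1 * A2).
Hypothesis (hpsi : quasi_mult c S psi) (Sa0 : S a0) (s01 : 0 < s <= 1).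

Let S1 := proj1_pred S.

(** Convertible with [I_psi psi q], which lets [T_psi] be unfolded by computation in [T_psiE]. *)
Definition fiber_pow q : seq A1 -> R := fiber_ws (fun w => pow0 (psi w) q).

Definition skew_pressure q : R := pressure (fun u => pow0 (fiber_pow q u) s).

Lemma proj1_pred0 : S1 a0.1.
Proof. by apply/existsP; exists a0.2; rewrite -surjective_pairing. Qed.

Lemma quasi_mult_fiber_pow q : quasi_mult (`|q| * c) S1 (fiber_pow q).
Proof. exact/quasi_mult_fiber/quasi_mult_pow. Qed.

Lemma quasi_mult_fiber_pows q :
  quasi_mult (`|s| * (`|q| * c)) S1 (fun u => pow0 (fiber_pow q u) s).
Proof. exact/quasi_mult_pow/quasi_mult_fiber_pow. Qed.

(* The weight of a word under the (unnormalised) measure projecting onto the Gibbs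
   measure of I_q^s and disintegrating like psi^q along the fibers. *)
Definition skew_weight q (w : seq (A1 * A2)) : R :=
  pow0 (fiber_pow q (unzip1 w)) (s - 1) * pow0 (psi w) q.

Lemma all_unzip1 w : all S w -> all S1 (unzip1 w).
Proof.
elim: w => //= -[a b] w IH /andP[Sab Sw] /=; rewrite IH// andbT.
by apply/existsP; exists b.
Qed.

Lemma quasi_mult_skew_weight q :
  quasi_mult (`|s - 1| * (`|q| * c) + `|q| * c) S (skew_weight q).
Proof.
apply: quasi_mult_mul; last exact: quasi_mult_pow.
have [c0 fp fc] := quasi_mult_on_pow (s - 1) (quasi_mult_fiber_pow q).1.
split => // [w Sw|u v Su Sv]; first exact/fp/all_unzip1.
have -> : unzip1 (u ++ v) = unzip1 u ++ unzip1 v by rewrite /unzip1 map_cat.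
by apply: fc; apply: all_unzip1.
Qed.

Lemma skew_weight_fiber q (k : seq (A1 * A2) -> R) n :
  ws n (fun w => pow0 (fiber_pow q (unzip1 w)) (s - 1) * k w) =
  ws n (fun u => pow0 (fiber_pow q u) (s - 1) * fiber_ws k u).
Proof.
rewrite ws_zip; apply: eq_ws => u su; rewrite /fiber_ws -wsZ su.
by apply: eq_ws => v sv; rewrite unzip1_zip// su sv.
Qed.

Lemma pow0_subK x y : 0 <= x -> pow0 x (y - 1) * x = pow0 x y :> R.
Proof.
rewrite le_eqVlt => /orP[/eqP<-|x0]; first by rewrite mulr0 /pow0 eqxx.
rewrite !pow0E// -[X in _ * X = _]lnK ?posrE// -expRD; congr expR; ring.
Qed.

End FiberSum.

Section SkewPressure.
Context {R : realType} {A1 A2 : finType}.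
Variables (c s : R) (S : pred (A1 * A2)) (psi : seq (A1 * A2) -> R) (a0 : A1 * A2).
Hypothesis (hpsi : quasi_mult c S psi) (Sa0 : S a0) (s01 : 0 < s <= 1).

Local Notation S1 := (proj1_pred S).
Local Notation J := (fiber_pow psi).
Local Notation P := (skew_pressure s psi).

Let Sa1 : S1 a0.1. Proof. exact: proj1_pred0 Sa0. Qed.

Let psi_ge0 w : 0 <= psi w. Proof. exact: quasi_mult_ge0 hpsi w. Qed.

Lemma fiber_pow_ge0 q u : 0 <= J q u.
Proof. exact: quasi_mult_ge0 (quasi_mult_fiber_pow hpsi q) u. Qed.

Lemma fiber_pow_gt0 q u : all S1 u -> 0 < J q u.
Proof. by case: (quasi_mult_fiber_pow hpsi q) => -[_ h _] _; apply: h. Qed.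

Lemma fiber_pow_eq0 q u : ~~ all S1 u -> J q u = 0.
Proof. by case: (quasi_mult_fiber_pow hpsi q) => -[_ _ _]; apply. Qed.

Lemma pow0_ge0 (x y : R) : 0 <= pow0 x y.
Proof. by rewrite /pow0; case: ifP => // _; apply: powR_ge0. Qed.

Lemma pow00 (y : R) : pow0 0 y = 0. Proof. by rewrite /pow0 eqxx. Qed.

Lemma ws_skew_weight q n :
  ws n (skew_weight s psi q) = ws n (fun u => pow0 (J q u) s).
Proof.
rewrite (skew_weight_fiber s psi q); apply: eq_ws => u _.
by rewrite pow0_subK ?fiber_pow_ge0.
Qed.

Lemma pow0_tilt q t w :
  pow0 (psi w) q * expR (t * ln (psi w)) = pow0 (psi w) (q + t).
Proof.
have := psi_ge0 w; rewrite le_eqVlt => /orP[/eqP<-|h]; first by rewrite !pow00 mul0r.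
by rewrite !pow0E// -expRD; congr expR; ring.
Qed.

Lemma ws_tilt_skew_weight q t n :
  ws n (tilt (skew_weight s psi q) (fun w => ln (psi w)) t) =
  ws n (fun u => pow0 (J q u) (s - 1) * J (q + t) u).
Proof.
rewrite -(skew_weight_fiber s psi q (fun w => pow0 (psi w) (q + t))).
by apply: eq_ws => w _; rewrite /tilt /skew_weight -mulrA pow0_tilt.
Qed.

Let psi_ln u v : all S u -> all S v ->
  `|ln (psi (u ++ v)) - ln (psi u) - ln (psi v)| <= c.
Proof. by case: hpsi => -[_ _ h] _; apply: h. Qed.

Let c0 : 0 <= c. Proof. by case: hpsi => -[]. Qed.

(** Because of the power s, P is not itself the pressure of an exponential family. Hoelder's
    inequality with exponents 1 - s and s bounds it by one, with equality at t = 0. *)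
Lemma skew_pressure_tilt q t :
  P (q + t) <= (1 - s) * P q +
    s * pressure (tilt (skew_weight s psi q) (fun w => ln (psi w)) t).
Proof.
have s0 : 0 <= s <= 1 by case/andP: s01 => /ltW -> ->.
rewrite (eq_pressure (ws_tilt_skew_weight q t)).
have qmg : exists e, quasi_mult e S1 (fun u => pow0 (J q u) (s - 1) * J (q + t) u).
  exists (`|s - 1| * (`|q| * c) + `|q + t| * c).
  apply: quasi_mult_mul; last exact: quasi_mult_fiber_pow.
  by apply: quasi_mult_on_pow; case: (quasi_mult_fiber_pow hpsi q).
have [e he] := qmg.
have hp q' := quasi_mult_fiber_pows s hpsi q'.
apply: (pressure_le_convex Sa1 s0 (hp q) he (hp (q + t))) => n.
have Zp q' := quasi_mult_ws_gt0 (hp q') Sa1 n.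
have Ze := quasi_mult_ws_gt0 he Sa1 n.
rewrite -ler_expR lnK ?posrE//; apply: hoelder_sum => //.
- by move=> u; apply: pow0_ge0.
- by move=> u; rewrite mulr_ge0 ?pow0_ge0 ?fiber_pow_ge0.
- move=> u; have [Su|Su] := boolP (all S1 u); last first.
    by left; rewrite fiber_pow_eq0// pow00.
  have Jp q' := fiber_pow_gt0 q' Su.
  right; rewrite !pow0E//; split; rewrite ?expR_gt0 ?mulr_gt0 ?expR_gt0//.
  rewrite ler_expR lnM ?posrE ?expR_gt0// !expRK.
  by move: (ln (J q u)) (ln (J (q + t) u)) => x y; lra.
- exact: Zp.
Qed.

Lemma pressure_skew_weight q : pressure (skew_weight s psi q) = P q.
Proof. by apply: eq_pressure => n; rewrite ws_skew_weight. Qed.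

Lemma fiber_pow_convex x y t u : 0 <= t <= 1 -> all S1 u ->
  ln (J ((1 - t) * x + t * y) u) <= (1 - t) * ln (J x u) + t * ln (J y u).
Proof.
move=> t01 Su; rewrite -ler_expR lnK ?posrE ?fiber_pow_gt0//.
apply: hoelder_sum => // [v|v|v||]; try exact: pow0_ge0.
- have := psi_ge0 (zip u v); rewrite le_eqVlt => /orP[/eqP<-|h].
    by left; rewrite pow00.
  right; rewrite !pow0E//; split; rewrite ?expR_gt0//.
  by rewrite ler_expR !expRK; move: (ln (psi _)) => z; lra.
- exact: fiber_pow_gt0.
- exact: fiber_pow_gt0.
Qed.

(** Hoelder's inequality is used twice: along the fibers it makes ln I_q convex in q, and over the
    base words it passes this on to the pressure. *)
Lemma skew_pressure_convex x y t : 0 <= t <= 1 ->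
  P ((1 - t) * x + t * y) <= (1 - t) * P x + t * P y.
Proof.
move=> t01; have s0 : 0 <= s by case/andP: s01 => /ltW.
have hp q' := quasi_mult_fiber_pows s hpsi q'.
apply: (pressure_le_convex Sa1 t01 (hp _) (hp _) (hp _)) => n.
have Zp q' := quasi_mult_ws_gt0 (hp q') Sa1 n.
rewrite -ler_expR lnK ?posrE//; apply: hoelder_sum => // [u|u|u||];
  try exact: pow0_ge0; try exact: Zp.
have [Su|Su] := boolP (all S1 u); last first.
  by left; rewrite fiber_pow_eq0// pow00.
have Jp q' := fiber_pow_gt0 q' Su.
move: (ler_wpM2l s0 (fiber_pow_convex x y t01 Su)) (Jp x) (Jp y) (Jp ((1 - t) * x + t * y)).
move: (J x u) (J y u) (J _ u) => a b d h a0' b0 d0.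
right; rewrite !pow0E//; split; rewrite ?expR_gt0// ler_expR !expRK.
by move: (ln _) (ln _) (ln _) h => a' b' d'; lra.
Qed.

Lemma skew_pressure_mono q q' : (forall w, psi w <= 1) -> q <= q' -> P q' <= P q.
Proof.
move=> psi1 qq'; have s0 : 0 <= s by case/andP: s01 => /ltW.
have hp q' := quasi_mult_fiber_pows s hpsi q'.
apply: (pressure_le Sa1 (hp _) (hp _)) => n; apply: ler_ws => u _.
have [Su|Su] := boolP (all S1 u); last by rewrite !fiber_pow_eq0.
have Jp q'' := fiber_pow_gt0 q'' Su.
rewrite (pow0E _ (Jp q')) (pow0E _ (Jp q)) ler_expR ler_wpM2l// ler_ln ?posrE//.
apply: ler_ws => v _.
have := psi_ge0 (zip u v); rewrite le_eqVlt => /orP[/eqP<-|h]; first by rewrite !pow00.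
rewrite !pow0E// ler_expR; have := ln_le0 (psi1 (zip u v)).
by move: (ln _) => z; nra.
Qed.

Lemma skew_pressure_near q : exists b : R, forall eta : R, 0 < eta ->
  exists2 t0 : R, 0 < t0 & forall t, `|t| <= t0 ->
    P (q + t) <= P q + b * t + eta * `|t|.
Proof.
have [b hb] := pressure_tilt_near (quasi_mult_skew_weight s hpsi q) Sa0 c0 psi_ln.
have /andP[s0 s1] := s01.
(* The factor s comes from the Hoelder exponent; this is why slopes of P are divided by s when they
   are read as growth rates of ln psi. *)
exists (s * b) => eta eta0; have [t0 t00 h] := hb _ eta0; exists t0 => // t /h.
rewrite pressure_skew_weight; have := skew_pressure_tilt q t.
have : 0 <= eta * `|t| by rewrite mulr_ge0 ?(ltW eta0).
move: (P q) (P (q + t)) (pressure _) (eta * _) => x y z e e0 h1 h2.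
have := ler_wpM2l (ltW s0) h2; have : s * e <= e by rewrite ler_piMl.
lra.
Qed.

End SkewPressure.

(** * Penalised minimisation of alpha q - T(q) *)

Section ApproximateMinimizer.
Context {R : realType}.
Variables (T a : R -> R) (alpha D eta : R).
Hypothesis T_derivable : forall q, derivable T q 1.
Hypothesis T_slope : forall q (e : R), 0 < e -> exists2 t0 : R, 0 < t0 &
  forall t, `|t| <= t0 -> T q + a q * t - e * `|t| <= T (q + t).
Hypothesis eta0 : 0 < eta.
Hypothesis hD : forall q, D <= alpha * q - T q.

Let f q := alpha * q - T q + eta * `|q|.

Let f_cont : continuous f.
Proof.
move=> q; apply: cvgD; first apply: cvgB.
- by apply: cvgMr; exact: cvg_id.
- by apply/differentiable_continuous/derivable1_diffP.
- by apply: cvgMr; apply: cvg_norm; exact: cvg_id.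
Qed.

Let f_min : exists q, forall x, f q <= f x.
Proof.
(* Beyond |q| = M the penalty alone exceeds f 0 - D, so a minimum over [-M, M] is global. *)
pose M := (f 0 - D) / eta + 1.
have f0 : D <= f 0 by have := hD 0; rewrite /f normr0 !mulr0 addr0.
have M0 : 0 <= M by rewrite addr_ge0// divr_ge0 ?(ltW eta0)// subr_ge0.
have hM : - M <= M by lra.
have [|q qM hq] := @EVT_min R f _ _ hM; first exact: continuous_subspaceT.
exists q => x; have [xM|xM] := leP `|x| M.
  by apply: hq; rewrite in_itv/= -ler_norml.
apply: (@le_trans _ _ (f 0)); first by apply: hq; rewrite in_itv/= oppr_le0 M0.
have := hD x; have : f 0 - D <= eta * `|x|.
  rewrite mulrC -ler_pdivrMr//; apply: ltW; apply: lt_trans xM.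
  by rewrite /M ltrDl.
have -> : f x = alpha * x - T x + eta * `|x| by [].
move: (f 0) (T x) => *; lra.
Qed.

(* At a minimiser of alpha q - T q + eta |q| the penalty perturbs the slope by at most
   eta, and in the direction that increases a q - T q. *)
Lemma legendre_approx : exists2 q, `|a q - alpha| <= eta & D <= a q * q - T q.
Proof.
have [q hq] := f_min; exists q.
  apply/ler_addgt0Pr => e e0; have [t0 t00 ht] := T_slope q e0.
  have H t : `|t| <= t0 -> (a q - alpha) * t <= (eta + e) * `|t|.
    move=> /ht; have := hq (q + t); rewrite /f; have := ler_normD q t.
    move=> /(ler_wpM2l (ltW eta0)); rewrite mulrDr.
    by move: (T q) (T (q + t)) => *; lra.
  have := H t0; rewrite (gtr0_norm t00) ler_pM2r// => /(_ (lexx _)) h1.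
  have := H (- t0); rewrite normrN (gtr0_norm t00) => /(_ (lexx _)) h2.
  rewrite ler_norml; apply/andP; split; last by [].
  by rewrite -(ler_pM2r t00); lra.
have fE : D <= alpha * q - T q + eta * `|q|.
  have := hD q; have : 0 <= eta * `|q| by apply: mulr_ge0 => //; exact: ltW.
  by move: (T q) => *; lra.
apply: (le_trans fE); rewrite [X in X + _]addrC -addrA [leRHS]addrC lerD2l.
apply/ler_addgt0Pr => e e0; have [->|qn] := eqVneq q 0.
  by rewrite normr0 !mulr0 !addr0 add0r ltW.
have q0 : 0 < `|q| by rewrite normr_gt0.
have [t0 t00 ht] := T_slope q (divr_gt0 e0 q0).
(* The minimiser is compared with (1 - th) q: shrinking q lowers the penalty by th eta |q|. *)
pose th := Num.min 1 (t0 / `|q|).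
have th0 : 0 < th by rewrite lt_min ltr01 divr_gt0.
have th1 : th <= 1 by rewrite ge_min lexx.
have := ht (- (th * q)); rewrite normrN normrM (gtr0_norm th0).
have -> : th * `|q| <= t0 by rewrite -ler_pdivlMr// ge_min lexx orbT.
move=> /(_ isT); have := hq (q + - (th * q)); rewrite /f.
have -> : q + - (th * q) = (1 - th) * q by ring.
rewrite normrM (ger0_norm (_ : 0 <= 1 - th)) ?subr_ge0//.
have -> : e / `|q| * (th * `|q|) = th * e by field; rewrite gt_eqF.
move: (T q) (T _) => x y h1 h2.
have : th * (alpha * q + eta * `|q|) <= th * (a q * q + e) by lra.
by rewrite ler_pM2l.
Qed.

End ApproximateMinimizer.

(** * Typical words *)

Section Concentration.
Context {R : realType} {A1 A2 : finType}.
Variables (c s : R) (S : pred (A1 * A2)) (psi : seq (A1 * A2) -> R) (a0 : A1 * A2).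
Hypothesis (hpsi : quasi_mult c S psi) (Sa0 : S a0) (s01 : 0 < s <= 1).

Local Notation S1 := (proj1_pred S).
Local Notation J := (fiber_pow psi).
Local Notation P := (skew_pressure s psi).

Variables (q b : R).
Hypothesis P_near : forall eta : R, 0 < eta -> exists2 t0 : R, 0 < t0 &
  forall t, `|t| <= t0 -> P (q + t) <= P q + b * t + eta * `|t|.

(** The decay rate of psi that is typical for the skew weight at q. *)
Let beta := - (b / s).
Let g := skew_weight s psi q.
Let Sa1 : S1 a0.1. Proof. exact: proj1_pred0 Sa0. Qed.
Let s0 : 0 < s. Proof. by case/andP: s01. Qed.
Let psi_ge0 w : 0 <= psi w. Proof. exact: quasi_mult_ge0 hpsi w. Qed.
Let g_ge0 w : 0 <= g w.
Proof. exact: quasi_mult_ge0 (quasi_mult_skew_weight s hpsi q) w. Qed.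

(* Concavity of x^s turns a deviation of psi carrying a positive proportion of the
   mass into a lower bound for the pressure at q + t. *)
Lemma deviation_bound (t x : R) n :
  ws n (fun w => g w * (x <= t * ln (psi w))%R%:R) <=
  expR (- (s * x)) * ws n (fun u => pow0 (J (q + t) u) s).
Proof.
pose K (u : seq A1) := fiber_ws
  (fun w => pow0 (psi w) q * (x <= t * ln (psi w))%R%:R) u.
have K0 u : 0 <= K u by apply: ws_ge0 => v _; rewrite mulr_ge0 ?pow0_ge0.
have KJ u : K u <= J q u.
  by apply: ler_ws => v _; rewrite ler_piMr ?pow0_ge0// lern1 leq_b1.
have KJt u : expR x * K u <= J (q + t) u.
  rewrite -wsZ; apply: ler_ws => v _.
  case: (boolP (x <= _)) => h; last by rewrite !mulr0 pow0_ge0.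
  have := psi_ge0 (zip u v); rewrite mulr1 le_eqVlt => /orP[/eqP<-|hp].
    by rewrite !pow00 mulr0.
  rewrite !pow0E// -expRD ler_expR mulrDl addrC lerD2l.
  exact: h.
have -> : ws n (fun w => g w * (x <= t * ln (psi w))%R%:R) =
    ws n (fun u => pow0 (J q u) (s - 1) * K u).
  rewrite -(skew_weight_fiber s psi q
    (fun w => pow0 (psi w) q * (x <= t * ln (psi w))%R%:R)).
  by apply: eq_ws => w _; rewrite /g /skew_weight mulrA.
rewrite -wsZ; apply: ler_ws => u _.
have := K0 u; rewrite le_eqVlt => /orP[/eqP<-|Kp].
  by rewrite mulr0 mulr_ge0 ?expR_ge0 ?pow0_ge0.
have Jp : 0 < J q u := lt_le_trans Kp (KJ u).
have KJt' := KJt u; have Jtp : 0 < J (q + t) u.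
  by apply: lt_le_trans KJt'; rewrite mulr_gt0 ?expR_gt0.
(* From k <= j, e^x k <= j' and s <= 1: j^(s-1) k <= k^s <= e^(-s x) j'^s. *)
move: (KJ u) KJt' Kp Jp Jtp; move: (K u) (J q u) (J (q + t) u) => k j j' kj kj' k0 j0 j0'.
rewrite !pow0E// -[X in _ * X]lnK ?posrE// -!expRD ler_expR.
move: kj' kj; rewrite -ler_ln ?posrE ?mulr_gt0 ?expR_gt0//.
rewrite lnM ?posrE ?expR_gt0// expRK -(ler_ln (x := k)) ?posrE//.
have /andP[_ s1] := s01.
move: (ln k) (ln j) (ln j') => y y1 y2 h1 h2.
have := ler_wpM2l (ltW s0) h1; have s1' : 0 <= 1 - s by rewrite subr_ge0.
by have := ler_wpM2l s1' h2; lra.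
Qed.

(** Each tail is an exponential Markov inequality, through [deviation_bound] at t0 or - t0. The
    slope b cancels the linear term of P (q + t), and a gain n t0 s eta / 2 remains to absorb the
    constants. *)
Lemma chernoff (eta : R) : 0 < eta -> exists n0 : nat, forall n, (n0 <= n)%N ->
  ws n (fun w => g w * (n%:R * eta <= `|ln (psi w) + n%:R * beta|)%R%:R) <=
  ws n g / 2.
Proof.
move=> eta0; have [|t0 t00 ht] := @P_near (s * eta / 2); first by rewrite !mulr_gt0.
pose C t := `|s| * (`|q + t| * c).
pose C1 := `|s| * (`|q| * c).
(* For t = t0, resp. t = - t0, the condition [x t n <= t * ln (psi w)] says that ln (psi w) + n beta
   is at least n eta, resp. at most - n eta. *)
pose x (t : R) (n : nat) := t * (n%:R * - beta) + n%:R * (t0 * eta).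
pose CC := C t0 + C (- t0) + C1.
have cc : 0 <= c by case: hpsi => -[].
have C0 t : 0 <= C t by rewrite !mulr_ge0.
have hp q' := quasi_mult_fiber_pows s hpsi q'.
have [n0 hn0] : exists n0 : nat, (CC + ln 4) / (t0 * (s * eta / 2)) < n0%:R.
  by exists (Num.truncn ((CC + ln 4) / (t0 * (s * eta / 2)))).+1; apply: truncnS_gt.
exists n0 => n hn.
have {hn0}hn : CC + ln 4 <= n%:R * (t0 * (s * eta / 2)).
  by rewrite -ler_pdivrMr ?mulr_gt0//; apply: (le_trans (ltW hn0)); rewrite ler_nat.
have one t : `|t| = t0 -> ws n (fun w => g w * (x t n <= t * ln (psi w))%R%:R) <= ws n g
  / 4.
  move=> tt0; apply: (le_trans (deviation_bound t (x t n) n)).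
  have tC : C t + C1 <= CC.
    have tt : t = t0 \/ t = - t0.
      move: tt0; case: (ltrgt0P t) => [_ ->|_ <-|-> te]; [by left|by right; rewrite opprK|].
      by move: t00; rewrite -te ltxx.
    rewrite /CC; have := C0 t0; have := C0 (- t0).
    by case: tt => ->; move: (C t0) (C (- t0)) => *; lra.
  have h1 := pressure_upper (hp (q + t)) Sa1 n.
  have h2 := pressure_lower (hp q) Sa1 n.
  rewrite /g (ws_skew_weight s hpsi).
  apply: (le_trans (ler_wpM2l (expR_ge0 _) h1)).
  apply: (@le_trans _ _ (expR (n%:R * P q - C1) / 4)); last by rewrite ler_pM2r.
  rewrite -[X in _ / X](@lnK _ 4) ?posrE// -expRD -expRB ler_expR.
  have := ht t; rewrite tt0 lexx => /(_ isT); rewrite -/(P (q + t)) -/(P q) -/(C t) -/C1.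
  move: (P q) (P (q + t)) => p p' hh.
  have := ler_wpM2l (ler0n R n) hh.
  have sb : s * beta = - b by rewrite /beta; field; rewrite gt_eqF.
  have -> : s * x t n = - (n%:R * t * (s * beta)) + n%:R * (s * t0 * eta).
    by rewrite /x; ring.
  rewrite sb; move: tC hn; move: (C t) (ln 4) => y z; clear h1 h2; clearbody CC;
    clearbody C1; lra.
have pt w : g w * (n%:R * eta <= `|ln (psi w) + n%:R * beta|)%R%:R <=
    g w * (x t0 n <= t0 * ln (psi w))%R%:R +
    g w * (x (- t0) n <= - t0 * ln (psi w))%R%:R.
  case: (boolP (n%:R * eta <= `|ln (psi w) + n%:R * beta|)) => h; last first.
    by rewrite mulr0; apply: addr_ge0; apply: mulr_ge0.
  rewrite mulr1; move: h; rewrite ler_normr => /orP[] h.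
    have -> : x t0 n <= t0 * ln (psi w).
      by rewrite /x; have := ler_wpM2l (ltW t00) h; lra.
    by rewrite mulr1 lerDl; apply: mulr_ge0.
  have -> : x (- t0) n <= - t0 * ln (psi w).
    by rewrite /x; have := ler_wpM2l (ltW t00) h; lra.
  by rewrite mulr1 lerDr; apply: mulr_ge0.
have := ler_ws (fun w (_ : size w = n) => pt w); rewrite wsD.
have := one t0 (gtr0_norm t00).
have := one (- t0); rewrite normrN gtr0_norm// => /(_ erefl).
move: (ws n _) (ws n _) (ws n _) (ws n _) => *; lra.
Qed.

End Concentration.

(** * Blocks of typical words *)

Section MoranBlock.
Context {R : realType} {A1 A2 : finType}.
Implicit Types (S : pred (A1 * A2)) (psi m : seq (A1 * A2) -> R).

(* Weights on words of length N which see psi decaying at rate beta, and for which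
   e1 and e2 are lower bounds for the entropy of the projection to A1 and for the
   conditional entropy along the fibers. *)
Definition moran_block S psi (beta e1 e2 eta : R) (N : nat) m : Prop :=
  [/\ forall w, 0 <= m w, ws N m = 1,
      forall w, size w = N -> 0 < m w ->
        all S w /\ `|ln (psi w) + N%:R * beta| <= N%:R * eta,
      forall w, size w = N -> m w <= expR (- (N%:R * (e1 + e2 - eta))) &
      forall u, size u = N -> fiber_ws m u <= expR (- (N%:R * (e1 - eta)))].

Variables (c s : R) (S : pred (A1 * A2)) (psi : seq (A1 * A2) -> R) (a0 : A1 * A2).
Hypothesis (hpsi : quasi_mult c S psi) (Sa0 : S a0) (s01 : 0 < s <= 1).

Local Notation S1 := (proj1_pred S).
Local Notation J := (fiber_pow psi).
Local Notation P := (skew_pressure s psi).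

Variables (q b : R).
Hypothesis P_near : forall eta : R, 0 < eta -> exists2 t0 : R, 0 < t0 &
  forall t, `|t| <= t0 -> P (q + t) <= P q + b * t + eta * `|t|.

Let Sa1 : S1 a0.1. Proof. exact: proj1_pred0 Sa0. Qed.
Let s0 : 0 < s. Proof. by case/andP: s01. Qed.

(* Among the words with the typical decay of psi, the pigeonhole principle selects a
   positive proportion on which I_q has a prescribed growth rate h. *)
Lemma typical_window (omega eta : R) : 0 < omega -> 0 < eta ->
  exists m0 : nat, exists n0 : nat, forall N, (n0 <= N)%N ->
  exists (G : seq (A1 * A2) -> bool) (h : R),
    [/\ forall w, size w = N -> all S w -> G w ->
          `|ln (psi w) + N%:R * - (b / s)| <= N%:R * eta /\
          N%:R * h <= ln (J q (unzip1 w)) <= N%:R * (h + omega) &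
        ws N (skew_weight s psi q) <=
        m0.+1%:R * 2 * ws N (fun w => skew_weight s psi q w * (G w)%:R)].
Proof.
move=> omega0 eta0.
have [K K0 hK] := quasi_mult_on_ln_bound (quasi_mult_fiber_pow hpsi q).1.
set cJ := `|q| * c in hK.
have [n1 h1] := chernoff hpsi Sa0 s01 P_near eta0.
(* For N > cJ the quotient ln I_q / N stays in [- kp, kp], so the number of windows of width omega
   needed does not depend on N. *)
pose kp := K + 1.
pose m0 := Num.truncn (2 * kp / omega).
exists m0, (maxn n1 (Num.truncn cJ).+1) => N.
rewrite geq_max => /andP[/h1 hN hN2].
have NcJ : cJ < N%:R := lt_of_truncn hN2.
have N0 : (0 : R) < N%:R by rewrite ltr0n; case: (N) hN2.
set g := skew_weight s psi q in hN *.
have g_ge0 w : 0 <= g w := quasi_mult_ge0 (quasi_mult_skew_weight s hpsi q) w.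
pose G1 (w : seq (A1 * A2)) := ~~ (N%:R * eta <= `|ln (psi w) + N%:R * - (b / s)|).
pose idx (w : seq (A1 * A2)) := Num.truncn ((ln (J q (unzip1 w)) / N%:R + kp) / omega).
pose F (j : nat) (w : seq (A1 * A2)) : R := g w * (G1 w && (idx w == j))%:R.
have range (w : seq (A1 * A2)) : size w = N -> all S w ->
    0 <= (ln (J q (unzip1 w)) / N%:R + kp) / omega <= 2 * kp / omega.
  move=> sw Sw; have := hK _ (all_unzip1 Sw); rewrite size_map sw.
  move: (ln _) => x; rewrite ler_norml => /andP[x1 x2].
  apply/andP; split.
    apply: divr_ge0; last exact: ltW.
    rewrite -(pmulr_rge0 _ N0) mulrDr mulrCA divff ?gt_eqF// mulr1 /kp; lra.
  rewrite ler_pM2r ?invr_gt0// -(ler_pM2l N0) mulrDr mulrCA divff ?gt_eqF//.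
  by rewrite mulr1 /kp; lra.
have idx_lt (w : seq (A1 * A2)) : size w = N -> all S w -> (idx w < m0.+1)%N.
  move=> sw Sw; rewrite ltnS /idx /m0; apply: le_truncn.
  by case/andP: (range _ sw Sw).
have split_sum : ws N g <= 2 * \sum_(j < m0.+1) ws N (F j).
  have e1 : ws N g <= ws N (fun w => g w * (N%:R * eta <= `|ln (psi w) + N%:R * - (b /
    s)|)%R%:R)
     + \sum_(j < m0.+1) ws N (F j).
    rewrite -(ws_sum N (fun (j : 'I_m0.+1) (w : seq (A1 * A2)) => F j w)) -wsD.
    apply: ler_ws => w sw; rewrite /F -mulr_sumr -mulrDr.
    have [Sw|Sw] := boolP (all S w); last first.
      by case: (quasi_mult_skew_weight s hpsi q) => _ /(_ _ Sw) e; rewrite /g e mul0r.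
    rewrite ler_peMr// /G1; case: (boolP (_ <= `|_|)) => hh /=.
      by rewrite lerDl sumr_ge0.
    by rewrite add0r (bigD1 (Ordinal (idx_lt _ sw Sw))) //= eqxx lerDl sumr_ge0.
  move: hN e1; move: (ws N _) (ws N g) (\sum_(j < _) _) => *; lra.
have [j hj] : exists j : 'I_m0.+1,
    ws N g <= m0.+1%:R * 2 * ws N (F j).
  apply: contrapT => hn.
  have hlt (j : 'I_m0.+1) : 2 * ws N (F j) <
     ws N g / m0.+1%:R.
    rewrite ltr_pdivlMr// ltNge mulrC mulrA; apply/negP => hj; apply: hn.
    by exists j.
  have : 2 * \sum_(j < m0.+1) ws N (F j) < ws N g.
    rewrite mulr_sumr; apply: (@lt_le_trans _ _ (\sum_(j < m0.+1) (ws N g / m0.+1%:R))).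
      apply: ltr_sum => [|i _]; last exact: hlt.
      by apply/hasP; exists ord0; rewrite ?mem_index_enum.
    by rewrite sumr_const card_ord -[leLHS]mulr_natl mulrC divfK ?pnatr_eq0.
  by rewrite ltNge split_sum.
exists (fun w => G1 w && (idx w == j)), (j%:R * omega - kp); split; last exact: hj.
move=> w sw Sw /andP[G1w /eqP ij]; split.
  by move: G1w; rewrite /G1 -ltNge => /ltW.
have /andP[r0 _] := range _ sw Sw; have := truncn_itv r0.
rewrite -/(idx w) ij => /andP[]; rewrite ler_pdivlMr// ltr_pdivrMr//.
move: (ln _) => x h2 h3; rewrite -natr1 in h3.
have xE : x = N%:R * (x / N%:R) by rewrite mulrCA divff ?gt_eqF// mulr1.
rewrite [X in _ <= X <= _]xE; apply/andP; split; rewrite ler_pM2l//; lra.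
Qed.

(** The block is the skew weight restricted to a window of [typical_window] and normalised. With I_q
    close to e^(N h) on the window, a fiber has mass about e^(- N (P - s h)), so e1 = P - s h, and
    the entropy left along the fibers is h - q b / s. The bounds on e1 do not depend on eta or N0,
    so a cluster point can be taken later. *)
Lemma moran_block_exists (eta : R) (N0 : nat) : 0 < eta <= 1 ->
  exists N e1 m, [/\ (N0 <= N)%N, (0 < N)%N, -1 <= e1 <= ln #|A1|%:R + 1 &
    moran_block S psi (- (b / s)) e1 ((P q - e1) / s + q * - (b / s)) eta N m].
Proof.
move=> /andP[eta0 eta1].
(* Deviations of ln psi enter the weights multiplied by q. *)
pose eta' := eta / (4 * (`|q| + 1)).
have q1 : 0 < `|q| + 1 by have := normr_ge0 q; lra.
have eta'0 : 0 < eta' by rewrite divr_gt0 ?mulr_gt0.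
have qeta' : `|q| * eta' <= eta / 4.
  have -> : eta / 4 = (`|q| + 1) * eta' by rewrite /eta'; field; rewrite gt_eqF.
  by rewrite ler_pM2r// lerDl.
have eta'eta : eta' <= eta.
  rewrite ler_pdivrMr ?mulr_gt0//; have := normr_ge0 q; nra.
have omega0 : 0 < eta / 4 by rewrite divr_gt0.
have [m0 [n0 hw]] := typical_window omega0 eta'0.
set beta := - (b / s) in hw *.
have hp := quasi_mult_fiber_pows s hpsi q.
set C := `|s| * (`|q| * c) in hp.
have C0 : 0 <= C by case: hp => -[].
pose x := (ln (m0.+1%:R * 2) + C) / (eta / 4).
pose N := (N0 + n0 + (Num.truncn x).+1 + (Num.truncn C).+1)%N.
have NN0 : (N0 <= N)%N by rewrite /N -!addnA leq_addr.
have Nn0 : (n0 <= N)%N by rewrite /N; apply: leq_trans (leq_addr _ _);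
  apply: leq_trans (leq_addr _ _); apply: leq_addl.
have Npos : (0 < N)%N by rewrite /N addnS.
have Nx : x < N%:R.
  by apply: lt_of_truncn; rewrite /N; apply: leq_trans (leq_addr _ _); apply: leq_addl.
have NC : C < N%:R by apply: lt_of_truncn; rewrite /N; apply: leq_addl.
clearbody N.
have NR : (0 : R) < N%:R by rewrite ltr0n.
have {}Nx : ln (m0.+1%:R * 2) + C <= N%:R * (eta / 4).
  by rewrite -ler_pdivrMr// ltW.
have [G [h [hG hmass]]] := hw _ Nn0.
set g := skew_weight s psi q in hmass *.
have g_ge0 w : 0 <= g w := quasi_mult_ge0 (quasi_mult_skew_weight s hpsi q) w.
have gE : ws N g = ws N (fun u => pow0 (J q u) s) := ws_skew_weight s hpsi q N.
have Zlow := pressure_lower hp Sa1 N; have Zup := pressure_upper hp Sa1 N.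
rewrite -gE -/(P q) in Zlow Zup.
have Z0 : 0 < ws N g by apply: lt_le_trans Zlow; apply: expR_gt0.
set M := ws N (fun w => g w * (G w)%:R) in hmass.
have m02 : 0 < m0.+1%:R * 2 :> R by rewrite mulr_gt0.
have M0 : 0 < M by rewrite -(pmulr_rgt0 _ m02); apply: lt_le_trans hmass.
have MV : M^-1 <= expR (N%:R * (eta / 4) - N%:R * P q).
  rewrite -[X in _ <= X]invrK -expRN lef_pV2 ?posrE ?expR_gt0//.
  rewrite -(ler_pM2l m02); apply: le_trans hmass; apply: le_trans Zlow.
  rewrite -[X in X * _]lnK ?posrE// -expRD ler_expR.
  by move: (ln _) (P q) Nx => *; lra.
pose m (w : seq (A1 * A2)) := if all S w && G w then M^-1 * g w else 0.
have mE w : size w = N -> m w = M^-1 * (g w * (G w)%:R).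
  move=> sw; rewrite /m; have [Sw|Sw] /= := boolP (all S w).
    by case: (G w); rewrite ?mulr1 ?mulr0.
  by case: (quasi_mult_skew_weight s hpsi q) => _ /(_ _ Sw); rewrite -/g => ->;
    rewrite mul0r mulr0.
have m_ge0 w : 0 <= m w.
  by rewrite /m; case: ifP => // _; rewrite mulr_ge0 ?invr_ge0 ?g_ge0 ?ltW.
have m_sum : ws N m = 1.
  by rewrite (eq_ws mE) wsZ mulVf ?gt_eqF.
pose e1 := P q - s * h.
have e2E : (P q - e1) / s + q * beta = h + q * beta.
  by rewrite /e1; field; rewrite gt_eqF.
have /andP[_ s1] := s01.
have m_word w : size w = N -> m w <= expR (- (N%:R * (e1 + (h + q * beta) - eta))).
  move=> sw; rewrite /m; case: ifP => [/andP[Sw Gw]|_]; last exact: expR_ge0.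
  have [hpsiw /andP[hJ1 _]] := hG _ sw Sw Gw.
  have Jp : 0 < J q (unzip1 w) := fiber_pow_gt0 hpsi q (all_unzip1 Sw).
  have pp : 0 < psi w by case: hpsi => -[_ hh _] _; apply: hh.
  rewrite /g /skew_weight !pow0E// -expRD.
  apply: (le_trans (ler_wpM2r (expR_ge0 _) MV)); rewrite -expRD ler_expR.
  have h2 : q * (ln (psi w) + N%:R * beta) <= N%:R * (eta / 4).
    apply: (le_trans (ler_norm _)); rewrite normrM.
    apply: (le_trans (ler_wpM2l (normr_ge0 _) hpsiw)).
    by rewrite mulrCA ler_pM2l.
  have h3 : (s - 1) * ln (J q (unzip1 w)) <= (s - 1) * (N%:R * h).
    by rewrite ler_wnM2l// subr_le0.
  have : 0 < N%:R * eta by rewrite mulr_gt0.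
  rewrite /e1; move: (ln _) (ln _) (P q) h2 h3 => *; lra.
have m_fiber u : size u = N -> fiber_ws m u <= expR (- (N%:R * (e1 - eta))).
  move=> su; have [uh|uh] := boolP (all S1 u && (ln (J q u) <= N%:R * (h + eta / 4)));
    last first.
    rewrite /fiber_ws; have -> : ws (size u) (fun v => m (zip u v)) = ws (size u) (fun _
      : seq A2 => 0).
      apply: eq_ws => v sv; rewrite /m; case: ifP => // /andP[Sw Gw].
      have sw : size (zip u v) = N by rewrite size_zip sv minnn su.
      have [_ /andP[_ hJ]] := hG _ sw Sw Gw.
      move: uh; rewrite unzip1_zip ?sv// in hJ; rewrite hJ andbT.
      by rewrite (all_zip_proj1 _ Sw)// sv.
    by rewrite ws_const mulr0 expR_ge0.
  have /andP[Su hJ] := uh; have Jp := fiber_pow_gt0 hpsi q Su.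
  apply: (@le_trans _ _ (M^-1 * (pow0 (J q u) (s - 1) * J q u))).
    rewrite /fiber_ws -!wsZ; apply: ler_ws => v sv.
    rewrite /m; case: ifP => _; rewrite /g /skew_weight ?unzip1_zip ?sv//.
    by rewrite !mulr_ge0 ?invr_ge0 ?pow0_ge0 ?ltW.
  rewrite pow0_subK ?(ltW Jp)// pow0E//.
  apply: (le_trans (ler_wpM2r (expR_ge0 _) MV)); rewrite -expRD ler_expR.
  have : s * ln (J q u) <= s * (N%:R * (h + eta / 4)) by rewrite ler_pM2l.
  have : s * (N%:R * eta) <= N%:R * eta by rewrite ler_piMl// mulr_ge0 ?ltW.
  have : 0 < N%:R * eta by rewrite mulr_gt0.
  by rewrite /e1; move: (ln _) (P q) => *; lra.
have A1pos : (0 : R) < #|A1|%:R.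
  by rewrite ltr0n; apply/card_gt0P; exists a0.1.
(* The #|A1|^N fiber masses sum to 1 and each is at most e^(- N (e1 - eta)). *)
have e1_up : e1 <= ln #|A1|%:R + 1.
  have : 1 <= #|A1|%:R ^+ N * expR (- (N%:R * (e1 - eta))).
    rewrite -[X in X <= _]m_sum ws_zip -ws_const; apply: ler_ws => u su.
    by have := m_fiber _ su; rewrite /fiber_ws su.
  rewrite -[#|A1|%:R]lnK ?posrE// -expRM_natl -expRD -[X in X <= _]expR0 ler_expR expRK
    => hh.
  have : N%:R * eta <= N%:R by rewrite ler_piMr ?(ltW NR).
  move=> hN; have : N%:R * e1 <= N%:R * (ln #|A1|%:R + 1) by move: (ln _) hh => z hh; lra.
  by rewrite ler_pM2l.
(* A single term I_q^s of the partition sum, taken on the window, is at most e^(C + N P). *)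
have e1_low : -1 <= e1.
  have [w sw] := ws_gt0_ex M0.
  case: (boolP (all S w && G w)) => [/andP[Sw Gw] _|]; last first.
    have := mE _ sw; rewrite /m => + /negbTE ww; rewrite ww => e /(mulr_gt0 (_ : 0 < M^-1)).
    by rewrite invr_gt0 => /(_ M0); rewrite -e ltxx.
  have [_ /andP[hJ1 _]] := hG _ sw Sw Gw.
  have Jp : 0 < J q (unzip1 w) := fiber_pow_gt0 hpsi q (all_unzip1 Sw).
  have : pow0 (J q (unzip1 w)) s <= ws N g.
    rewrite gE; apply: (ws_le_term (F := fun u => pow0 (J q u) s)) => [u _|].
      exact: pow0_ge0.
    by rewrite size_map.
  move=> /le_trans/(_ Zup); rewrite pow0E// ler_expR.
  have : s * (N%:R * h) <= s * ln (J q (unzip1 w)) by rewrite ler_pM2l.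
  rewrite /e1 => h2 h3; rewrite -(ler_pM2l NR).
  by move: (ln _) (P q) h2 h3 => *; lra.
exists N, e1, m; split => //; first by rewrite e1_low.
split => // [w sw|w sw]; last by rewrite e2E; apply: m_word.
rewrite /m; case: ifP => [/andP[Sw Gw] _|_]; last by rewrite ltxx.
split => //; have [hh _] := hG _ sw Sw Gw; apply: (le_trans hh).
by rewrite ler_pM2l.
Qed.

End MoranBlock.

(** * Moran sets *)

Section Agreement.
Context {A : eqType}.

(** Compares only the first min (l, size u) letters: u may be shorter than l, in which case it is
    only required to be compatible with the prescribed prefix. *)
Fixpoint agr (x : nat -> A) (l : nat) (u : seq A) {struct u} : bool :=
  match u, l with
  | a :: u', l'.+1 => (a == x 0%N) && agr (fun i => x i.+1) l' u'
  | _, _ => true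
  end.

Lemma agr_cat x l u v :
  agr x l (u ++ v) = agr x l u && agr (fun i => x (size u + i)%N) (l - size u) v.
Proof.
elim: u x l => [|a u IH] x l; first by rewrite /= subn0.
case: l => [|l] /=; first by rewrite sub0n; case: (v).
by rewrite IH andbA.
Qed.

Lemma agr_eq x l u : (size u <= l)%N -> agr x l u -> u = mkseq x (size u).
Proof.
elim: u x l => [|a u IH] x [|l] //= ul /andP[/eqP -> h].
rewrite /mkseq /= -[1%N]addn0 iotaDl -map_comp; congr cons.
by rewrite {1}(IH _ _ ul h).
Qed.

Lemma agr_mkseq x l (z : nat -> A) n :
  (forall m, (m < l)%N -> z m = x m) -> agr x l (mkseq z n).
Proof.
elim: n x l z => [|n IH] x [|l] z h //=.
rewrite h// eqxx /= -[1%N]addn0 iotaDl -map_comp; apply: IH => m ml /=.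
by rewrite add1n h.
Qed.

Lemma agr_short x l u : (l <= 0)%N -> agr x l u.
Proof. by case: l => // _; case: u. Qed.

End Agreement.

Section SlowSequence.
Variable N : nat -> nat.

(** The block type in use at stage j. It advances to k only after at least k [N k] stages, so that
    the next block is always short compared with the total length so far. *)
Fixpoint slow (j : nat) : nat :=
  if j is j'.+1 then
    if ((slow j').+1 * N (slow j').+1 <= j')%N then (slow j').+1 else slow j'
  else 0%N.

Lemma slow_le j : (slow j * N (slow j) <= j)%N.
Proof.
elim: j => // j IH /=; case: ifP => h; first exact: leqW.
exact: leqW.
Qed.

Lemma slow_unbounded K : exists j0, forall j, (j0 <= j)%N -> (K <= slow j)%N.
Proof.
have mono j : (slow j <= slow j.+1)%N by rewrite /=; case: ifP.
elim: K => [|K [j0 IH]]; first by exists 0%N.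
pose j1 := maxn j0 (K.+1 * N K.+1); exists j1.+1 => j hj.
have h1 : (K.+1 <= slow j1.+1)%N.
  have := IH j1 (leq_maxl _ _); rewrite leq_eqVlt => /orP[/eqP e|h].
    by rewrite /= -e leq_maxr.
  exact: leq_trans h (mono _).
elim: j hj => // j IHj; rewrite leq_eqVlt => /orP[/eqP <- //|hj].
exact: leq_trans (IHj hj) (mono _).
Qed.

End SlowSequence.

(** * Product masses of words and of boxes *)

Section MoranMass.
Context {R : realType} {A1 A2 : finType}.
Variables (c : R) (S : pred (A1 * A2)) (psi : seq (A1 * A2) -> R) (a0 : A1 * A2).
Hypothesis hpsi : quasi_mult c S psi.
Variables (beta e1 e2 : R) (n_ : nat -> nat) (ee : nat -> R).
Variable mm : nat -> seq (A1 * A2) -> R.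
Hypothesis n_gt0 : forall j, (0 < n_ j)%N.
Hypothesis hmm : forall j, moran_block S psi beta e1 e2 (ee j) (n_ j) (mm j).
Hypothesis n_slow : forall e : R, 0 < e -> exists A : R, forall j,
  (n_ j)%:R <= e * (\sum_(i < j) n_ i)%:R + A.
Hypothesis ee_slow : forall e : R, 0 < e -> exists A : R, forall j,
  \sum_(i < j) (n_ i)%:R * ee i <= e * (\sum_(i < j) n_ i)%:R + A.
Hypothesis c_small : forall j, c <= (n_ j)%:R * ee j.

Definition level (j : nat) : nat := \sum_(i < j) n_ i.

Lemma level0 : level 0 = 0%N. Proof. by rewrite /level big_ord0. Qed.

Lemma levelS j : level j.+1 = (level j + n_ j)%N.
Proof. by rewrite /level big_ord_recr. Qed.

Lemma leq_level i j : (i <= j)%N -> (level i <= level j)%N.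
Proof.
move=> /subnK <-; elim: (j - i)%N => // k IH.
by rewrite addSn levelS (leq_trans IH)// leq_addr.
Qed.

Lemma ltn_level j : (j <= level j)%N.
Proof.
elim: j => // j IH; rewrite levelS -addn1; apply: leq_add => //.
Qed.

Lemma level_locate n : exists j, (level j <= n < level j.+1)%N.
Proof.
elim: n => [|n [j /andP[h1 h2]]].
  by exists 0%N; rewrite levelS level0 add0n n_gt0.
have [h|h] := leqP (level j.+1) n.+1; last by exists j; rewrite h (leq_trans h1).
exists j.+1; rewrite h /=; have e : level j.+1 = n.+1.
  by apply/eqP; rewrite eqn_leq h.
by rewrite levelS e -[X in (X < _)%N]addn0 ltn_add2l n_gt0.
Qed.

Fixpoint mass (j : nat) (w : seq (A1 * A2)) : R :=
  if j is j'.+1 then mass j' (take (level j') w) * mm j' (drop (level j') w) else 1.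

Lemma mass_ge0 j w : 0 <= mass j w.
Proof.
elim: j w => //= j IH w; rewrite mulr_ge0//; by case: (hmm j).
Qed.

Lemma ws_mass_cat j (F : seq (A1 * A2) -> R) :
  ws (level j.+1) (fun w => mass j.+1 w * F w) =
  ws (level j) (fun u => mass j u * ws (n_ j) (fun v => mm j v * F (u ++ v))).
Proof.
rewrite levelS ws_cat; apply: eq_ws => u su; rewrite -wsZ; apply: eq_ws => v _ /=.
by rewrite take_size_cat// drop_size_cat// mulrA.
Qed.

Lemma ws_mass j : ws (level j) (mass j) = 1.
Proof.
elim: j => [|j IH]; first by rewrite level0 ws0.
rewrite -[RHS]IH -[LHS](eq_ws (F := fun w => mass j.+1 w * 1)) => [|w _]; last exact: mulr1.
rewrite (ws_mass_cat j (fun=> 1)); apply: eq_ws => u _.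
have [_ h _ _ _] := hmm j.
by rewrite (eq_ws (G := mm j)) ?h ?mulr1// => w _; rewrite mulr1.
Qed.

Lemma mass_take j w : 0 < mass j.+1 w ->
  0 < mass j (take (level j) w) /\ 0 < mm j (drop (level j) w).
Proof.
move=> /= h; have h1 := mass_ge0 j (take (level j) w).
have [h2 _ _ _ _] := hmm j.
split; rewrite lt_neqAle ?h1 ?h2 andbT eq_sym; apply/eqP => e.
  by move: h; rewrite e mul0r ltxx.
by move: h; rewrite e mulr0 ltxx.
Qed.

Lemma mass_prefix i j w : (i <= j)%N -> size w = level j -> 0 < mass j w ->
  0 < mass i (take (level i) w).
Proof.
elim: j w => [|j IH] w; first by rewrite leqn0 => /eqP ->.
rewrite leq_eqVlt => /orP[/eqP ->|ij] sw hw; first by rewrite take_oversize ?sw.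
have [h1 _] := mass_take hw.
have sz : size (take (level j) w) = level j.
  by rewrite size_takel// sw leq_level.
by have := IH _ ij sz h1; rewrite take_takel// leq_level.
Qed.

Let c0 : 0 <= c. Proof. by case: hpsi => -[]. Qed.

(** Appending block i costs [n_ i * ee i] for the block and c for the concatenation; [c_small]
    bounds the latter by the former, whence the factor 2. *)
Lemma mass_psi j w : size w = level j -> 0 < mass j w ->
  all S w /\ `|ln (psi w) + (level j)%:R * beta| <=
    2 * (\sum_(i < j) (n_ i)%:R * ee i) + c.
Proof.
have [[_ fp fc] _] := hpsi.
elim: j w => [|j IH] w sw hw.
  rewrite level0 in sw; rewrite (size0nil sw) level0 mul0r addr0 big_ord0 mulr0 add0r.
  by split => //; have := fc [::] [::] isT isT; rewrite subrr sub0r normrN.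
have [h1 h2] := mass_take hw.
have sz : size (take (level j) w) = level j by rewrite size_takel// sw leq_level.
have sz2 : size (drop (level j) w) = n_ j by rewrite size_drop sw levelS addKn.
have [S1 IH1] := IH _ sz h1.
have [_ _ hm _ _] := hmm j; have [S2 IH2] := hm _ sz2 h2.
have := fc _ _ S1 S2; rewrite cat_take_drop -[in all S w](cat_take_drop (level j) w).
rewrite all_cat S1 S2 big_ord_recr levelS natrD /=; move: IH1 IH2 (c_small j).
move: (ln _) (ln _) (ln _) (\sum_(i < j) _) => x y z t.
rewrite !ler_norml => /andP[? ?] /andP[? ?] ? /andP[? ?].
by split => //; apply/andP; split; lra.
Qed.

(** The mass of the words of level j compatible with the approximate square given by l letters of x
    and n letters of y. It is the mass of the square itself once level j reaches both l and n. *)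
Definition box_mass (x : nat -> A1) (l : nat) (y : nat -> A2) (n : nat) (j : nat) : R :=
  ws (level j) (fun w => mass j w * (agr x l (unzip1 w) && agr y n (unzip2 w))%:R).

(** Used with three values of d: 1 for any block, the fiber bound for a block within the first l
    positions, where the projection is prescribed, and the word bound for a block within the first n
    positions, where both coordinates are. *)
Lemma box_mass_step x l y n j (d : R) : (n <= l)%N -> 0 <= d ->
  (forall x' y' l' n', l' = (l - level j)%N -> n' = (n - level j)%N ->
     ws (n_ j) (fun v => mm j v * (agr x' l' (unzip1 v) && agr y' n' (unzip2 v))%:R) <=
       d) ->
  box_mass x l y n j.+1 <= box_mass x l y n j * d.
Proof.
move=> nl d0 hd; rewrite /box_mass ws_mass_cat -wsZr; apply: ler_ws => u su.
rewrite -mulrA; apply: ler_wpM2l; first exact: mass_ge0.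
have [h0 _ _ _ _] := hmm j.
have cat1 v : unzip1 (u ++ v) = unzip1 u ++ unzip1 v by rewrite /unzip1 map_cat.
have cat2 v : unzip2 (u ++ v) = unzip2 u ++ unzip2 v by rewrite /unzip2 map_cat.
have s1 : size (unzip1 u) = level j by rewrite size_map.
have s2 : size (unzip2 u) = level j by rewrite size_map.
case: (boolP (agr x l (unzip1 u) && agr y n (unzip2 u))) => [/andP[a1 a2]|na]; last first.
  rewrite mul0r /ws big1// => v _; rewrite cat1 cat2 !agr_cat.
  by move: na; rewrite negb_and => /orP[] /negbTE ->; rewrite ?andbF /= mulr0.
rewrite mul1r; apply: le_trans (hd (fun i => x (level j + i)%N) (fun i => y (level j +
  i)%N) _ _ erefl erefl).
by apply: ler_ws => v _; rewrite cat1 cat2 !agr_cat a1 a2 s1 s2.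
Qed.

Lemma box_mass_step1 x l y n j : (n <= l)%N -> box_mass x l y n j.+1 <= box_mass x l y n j.
Proof.
move=> nl; rewrite -[leRHS]mulr1; apply: box_mass_step => // x' y' l' n' _ _.
have [h0 h1 _ _ _] := hmm j.
by rewrite -[leRHS]h1; apply: ler_ws => v _; rewrite ler_piMr// lern1 leq_b1.
Qed.

Lemma box_mass_step2 x l y n j : (n <= l)%N -> (level j.+1 <= l)%N ->
  box_mass x l y n j.+1 <= box_mass x l y n j * expR (- ((n_ j)%:R * (e1 - ee j))).
Proof.
move=> nl jl; apply: box_mass_step => //.
move=> x' y' l' n' l'E _; have [h0 _ _ _ h1] := hmm j.
have nl' : (n_ j <= l')%N by rewrite l'E leq_subRL ?(leq_trans (leq_level (leqnSn j)))//
  -levelS.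
apply: le_trans (h1 (mkseq x' (n_ j)) (size_mkseq _ _)).
have sx : size (mkseq x' (n_ j)) == n_ j by rewrite size_mkseq.
rewrite ws_zip /fiber_ws size_mkseq /ws (bigD1 (Tuple sx)) //= [X in _ + X <= _]big1
  ?addr0; last first.
  move=> u nu; rewrite big1// => v _; rewrite unzip1_zip ?size_tuple//.
  case: (boolP (agr x' l' u)) => [hu|_]; last by rewrite mulr0.
  have e := agr_eq (_ : (size u <= l')%N) hu.
  by move: nu; rewrite -val_eqE /= e ?size_tuple// eqxx.
by apply: ler_sum => v _; rewrite ler_piMr// lern1 leq_b1.
Qed.

Lemma box_mass_step3 x l y n j : (n <= l)%N -> (level j.+1 <= n)%N ->
  box_mass x l y n j.+1 <= box_mass x l y n j * expR (- ((n_ j)%:R * (e1 + e2 - ee j))).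
Proof.
move=> nl jn; apply: box_mass_step => //.
move=> x' y' l' n' l'E n'E; have [h0 _ _ h1 _] := hmm j.
have nn' : (n_ j <= n')%N by rewrite n'E leq_subRL ?(leq_trans (leq_level (leqnSn j)))//
  -levelS.
have nl' : (n_ j <= l')%N.
  rewrite l'E leq_subRL -?levelS ?(leq_trans jn)//.
  exact: leq_trans (leq_level (leqnSn j)) (leq_trans jn nl).
pose w := zip (mkseq x' (n_ j)) (mkseq y' (n_ j)).
have sw : size w = n_ j by rewrite size_zip !size_mkseq minnn.
apply: le_trans (h1 w sw).
have /eqP sw' := sw; rewrite /ws (bigD1 (Tuple sw')) //= big1 ?addr0.
  by rewrite ler_piMr// lern1 leq_b1.
move=> v nv; case: (boolP (_ && _)) => [/andP[a1 a2]|_]; last by rewrite mulr0.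
have z1 : size (unzip1 v) = n_ j by rewrite size_map size_tuple.
have z2 : size (unzip2 v) = n_ j by rewrite size_map size_tuple.
have f1 : unzip1 v = mkseq x' (n_ j).
  by rewrite (@agr_eq _ x' l' (unzip1 v)) ?z1.
have f2 : unzip2 v = mkseq y' (n_ j).
  by rewrite (@agr_eq _ y' n' (unzip2 v)) ?z2.
by move/eqP: nv; case; apply: val_inj; rewrite /= /w -f1 -f2 zip_unzip.
Qed.

Lemma box_mass_decr x l y n i j : (n <= l)%N -> (i <= j)%N ->
  box_mass x l y n j <= box_mass x l y n i.
Proof.
move=> nl /subnK <-; elim: (j - i)%N => // k IH.
exact: le_trans (box_mass_step1 _ _ _ nl) IH.
Qed.

(** Blocks before jb contribute e1 + e2 to the exponent, those between jb and ja only e1. *)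
Lemma box_mass_level x l y n ja jb i : (n <= l)%N -> (level ja <= l)%N ->
  (level jb <= n)%N -> (i <= ja)%N ->
  box_mass x l y n i <= expR (- (e1 * (level i)%:R) - e2 * (level (minn i jb))%:R +
    \sum_(k < i) (n_ k)%:R * ee k).
Proof.
move=> nl jal jbn; elim: i => [|i IH] ij.
  rewrite min0n level0 !mulr0 big_ord0 oppr0 !addr0 expR0.
  by rewrite /box_mass level0 ws0 /= mul1r lern1.
have {}IH := IH (ltnW ij).
rewrite big_ord_recr levelS natrD /=.
have [h|h] := ltnP i jb.
  rewrite (minn_idPl h) (minn_idPl (ltnW h)) in IH *.
  have h2 : (level i.+1 <= n)%N by apply: leq_trans jbn; apply: leq_level.
  apply: (le_trans (box_mass_step3 _ _ nl h2)).
  apply: (le_trans (ler_wpM2r (expR_ge0 _) IH)); rewrite -expRD ler_expR levelS natrD.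
  by move: (\sum_(k < i) _) => z; lra.
rewrite (minn_idPr h) (minn_idPr (leqW h)) in IH *.
have h2 : (level i.+1 <= l)%N by apply: leq_trans jal; apply: leq_level.
apply: (le_trans (box_mass_step2 _ _ nl h2)).
apply: (le_trans (ler_wpM2r (expR_ge0 _) IH)); rewrite -expRD ler_expR.
by move: (\sum_(k < i) _) => z; lra.
Qed.

(** Rounding l and n down to levels loses at most one block each, negligible by [n_slow]. The
    threshold j0 may depend on the box, but C may not. *)
Lemma box_mass_bound (e : R) : 0 < e -> exists C : R, forall x l y n, (n <= l)%N ->
  exists j0, forall j, (j0 <= j)%N ->
    box_mass x l y n j <= expR (- (e1 * l%:R) - e2 * n%:R + e * l%:R + C).
Proof.
(* Errors of size d l, up to constants, occur with coefficients |e1|, |e2| and 1. *)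
move=> e0; pose d := e / (`|e1| + `|e2| + 1).
have D0 : 0 < `|e1| + `|e2| + 1 by rewrite ltr_wpDl// addr_ge0.
have d0 : 0 < d by rewrite divr_gt0.
have [C1 h1] := n_slow d0; have [C2 h2] := ee_slow d0.
exists ((`|e1| + `|e2|) * C1 + C2) => x l y n nl.
have [ja /andP[ja1 ja2]] := level_locate l.
have [jb /andP[jb1 jb2]] := level_locate n.
exists ja => j jaj.
have jab : (jb <= ja)%N.
  rewrite leqNgt; apply/negP => h; move: ja2; rewrite ltnNge.
  by rewrite (leq_trans (leq_level h))// (leq_trans jb1).
apply: (le_trans (box_mass_decr _ _ nl jaj)).
apply: (le_trans (box_mass_level _ _ nl ja1 jb1 (leqnn ja))).
rewrite (minn_idPr jab) ler_expR.
have := h1 ja; have := h1 jb; have := h2 ja; rewrite -!/(level _).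
move: ja1 ja2 jb1 jb2; rewrite !levelS -!(ltr_nat R) -!(ler_nat R) !natrD.
have nlR : n%:R <= l%:R :> R by rewrite ler_nat.
move: nlR; move: (l%:R) (n%:R) ((level ja)%:R) ((level jb)%:R) ((n_ ja)%:R) ((n_ jb)%:R).
move: (\sum_(k < ja) _) => z L n' la lb na nb nlR a1 a2 b1 b2 hz hb ha.
have k1 : `|la - L| <= d * L + C1.
  rewrite ler_norml; apply/andP; split; last by have := ler_wpM2l (ltW d0) a1; lra.
  by have := ler_wpM2l (ltW d0) a1; lra.
have k2 : `|lb - n'| <= d * L + C1.
  rewrite ler_norml; have := ler_wpM2l (ltW d0) b1; have := ler_wpM2l (ltW d0) nlR.
  by move=> *; apply/andP; split; lra.
have k3 : z <= d * L + C2 by have := ler_wpM2l (ltW d0) a1; lra.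
have k4 : e1 * (L - la) <= `|e1| * (d * L + C1).
  apply: (le_trans (ler_norm _)); rewrite normrM ler_wpM2l// distrC//.
have k5 : e2 * (n' - lb) <= `|e2| * (d * L + C1).
  apply: (le_trans (ler_norm _)); rewrite normrM ler_wpM2l// distrC//.
have k6 : e * L = (`|e1| + `|e2| + 1) * (d * L) by rewrite /d; field; rewrite gt_eqF.
rewrite k6; move: (`|e1|) (`|e2|) k4 k5 => u v k4 k5; lra.
Qed.

End MoranMass.

Section MoranSet.
Context {R : realType} {A1 A2 : finType}.
Variables (c : R) (S : pred (A1 * A2)) (psi : seq (A1 * A2) -> R) (a0 : A1 * A2).
Hypothesis hpsi : quasi_mult c S psi.
Variables (beta e1 e2 : R) (n_ : nat -> nat) (ee : nat -> R).
Variable mm : nat -> seq (A1 * A2) -> R.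
Hypothesis n_gt0 : forall j, (0 < n_ j)%N.
Hypothesis hmm : forall j, moran_block S psi beta e1 e2 (ee j) (n_ j) (mm j).

Local Notation level := (level n_).
Local Notation mass := (mass n_ mm).
Local Notation box_mass := (box_mass n_ mm).

Definition moran_set : set (nat -> A1 * A2) :=
  [set z | forall j, 0 < mass j (mkseq z (level j))].

Lemma take_mkseq (T : Type) (z : nat -> T) m n : (m <= n)%N ->
  take m (mkseq z n) = mkseq z m.
Proof. by move=> mn; rewrite /mkseq -map_take take_iota (minn_idPl mn). Qed.

(** At the ends of blocks this is [mass_psi]. Inside a block only the linear bound on ln psi is
    available, but the block is short. *)
Lemma moran_set_growth :
  (forall e : R, 0 < e -> exists C : R, forall j,
    (n_ j)%:R <= e * (\sum_(i < j) n_ i)%:R + C) ->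
  (forall e : R, 0 < e -> exists C : R, forall j,
    \sum_(i < j) (n_ i)%:R * ee i <= e * (\sum_(i < j) n_ i)%:R + C) ->
  (forall j, c <= (n_ j)%:R * ee j) ->
  forall e : R, 0 < e -> exists C : R, forall z, moran_set z -> forall n,
    all S (mkseq z n) /\ `|ln (psi (mkseq z n)) + n%:R * beta| <= e * n%:R + C.
Proof.
move=> n_slow ee_slow c_small e e0.
have [[c0 fp fc] _] := hpsi.
have [K K0 hK] := quasi_mult_on_ln_bound hpsi.1.
pose D := K + `|beta| + 2.
have D0 : 0 < D by rewrite /D; have := normr_ge0 beta; lra.
pose d := e / D; have d0 : 0 < d by rewrite divr_gt0.
have [C1 h1] := n_slow _ d0; have [C2 h2] := ee_slow _ d0.
exists (2 * C2 + (K + `|beta|) * C1 + 3 * c) => z hz n.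
have [j /andP[j1 j2]] := level_locate n_gt0 n.
have sz i : size (mkseq z i) = i by rewrite size_mkseq.
have [Sj1 _] := mass_psi hpsi hmm c_small (sz (level j.+1)) (hz j.+1).
have [Sj hj] := mass_psi hpsi hmm c_small (sz (level j)) (hz j).
have Sn : all S (mkseq z n).
  by move: Sj1; rewrite -(cat_take_drop n (mkseq z _)) all_cat take_mkseq ?(ltnW j2)// =>
    /andP[].
split => //.
have nE : mkseq z n = mkseq z (level j) ++ drop (level j) (mkseq z n).
  by rewrite -(take_mkseq z j1) cat_take_drop.
set v := drop _ _ in nE.
have Sv : all S v by move: Sn; rewrite nE all_cat => /andP[].
have sv : (size v)%:R = n%:R - (level j)%:R :> R by rewrite size_drop size_mkseq natrB.
have := fc _ _ Sj Sv; rewrite -nE.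
have := hK _ Sv; rewrite sv; move: hj; have := h1 j; have := h2 j; rewrite -!/(level _).
move: j1 j2; rewrite levelS -(ltr_nat R) -(ler_nat R) natrD.
move: (ln _) (ln _) (ln _) (\sum_(i < j) _) (n%:R) ((level j)%:R) ((n_ j)%:R).
move=> x y w s N L nj h3 h4 h5 h6 h7 h8 h9.
have k1 : nj <= d * N + C1 by have := ler_wpM2l (ltW d0) h3; lra.
have k2 : s <= d * N + C2 by have := ler_wpM2l (ltW d0) h3; lra.
have k3 : K * (N - L) <= K * (d * N + C1) by apply: ler_wpM2l => //; lra.
have k4 : `|(N - L) * beta| <= `|beta| * (d * N + C1).
  rewrite normrM mulrC ler_wpM2l// ger0_norm; lra.
have -> : e * N = D * (d * N) by rewrite /d; field; rewrite gt_eqF.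
move: h7 h8 h9 k4; rewrite /D !ler_norml; move: (`|beta|) k3 => B k3.
move=> /andP[? ?] /andP[? ?] /andP[? ?] /andP[? ?]; apply/andP; split; lra.
Qed.

(* Koenig's lemma: were the masses of the first k boxes to sum to less than 1 for every
   k, one could follow words that can be prolonged so as to avoid any number of boxes. *)
Lemma moran_set_cover (x : nat -> nat -> A1) (l : nat -> nat)
    (y : nat -> nat -> A2) (n : nat -> nat) :
  (forall z, moran_set z -> exists i,
     (forall m, (m < l i)%N -> (z m).1 = x i m) /\
     (forall m, (m < n i)%N -> (z m).2 = y i m)) ->
  exists k, forall j0, exists2 j, (j0 <= j)%N &
    1 <= \sum_(i < k) box_mass (x i) (l i) (y i) (n i) j.
Proof.
move=> hcov; apply: contrapT => hn.
pose inbox i w := agr (x i) (l i) (unzip1 w) && agr (y i) (n i) (unzip2 w).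
pose esc j w p j' w' := [/\ (p <= j')%N, (j <= j')%N, size w' = level j' &
  [/\ take (level j) w' = w, 0 < mass j' w' & forall i, (i < p)%N -> ~~ inbox i w']].
pose bad j w := forall p, exists j' w', esc j w p j' w'.
(* Otherwise all words of positive mass at high levels would meet the first p boxes, whose masses
   would then sum to at least the total mass 1. *)
have bad0 : bad 0%N [::].
  move=> p; apply: contrapT => hesc; apply: hn; exists p => j0.
  exists (maxn j0 p); first exact: leq_maxl.
  set j := maxn j0 p.
  rewrite -(ws_mass hmm j) /box_mass -(ws_sum (level j) (fun (i : 'I_p) w =>
    mass j w * (agr (x i) (l i) (unzip1 w) && agr (y i) (n i) (unzip2 w))%:R)).
  apply: ler_ws => w sw; rewrite -mulr_sumr.
  have := mass_ge0 hmm j w; rewrite le_eqVlt => /orP[/eqP <-|w0]; first by rewrite mul0r.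
  rewrite ler_peMr ?(ltW w0)//.
  have [i hi] : exists i : 'I_p, inbox i w.
    apply: contrapT => hi; apply: hesc; exists j, w; split => //.
      exact: leq_maxr.
    split => //; first by rewrite level0 take0.
    move=> i ip; apply/negP => ii; apply: hi; by exists (Ordinal ip).
  rewrite (bigD1 i) //=; move: hi; rewrite /inbox => ->.
  by rewrite lerDl sumr_ge0.
have badS j w : bad j w -> exists w', [/\ bad j.+1 w', take (level j) w' = w &
    size w' = level j.+1].
  move=> hb; apply: contrapT => hno.
  have hp (u : seq (A1 * A2)) : exists p, take (level j) u = w -> size u = level j.+1 ->
      ~ exists j' w', esc j.+1 u p j' w'.
    have [hu|hu] := pselect (exists p, ~ exists j' w', esc j.+1 u p j' w').
      by have [p hp] := hu; exists p.
    exists 0%N => tu su; exfalso; apply: hno; exists u; split => // p.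
    by apply: contrapT => h; apply: hu; exists p.
  have [f hf] := choice hp.
  (* Only finitely many words prolong w by one block. If each failed to escape for some p, a
     prolongation of w escaping for the maximum of these would be contradictory; taking p > j
     ensures that it contains a further block. *)
  pose p := maxn (\max_(u : (level j.+1).-tuple (A1 * A2)) f u) j.+1.
  have [j' [w' [pj' jj' sw' [tw' w'0 hw']]]] := hb p.
  have j1 : (j.+1 <= j')%N by apply: leq_trans pj'; apply: leq_maxr.
  pose u := take (level j.+1) w'.
  have su : size u = level j.+1 by rewrite size_takel// sw' leq_level.
  have tu : take (level j) u = w by rewrite take_takel ?leq_level.
  have fup : (f u <= p)%N.
    have /eqP su' := su; apply: leq_trans (leq_maxl _ _).
    exact: (leq_bigmax (F := fun v : (level j.+1).-tuple (A1 * A2) => f v) (Tuple su')).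
  apply: (hf u tu su); exists j', w'; split => //; first exact: leq_trans fup pj'.
  by split => // i ifu; apply: hw'; apply: leq_trans ifu fup.
have step (jw : nat * seq (A1 * A2)) : exists w', bad jw.1 jw.2 -> [/\ bad jw.1.+1 w',
    take (level jw.1) w' = jw.2 & size w' = level jw.1.+1].
  have [hb|hb] := pselect (bad jw.1 jw.2); last by exists [::].
  by have [w' hw'] := badS _ _ hb; exists w'.
have [f hf] := choice step.
pose W := fix W j := if j is j'.+1 then f (j', W j') else [::].
have WB j : bad j (W j) /\ size (W j) = level j.
  elim: j => [|j [IH _]]; first by rewrite level0.
  by have [? _ ?] := hf (j, W j) IH.
have WT i j : (i <= j)%N -> take (level i) (W j) = W i.
  elim: j => [|j IH]; first by rewrite leqn0 => /eqP ->.
  rewrite leq_eqVlt => /orP[/eqP ->|ij].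
    by rewrite take_oversize// (WB j.+1).2.
  have [hb _] := WB j; have [_ ht _] := hf (j, W j) hb.
  have {}ht : take (level j) (W j.+1) = W j := ht.
  by rewrite -(IH ij) -[in RHS]ht take_takel// leq_level.
pose z m := nth a0 (W m.+1) m.
have lt_level m : (m < level m.+1)%N by apply: ltn_level.
have zW j : mkseq z (level j) = W j.
  apply: (@eq_from_nth _ a0); rewrite size_mkseq ?(WB j).2// => m mj.
  rewrite nth_mkseq// /z; have [h|h] := leqP m.+1 j.
    by rewrite -(WT _ _ h) nth_take.
  by rewrite -(WT _ _ (ltnW h)) nth_take.
have zK : moran_set z.
  move=> j; rewrite zW; have [hb _] := WB j.
  have [j' [w' [_ jj' sw' [tw' w'0 _]]]] := hb 0%N.
  by have := mass_prefix hmm jj' sw' w'0; rewrite tw'.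
have [i [i1 i2]] := hcov z zK.
(* From this level on, membership in box i is decided by the prefix, so no prolongation of it can
   avoid the box. *)
pose j := maxn (l i) (n i).
have lj : (l i <= level j)%N by apply: leq_trans (ltn_level n_gt0 j); apply: leq_maxl.
have nj : (n i <= level j)%N by apply: leq_trans (ltn_level n_gt0 j); apply: leq_maxr.
have [hb _] := WB j; have [j' [w' [_ jj' sw' [tw' _ hav]]]] := hb i.+1.
have /negP := hav i (ltnSn i); apply.
rewrite -(cat_take_drop (level j) w') tw' -zW /inbox.
rewrite /unzip1 /unzip2 !map_cat !agr_cat !size_map !size_iota.
rewrite (eqP (_ : l i - level j == 0)%N) ?subn_eq0// (eqP (_ : n i - level j == 0)%N)
  ?subn_eq0//.
rewrite !(agr_short _ _ (leqnn 0)) !andbT /mkseq -!map_comp.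
by apply/andP; split; apply: agr_mkseq.
Qed.

End MoranSet.

Section MoranSetExists.
Context {R : realType} {A1 A2 : finType}.
Variables (c : R) (S : pred (A1 * A2)) (psi : seq (A1 * A2) -> R) (a0 : A1 * A2).
Hypothesis hpsi : quasi_mult c S psi.
Variables (beta e1 e2 : R).
Hypothesis blocks : forall eta : R, 0 < eta -> exists N m,
  [/\ (0 < N)%N, c <= N%:R * eta & moran_block S psi beta e1 e2 eta N m].

(** Blocks for eta = 1 / (k + 1) are strung together along [slow]. The second property is the mass
    distribution principle stated through coverings, so that no measure on K has to be
    constructed. *)
Lemma moran_set_exists : exists K : set (nat -> A1 * A2),
  (forall e : R, 0 < e -> exists C : R, forall z, K z -> forall n,
    all S (mkseq z n) /\ `|ln (psi (mkseq z n)) + n%:R * beta| <= e * n%:R + C) /\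
  (forall e : R, 0 < e -> exists C : R,
    forall (x : nat -> nat -> A1) (l : nat -> nat) (y : nat -> nat -> A2) (n : nat -> nat),
    (forall i, (n i <= l i)%N) ->
    (forall z, K z -> exists i, (forall m, (m < l i)%N -> (z m).1 = x i m) /\
       (forall m, (m < n i)%N -> (z m).2 = y i m)) ->
    exists k, 1 <= \sum_(i < k)
       expR (- (e1 * (l i)%:R) - e2 * (n i)%:R + e * (l i)%:R + C)).
Proof.
have hB (k : nat) : exists Nm : nat * (seq (A1 * A2) -> R),
    [/\ (0 < Nm.1)%N, c <= Nm.1%:R * k.+1%:R^-1 &
        moran_block S psi beta e1 e2 k.+1%:R^-1 Nm.1 Nm.2].
  have [|N [m h]] := @blocks k.+1%:R^-1; first by rewrite invr_gt0.
  by exists (N, m).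
have [B hB'] := choice hB.
pose N k := (B k).1.
have N_gt0 k : (0 < N k)%N by case: (hB' k).
pose n_ j := N (slow N j); pose mm j := (B (slow N j)).2.
pose ee j : R := (slow N j).+1%:R^-1.
have n_gt0 j : (0 < n_ j)%N := N_gt0 _.
have hmm j : moran_block S psi beta e1 e2 (ee j) (n_ j) (mm j).
  by case: (hB' (slow N j)).
have c_small j : c <= (n_ j)%:R * ee j by case: (hB' (slow N j)).
have slow_ev (e : R) : 0 < e -> exists j0, forall j, (j0 <= j)%N -> e^-1 <= (slow N j)%:R.
  move=> e0; have [j0 hj0] := slow_unbounded N (Num.truncn e^-1).+1.
  by exists j0 => j /hj0 h; apply/ltW/lt_of_truncn.
have n_slow (e : R) : 0 < e -> exists C : R, forall j,
    (n_ j)%:R <= e * (\sum_(i < j) n_ i)%:R + C.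
  move=> e0; have [j0 hj0] := slow_ev _ e0.
  exists (\sum_(i < j0) n_ i)%:R => j; have [jj|jj] := leqP j0 j.
    have h1 := hj0 _ jj.
    have h2 : ((slow N j) * n_ j)%:R <= (\sum_(i < j) n_ i)%:R :> R.
      rewrite ler_nat; apply: leq_trans (slow_le N j) _.
      exact: ltn_level.
    apply: (@le_trans _ _ (e * (\sum_(i < j) n_ i)%:R)); last by rewrite lerDl.
    apply: le_trans (ler_wpM2l (ltW e0) h2); rewrite natrM mulrA ler_peMl//.
    by rewrite mulrC -ler_pdivrMr// mul1r.
  apply: (@le_trans _ _ (\sum_(i < j0) n_ i)%:R).
    by rewrite ler_nat (bigD1 (Ordinal jj)) //= leq_addr.
  by rewrite lerDr mulr_ge0// ltW.
have ee_slow (e : R) : 0 < e -> exists C : R, forall j,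
    \sum_(i < j) (n_ i)%:R * ee i <= e * (\sum_(i < j) n_ i)%:R + C.
  move=> e0; have [j0 hj0] := slow_ev _ e0.
  have ee0 i : 0 <= ee i by rewrite invr_ge0.
  exists (\sum_(i < j0) (n_ i)%:R * ee i); elim=> [|j IH].
    by rewrite !big_ord0 mulr0 add0r sumr_ge0// => i _; rewrite mulr_ge0.
  have [jj|jj] := leqP j0 j.
    rewrite !big_ord_recr natrD /=.
    have h : (n_ j)%:R * ee j <= e * (n_ j)%:R.
      rewrite mulrC ler_wpM2r// /ee -[leRHS]invrK lef_pV2 ?posrE ?invr_gt0//.
      by apply: (le_trans (hj0 _ jj)); rewrite ler_nat.
    by move: IH; move: (\sum_(i < j) _ * _) ((\sum_(i < j) _)%:R) (\sum_(i < j0) _) => *;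
      lra.
  apply: (@le_trans _ _ (\sum_(i < j0) (n_ i)%:R * ee i)).
    rewrite (big_ord_widen _ (fun i => (n_ i)%:R * ee i) jj) [leRHS](bigID (fun i : 'I_j0
      => (i < j.+1)%N)) /=.
    by rewrite lerDl sumr_ge0// => i _; rewrite mulr_ge0.
  by rewrite lerDr mulr_ge0// ltW.
exists (moran_set n_ mm); split.
  exact: (moran_set_growth hpsi n_gt0 hmm n_slow ee_slow c_small).
move=> e e0; have [C hC] := box_mass_bound n_gt0 hmm n_slow ee_slow e0.
exists C => x l y n nl hcov.
have [k hk] := moran_set_cover a0 n_gt0 hmm hcov.
exists k.
have [f hf] := choice (fun i => hC (x i) (l i) (y i) (n i) (nl i)).
have [j hj] := hk (\max_(i < k) f i); move=> /le_trans; apply.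
apply: ler_sum => i _; apply: hf; apply: leq_trans hj.
exact: (leq_bigmax (F := fun i : 'I_k => f i) i).
Qed.

End MoranSetExists.

(** * Hausdorff dimension from below *)

Section HausdorffLower.
Context {R : realType}.

Lemma symb_dist_le_agree (A : finType) (r : nat) (x x' : nat -> A) (a : R) (m : nat) :
  (1 < r)%N -> symb_dist r x x' <= expR (- a) -> m%:R * ln r%:R < a -> x m = x' m.
Proof.
move=> r1 hd hm; apply/eqP; apply: contraT => xm.
have r0 : (0 : R) < r%:R by rewrite ltr0n ltnW.
move: hd; rewrite /symb_dist; case: pselect => [h|[]]; last by exists m.
case: ex_minnP => k _ /(_ m xm) km.
rewrite -[r%:R]lnK ?posrE// -expRM_natl -expRN ler_expR => h2.
have : k%:R * ln r%:R <= m%:R * ln r%:R :> R.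
  by rewrite ler_wpM2r ?ler_nat// ln_ge0// ler1n ltnW.
lra.
Qed.

Variables r1 r2 : nat.
Hypothesis (hr1 : (2 <= r1)%N) (hr12 : (r1 <= r2)%N).
Local Notation A1 := (letter r1).
Local Notation A2 := (letter r2).
Local Notation L1 := (ln r1%:R : R).
Local Notation L2 := (ln r2%:R : R).

Lemma ln_base_gt0 (r : nat) : (2 <= r)%N -> 0 < ln r%:R :> R.
Proof. by move=> h; rewrite ln_gt0// ltr1n. Qed.

Lemma gauge_ge0 (T : Type) (dist : T -> T -> R) t U : (0 <= gauge dist t U)%E.
Proof. by rewrite /gauge; case: ifP => // _; apply: poweR_ge0. Qed.

Lemma dist_le_diameter (T : Type) (dist : T -> T -> R) U z z' : U z -> U z' ->
  ((dist z z')%:E <= diameter dist U)%E.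
Proof.
move=> Uz Uz'; rewrite /diameter le_max; apply/orP; right.
by apply: ereal_sup_ubound; exists (z, z').
Qed.

(** The largest l with r1^(-l) >= r2^(-n): points at distance at most r2^(-n) share this many
    letters in the first coordinate and n in the second. *)
Definition box_length (n : nat) : nat := Num.truncn (n%:R * L2 / L1).

Lemma box_length_bounds n :
  (box_length n)%:R <= n%:R * L2 / L1 < (box_length n).+1%:R.
Proof.
have l1 := ln_base_gt0 hr1; have l2 := ln_base_gt0 (leq_trans hr1 hr12).
by apply: truncn_itv; rewrite divr_ge0 ?mulr_ge0 ?(ltW l1) ?(ltW l2).
Qed.

Lemma box_length_ge n : (n <= box_length n)%N.
Proof.
have l1 := ln_base_gt0 hr1; have /andP[_] := box_length_bounds n.
have h : n%:R <= n%:R * L2 / L1.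
  rewrite ler_pdivlMr// ler_wpM2l// ler_ln ?posrE ?ltr0n ?ler_nat//.
    exact: leq_trans hr1.
  exact: leq_trans (leq_trans hr1 hr12).
by move=> /(le_lt_trans h); rewrite ltr_nat ltnS.
Qed.

(* The error term eps accounts for the sets of diameter 0. *)
Lemma cover_by_box (U : set ((nat -> A1) * (nat -> A2))) (t t' C eps : R) :
  0 <= t -> t < t' -> 0 < eps -> (diameter (prod_dist (R := R) r1 r2) U <= 1%:E)%E ->
  exists (x : nat -> A1) (y : nat -> A2) (n : nat) (g : R),
    [/\ gauge (prod_dist (R := R) r1 r2) t U = g%:E, 0 <= g,
     forall z, U z -> (forall m, (m < box_length n)%N -> z.1 m = x m) /\
                      (forall m, (m < n)%N -> z.2 m = y m) &
     expR (- (t' * L2 * n%:R) + C) <= expR (C + t * L2) * g + eps].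
Proof.
move=> t0 tt' eps0 hd.
have l1 := ln_base_gt0 hr1; have l2 := ln_base_gt0 (leq_trans hr1 hr12).
have t'0 : 0 < t' by lra.
(* For an empty set or a set of diameter 0 the scale is free, and is taken so fine that its term is
   below eps. *)
have big : exists n : nat, expR (- (t' * L2 * n%:R) + C) <= eps.
  pose X := (C - ln eps) / (t' * L2).
  exists (Num.truncn X).+1; rewrite -[leRHS]lnK ?posrE// ler_expR.
  have : X < (Num.truncn X).+1%:R by apply: truncnS_gt.
  rewrite ltr_pdivrMr ?mulr_gt0//; move: (_.+1%:R) => z; lra.
have [->|/set0P[z0 Uz0]] := eqVneq U set0.
  have [n hn] := big; exists (fun=> ord0), (fun=> ord0), n, 0; split => //.
    by rewrite /gauge eqxx.
  by rewrite mulr0 add0r.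
have Un0 : U != set0 by apply/set0P; exists z0.
have d0 : (0 <= diameter (prod_dist (R := R) r1 r2) U :> \bar R)%E by rewrite /diameter
  le_max lexx.
have [d dE] : exists d : R, diameter (prod_dist (R := R) r1 r2) U = d%:E.
  by move: d0 hd; case: (diameter _ U) => // d _ _; exists d.
have gE : gauge (prod_dist (R := R) r1 r2) t U = (d `^ t)%:E.
  by rewrite /gauge (negbTE Un0) dE poweR_EFin.
rewrite dE lee_fin in hd; rewrite dE lee_fin in d0.
have agree (n : nat) : d <= expR (- (n%:R * L2)) -> forall z, U z ->
    (forall m, (m < box_length n)%N -> z.1 m = z0.1 m) /\
    (forall m, (m < n)%N -> z.2 m = z0.2 m).
  move=> dn z Uz; have := dist_le_diameter (prod_dist (R := R) r1 r2) Uz Uz0.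
  rewrite dE lee_fin => /le_trans/(_ dn); rewrite /prod_dist ge_max => /andP[h1 h2].
  split => m hm.
    apply: (symb_dist_le_agree _ h1) => //; have /andP[+ _] := box_length_bounds n.
    rewrite ler_pdivlMr//; apply: lt_le_trans; rewrite ltr_pM2r// ltr_nat//.
  apply: (symb_dist_le_agree _ h2); first exact: leq_trans hr1 hr12.
  by rewrite ltr_pM2r// ltr_nat.
have [de|dn0] := eqVneq d 0.
  have [n hn] := big; exists z0.1, z0.2, n, (d `^ t); split => //.
  - exact: powR_ge0.
  - by apply: agree; rewrite de expR_ge0.
  - by apply: (le_trans hn); rewrite lerDr mulr_ge0 ?expR_ge0 ?powR_ge0.
have dp : 0 < d by rewrite lt_neqAle eq_sym dn0.
(* Thus r2^(-n-1) < d <= r2^(-n); the lost factor r2 accounts for [t * L2] in the constant. *)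
pose n := Num.truncn (- ln d / L2).
have /andP[n1 n2] : n%:R <= - ln d / L2 < n.+1%:R.
  by apply: truncn_itv; rewrite divr_ge0 ?(ltW l2)// oppr_ge0 ln_le0.
exists z0.1, z0.2, n, (d `^ t); split => //; first exact: powR_ge0.
  apply: agree; rewrite -[leLHS]lnK ?posrE// ler_expR lerNr.
  by rewrite -ler_pdivlMr.
apply: (@le_trans _ _ (expR (C + t * L2) * d `^ t)); last by rewrite lerDl ltW.
rewrite /powR (negbTE dn0) -expRD ler_expR.
rewrite ler_pdivlMr// in n1; rewrite ltr_pdivrMr// -natr1 in n2.
have : t * (- ln d) <= t * ((n%:R + 1) * L2) by rewrite ler_wpM2l// ltW.
have : t * (L2 * n%:R) <= t' * (L2 * n%:R) by rewrite ler_wpM2r ?mulr_ge0 ?(ltW l2) ?(ltW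
  tt').
by move: (ln d) (ln r2%:R) (n%:R) => *; lra.
Qed.

(** Were the t-measure zero for some t < D, a covering with tiny t-sum would turn into boxes whose
    bounds sum to less than 1. For l close to n L2 / L1 the exponent e1 l + e2 n is n L2 (e1 / L1 +
    e2 / L2), up to a constant. *)
Lemma hausdorff_dim_ge (e1 e2 D : R) (K : set (nat -> A1 * A2))
    (E : set ((nat -> A1) * (nat -> A2))) :
  (forall e : R, 0 < e -> exists C : R,
    forall (x : nat -> nat -> A1) (l : nat -> nat) (y : nat -> nat -> A2) (n : nat -> nat),
    (forall i, (n i <= l i)%N) ->
    (forall z, K z -> exists i, (forall m, (m < l i)%N -> (z m).1 = x i m) /\
       (forall m, (m < n i)%N -> (z m).2 = y i m)) ->
    exists k, 1 <= \sum_(i < k)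
       expR (- (e1 * (l i)%:R) - e2 * (n i)%:R + e * (l i)%:R + C)) ->
  (forall z, K (pair_seq z) -> E z) ->
  D <= e1 / L1 + e2 / L2 ->
  (D%:E <= hausdorff_dim (prod_dist r1 r2) E)%E.
Proof.
move=> hK KE hD.
have l1 := ln_base_gt0 hr1; have l2 := ln_base_gt0 (leq_trans hr1 hr12).
apply: le_ereal_inf_tmp => _ [t [t0 ht] <-]; rewrite lee_fin leNgt; apply/negP => tD.
pose t' := (t + D) / 2.
have tt' : t < t' by rewrite /t'; lra.
(* The error e l is then at most n L2 (D - t) / 2, which lowers the exponent from D to the midpoint
   t'. *)
pose e := L1 * (D - t) / 2.
have e0 : 0 < e by rewrite divr_gt0// mulr_gt0// subr_gt0.
have [C hC] := hK _ e0.
pose C' := C + `|e1|; pose C3 := expR (C' + t * L2).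
have C30 : 0 < C3 := expR_gt0 _.
(* The gauges contribute at most C3 eps and the sets of diameter 0 at most eps, together 1/2. *)
pose eps := (2 * (C3 + 1))^-1.
have eps0 : 0 < eps by rewrite invr_gt0 mulr_gt0// ltr_wpDl// ltW.
have [U [EU Ud Usum]] : exists U : nat -> set ((nat -> A1) * (nat -> A2)),
   [/\ E `<=` \bigcup_i U i,
      forall i, (diameter (prod_dist (R := R) r1 r2) (U i) <= 1%:E)%E &
      (\sum_(i <oo) gauge (prod_dist (R := R) r1 r2) t (U i) < eps%:E)%E].
  have : (hausdorff_premeasure (prod_dist (R := R) r1 r2) t 1 E < eps%:E)%E.
    apply: le_lt_trans (_ : (0 < eps%:E)%E); last by rewrite lte_fin.
    by rewrite -ht; apply: ereal_sup_ubound; exists 1 => //=.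
  by move=> /ereal_inf_lt[_ [U [h1 h2] <-] h3]; exists U.
have eps_gt0 i : 0 < eps * 2^-1 ^+ i.+1 by rewrite mulr_gt0// exprn_gt0 ?invr_gt0.
have hQ i : exists p : (nat -> A1) * (nat -> A2) * nat * R,
    [/\ gauge (prod_dist (R := R) r1 r2) t (U i) = p.2%:E, 0 <= p.2,
     forall z, U i z -> (forall m, (m < box_length p.1.2)%N -> z.1 m = p.1.1.1 m) /\
                        (forall m, (m < p.1.2)%N -> z.2 m = p.1.1.2 m) &
     expR (- (t' * L2 * p.1.2%:R) + C') <= C3 * p.2 + eps * 2^-1 ^+ i.+1].
  have [x [y [n [g h]]]] := cover_by_box C' t0 tt' (eps_gt0 i) (Ud i).
  by exists (x, y, n, g).
have [f hf] := choice hQ.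
pose n i := (f i).1.2; pose l i := box_length (n i).
have hcov z : K z -> exists i, (forall m, (m < l i)%N -> (z m).1 = (f i).1.1.1 m) /\
    (forall m, (m < n i)%N -> (z m).2 = (f i).1.1.2 m).
  move=> Kz; pose zz := (fun i => (z i).1, fun i => (z i).2).
  have Ez : E zz.
    apply: KE; have -> : pair_seq zz = z; last by [].
    by apply/funext => i; rewrite /pair_seq /=; case: (z i).
  have [i _ Ui] := EU _ Ez; exists i; have [_ _ hz _] := hf i.
  exact: (hz _ Ui).
have [k] := hC (fun i => (f i).1.1.1) l (fun i => (f i).1.1.2) n
  (fun i => box_length_ge (n i)) hcov.
apply/negP; rewrite -ltNge.
have term i : expR (- (e1 * (l i)%:R) - e2 * (n i)%:R + e * (l i)%:R + C) <=
    C3 * (f i).2 + eps * 2^-1 ^+ i.+1.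
  have [_ _ _ h] := hf i; apply: le_trans h; rewrite ler_expR -/(n i).
  have /andP[b1 b2] := box_length_bounds (n i); rewrite -/(l i) in b1 b2.
  rewrite -natr1 in b2.
  pose X := (n i)%:R * L2 / L1; rewrite -/X in b1 b2.
  have k1 : e1 * (X - (l i)%:R) <= `|e1|.
    apply: (le_trans (ler_norm _)); rewrite normrM ler_piMr// ger0_norm; lra.
  have k2 : e * (l i)%:R <= e * X by rewrite ler_pM2l.
  have k3 : (n i)%:R * L2 * D <= (n i)%:R * L2 * (e1 / L1 + e2 / L2).
    by rewrite ler_wpM2l// mulr_ge0// ltW.
  have k4 : (n i)%:R * L2 * (e1 / L1 + e2 / L2) = e1 * X + e2 * (n i)%:R.
    by rewrite /X; field; rewrite !gt_eqF.
  have k5 : e * X = (n i)%:R * L2 * ((D - t) / 2) by rewrite /X /e; field; rewrite gt_eqF.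
  rewrite k4 in k3; rewrite k5 in k2; move: k1 k2 k3; rewrite /C' /t'.
  clear b1 b2 k4 k5; clearbody X.
  by move: ((n i)%:R) ((l i)%:R) L2 => *; lra.
apply: (@le_lt_trans _ _ (\sum_(i < k) (C3 * (f i).2 + eps * 2^-1 ^+ i.+1))).
  by apply: ler_sum => i _; apply: term.
rewrite big_split /= -!mulr_sumr.
have gsum : \sum_(i < k) (f i).2 <= eps.
  rewrite -lee_fin -sumEFin; apply: ltW; apply: le_lt_trans Usum.
  have -> : (\sum_(i < k) (f i).2%:E =
     \sum_(0 <= i < k) gauge (prod_dist (R := R) r1 r2) t (U i))%E.
    by rewrite big_mkord; apply: eq_bigr => i _; have [-> _ _ _] := hf i.
  by apply: nneseries_lim_ge => i _ _; apply: gauge_ge0.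
have gsum2 m : \sum_(i < m) (2^-1 : R) ^+ i.+1 <= 1 - 2^-1 ^+ m.
  elim: m => [|m IH]; first by rewrite big_ord0 expr0 subrr.
  rewrite big_ord_recr /= [in leRHS]exprS; move: IH; rewrite exprS.
  by move: (\sum_(i < m) _) (_ ^+ m) => *; lra.
have h1 : C3 * \sum_(i < k) (f i).2 <= C3 * eps by rewrite ler_pM2l.
have h2 : eps * \sum_(i < k) 2^-1 ^+ i.+1 <= eps * 1.
  rewrite ler_pM2l//; apply: le_trans (gsum2 k) _.
  by rewrite gerBl exprn_ge0// invr_ge0.
have h3 : C3 * eps + eps * 1 = 2^-1.
  by rewrite /eps; field; rewrite gt_eqF//; lra.
have h4 : (2^-1 : R) < 1 by rewrite invf_lt1 ?ltr1n.
apply: le_lt_trans h4; apply: (@le_trans _ _ (C3 * eps + eps * 1)); last by rewrite h3.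
exact: lerD.
Qed.

End HausdorffLower.

(** * Hausdorff dimension from above *)

Section HausdorffUpper.
Context {R : realType}.
Variables r1 r2 : nat.
Hypothesis (hr1 : (2 <= r1)%N) (hr12 : (r1 <= r2)%N).
Local Notation A1 := (letter r1).
Local Notation A2 := (letter r2).
Local Notation L1 := (ln r1%:R : R).
Local Notation L2 := (ln r2%:R : R).
Local Notation l := (box_length (R := R) r1 r2).
Local Notation dist := (prod_dist (R := R) r1 r2).

Lemma agree_symb_dist (A : finType) (r : nat) (x x' : nat -> A) (k : nat) :
  (1 < r)%N -> (forall m, (m < k)%N -> x m = x' m) ->
  symb_dist r x x' <= expR (- (k%:R * ln r%:R)) :> R.
Proof.
move=> r1' h; rewrite /symb_dist; case: pselect => [h'|_]; last exact: expR_ge0.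
case: ex_minnP => m xm _; have km : (k <= m)%N.
  by rewrite leqNgt; apply/negP => /h/eqP; apply/negP.
have r0 : (0 : R) < r%:R by rewrite ltr0n ltnW.
rewrite -[X in X ^- _]lnK ?posrE// -expRM_natl -expRN ler_expR lerN2.
by rewrite ler_wpM2r ?ler_nat// ln_ge0// ler1n ltnW.
Qed.

Definition box_of (n : nat) (u : seq A1) (v : seq A2) : set ((nat -> A1) * (nat -> A2)) :=
  [set z | mkseq z.1 (l n) = u /\ mkseq z.2 n = v].

Lemma mkseq_eq (T : Type) (x y : nat -> T) n : mkseq x n = mkseq y n ->
  forall m, (m < n)%N -> x m = y m.
Proof.
move=> e m mn; have := congr1 (fun s => nth (x 0%N) s m) e.
by rewrite !nth_mkseq.
Qed.

(** The floor in [box_length] costs a factor r1 in the first coordinate. *)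
Lemma diameter_box n u v : (diameter dist (box_of n u v) <= (expR (L1 - n%:R * L2))%:E)%E.
Proof.
rewrite /diameter ge_max lee_fin expR_ge0 /=;
  apply: ge_ereal_sup => _ [[z z'] /= [[z1 z2] [z3 z4]] <-].
rewrite lee_fin /prod_dist ge_max /=; apply/andP; split.
  have h : forall m, (m < l n)%N -> z.1 m = z'.1 m by apply: mkseq_eq; rewrite z1 z3.
  apply: (le_trans (agree_symb_dist hr1 h)); rewrite ler_expR.
  have l1 := ln_base_gt0 (R := R) hr1.
  have /andP[_] := box_length_bounds (R := R) hr1 hr12 n.
  by rewrite ltr_pdivrMr// -natr1; lra.
have h : forall m, (m < n)%N -> z.2 m = z'.2 m by apply: mkseq_eq; rewrite z2 z4.
apply: (le_trans (agree_symb_dist (leq_trans hr1 hr12) h)); rewrite ler_expR.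
have := ln_base_gt0 (R := R) hr1; lra.
Qed.

Lemma gauge_box t n u v : 0 <= t ->
  (gauge dist t (box_of n u v) <= (expR (t * (L1 - n%:R * L2)))%:E)%E.
Proof.
move=> t0; rewrite /gauge; case: ifP => _; first by rewrite lee_fin expR_ge0.
have := diameter_box n u v.
have : (0 <= diameter dist (box_of n u v))%E by rewrite /diameter le_max lexx.
case: (diameter _ _) => // d; rewrite !lee_fin => d0 hd.
rewrite /= ?lee_fin [t * _]mulrC expRM.
by apply: ge0_ler_powR => //; rewrite nnegrE// expR_ge0.
Qed.

Lemma exp_geometric_sum (k : R) n0 M : 0 < k ->
  \sum_(m < M) expR (- (k * (n0 + m)%:R)) <= expR (- (k * n0%:R)) / (1 - expR (- k)).
Proof.
move=> k0; have k1 : 0 < 1 - expR (- k) by rewrite subr_gt0 expR_lt1 oppr_lt0.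
rewrite ler_pdivlMr//.
suff : (\sum_(m < M) expR (- (k * (n0 + m)%:R))) * (1 - expR (- k)) =
   expR (- (k * n0%:R)) - expR (- (k * (n0 + M)%:R)).
  by move=> ->; rewrite gerBl expR_ge0.
elim: M => [|M IH]; first by rewrite big_ord0 mul0r addn0 subrr.
have -> : - (k * (n0 + M.+1)%:R) = - (k * (n0 + M)%:R) + - k.
  by rewrite addnS -natr1; ring.
rewrite big_ord_recr /= mulrDl IH expRD.
by move: (expR _) (expR _) (expR _) => *; ring.
Qed.

(** For every n0 the selected boxes of scale at least n0 cover E. Their t-gauges at scale n sum to
    at most a constant times e^(- k n), so the total is the tail of a geometric series. *)
Lemma hausdorff_measure_eq0 (E : set ((nat -> A1) * (nat -> A2))) (t k B : R)
    (sel : nat -> seq A1 -> seq A2 -> bool) :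
  0 < t -> 0 < k ->
  (forall z, E z -> forall n0, exists2 n, (n0 <= n)%N &
     sel n (mkseq z.1 (l n)) (mkseq z.2 n)) ->
  (forall n, ws (l n) (fun u => ws n (fun v => (sel n u v)%:R)) <=
     B * expR (t * L2 * n%:R - k * n%:R)) ->
  hausdorff_measure dist t E = 0%E.
Proof.
move=> t0 k0 hE hsum; have l2 := ln_base_gt0 (R := R) (leq_trans hr1 hr12).
have B0 : 0 <= B.
  have := hsum 0%N; rewrite !mulr0 subrr expR0 mulr1; apply: le_trans.
  by apply: ws_ge0 => u _; apply: ws_ge0.
have pre_ge0 d : (0 <= hausdorff_premeasure dist t d E)%E.
  apply: le_ereal_inf_tmp => _ [U _ <-]; apply: nneseries_ge0 => i _ _.
  exact: gauge_ge0.
apply/eqP; rewrite eq_le; apply/andP; split; last first.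
  apply: le_trans (pre_ge0 1) _; apply: ereal_sup_ubound; by exists 1 => //=.
apply: ge_ereal_sup => _ [d /= d0 <-].
apply/lee_addgt0Pr => eps eps0; rewrite add0e.
pose C := expR (t * L1) * B / (1 - expR (- k)).
have k1 : 0 < 1 - expR (- k) by rewrite subr_gt0 expR_lt1 oppr_lt0.
have C0 : 0 <= C by rewrite divr_ge0 ?mulr_ge0 ?expR_ge0 ?(ltW k1).
have [n0 hn1 hn2] : exists2 n0 : nat, forall n, (n0 <= n)%N -> L1 - n%:R * L2 <= ln d &
    (C + 1) * expR (- (k * n0%:R)) <= eps.
  pose X := (L1 - ln d) / L2; pose Y := (ln (C + 1) - ln eps) / k.
  exists (Num.truncn X + (Num.truncn Y).+1)%N.
    move=> n hn; have : X < n%:R.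
      by apply: lt_of_truncn; apply: leq_trans hn; rewrite addnS ltnS leq_addr.
    by rewrite ltr_pdivrMr// => h; lra.
  set n0 := (_ + _)%N; have : Y < n0%:R.
    by apply: lt_of_truncn; rewrite /n0 addnS ltnS leq_addl.
  clearbody n0; rewrite ltr_pdivrMr// => h.
  have C1 : 0 < C + 1 by lra.
  rewrite -[C + 1]lnK ?posrE// -expRD -[leRHS]lnK ?posrE// ler_expR.
  by move: (ln _) (ln _) h => *; lra.
pose ok (p : seq A1 * seq A2) := [&& (n0 <= size p.2)%N, size p.1 == l (size p.2) &
   sel (size p.2) p.1 p.2].
(* Pairs of words are enumerated by [pickle_inv]; an index that codes no selected box gives the
   empty set, whose gauge is 0. *)
pose U (i : nat) : set ((nat -> A1) * (nat -> A2)) :=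
  if pickle_inv i is Some p then if ok p then box_of (size p.2) p.1 p.2 else set0 else set0.
pose G (i : nat) : R := if pickle_inv i is Some p then
  (if ok p then expR (t * (L1 - (size (p : seq A1 * seq A2).2)%:R * L2)) else 0) else 0.
have GU i : (gauge dist t (U i) <= (G i)%:E)%E.
  rewrite /U /G; case: pickle_inv => [p|]; last by rewrite /gauge eqxx.
  case: ifP => _; last by rewrite /gauge eqxx.
  exact/gauge_box/ltW.
apply: (@le_trans _ _ (\sum_(i <oo) gauge dist t (U i))%E).
  apply: ereal_inf_lbound; exists U => //; split.
    move=> z Ez; have [n nn0 hz] := hE z Ez n0.
    exists (pickle (mkseq z.1 (l n), mkseq z.2 n)) => //.
    by rewrite /U pickleK_inv /ok !size_mkseq nn0 eqxx hz.
  move=> i; rewrite /U.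
  have d00 : (diameter dist set0 <= d%:E)%E.
    rewrite /diameter ge_max lee_fin (ltW d0) /=.
    by apply: ge_ereal_sup => _ [[z z'] /= [[]]].
  case: pickle_inv => [p|] //; case: ifP => // /and3P[pn _ _].
  apply: (le_trans (diameter_box _ _ _)); rewrite lee_fin.
  rewrite -[leRHS]lnK ?posrE// ler_expR; exact: hn1.
apply: lime_le.
  by apply: is_cvg_nneseries => i _ _; apply: gauge_ge0.
apply: nearW => N /=.
apply: (@le_trans _ _ (\sum_(0 <= i < N) (G i)%:E)%E).
  by apply: lee_sum => i _; apply: GU.
rewrite sumEFin lee_fin big_mkord.
pose M := (\max_(i < N) if pickle_inv i is Some p then (size (p : seq A1 * seq A2).2).+1
  else 0%N)%N.
pose g (m : nat) := expR (t * (L1 - (n0 + m)%:R * L2)).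
(* Writing each term as a sum over all boxes lets the sum over indices be taken first; by
   injectivity of the coding it counts each box at most once. *)
have GM (i : 'I_N) : G i <= \sum_(m < M) ws (l (n0 + m)) (fun u => ws (n0 + m) (fun v =>
     (pickle_inv i == Some (u, v))%:R * ((sel (n0 + m)%N u v)%:R * g m))).
  have nn (m : nat) u v : 0 <= (pickle_inv i == Some (u, v))%:R * ((sel (n0 + m)%N u
    v)%:R * g m).
    by rewrite !mulr_ge0 ?expR_ge0.
  have nn2 : 0 <= \sum_(m < M) ws (l (n0 + m)) (fun u => ws (n0 + m) (fun v =>
     (pickle_inv i == Some (u, v))%:R * ((sel (n0 + m)%N u v)%:R * g m))).
    by apply: sumr_ge0 => m _; apply: ws_ge0 => u _; apply: ws_ge0 => v _.
  rewrite {1}/G; case Ei : (pickle_inv i) => [p|] //; last by rewrite -Ei.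
  case: ifP => [/and3P[pn /eqP p1 ps]|_]; last by rewrite -Ei.
  have pM : (size p.2 - n0 < M)%N.
    have := leq_bigmax (F := fun i : 'I_N => (if pickle_inv i is Some p then (size (p :
      seq A1 * seq A2).2).+1 else 0%N)) i.
    by rewrite Ei -/M => h; apply: leq_ltn_trans h; rewrite leq_subr.
  have e0 : (n0 + (size p.2 - n0) = size p.2)%N by rewrite subnKC.
  rewrite (bigD1 (Ordinal pM)) //= -Ei.
  rewrite -[leLHS]addr0; apply: lerD; last first.
    by apply: sumr_ge0 => m _; apply: ws_ge0 => u _; apply: ws_ge0 => v _.
  apply: le_trans (ws_le_term (F := fun u => ws (n0 + (size p.2 - n0)) (fun v =>
     (pickle_inv i == Some (u, v))%:R * ((sel (n0 + (size p.2 - n0))%N u v)%:R * g (size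
       p.2 - n0)%N))) (u := p.1) _ _).
  - apply: le_trans (ws_le_term (F := fun v =>
     (pickle_inv i == Some (p.1, v))%:R * ((sel (n0 + (size p.2 - n0))%N p.1 v)%:R * g
       (size p.2 - n0)%N)) (u := p.2) _ _).
    + by rewrite Ei -surjective_pairing eqxx /g e0 ps !mul1r.
    + by move=> v _; apply: nn.
    + by rewrite e0.
  - by move=> u _; apply: ws_ge0 => v _.
  - by rewrite e0.
apply: (le_trans (ler_sum _ (fun i _ => GM i))).
rewrite exchange_big /=.
apply: (@le_trans _ _ (\sum_(m < M) expR (t * L1) * B * expR (- (k * (n0 + m)%:R)))).
  apply: ler_sum => m _.
  apply: (@le_trans _ _ (ws (l (n0 + m)) (fun u => ws (n0 + m) (fun v => (sel (n0 + m)%N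
    u v)%:R * g m)))).
    rewrite -ws_sum; apply: ler_ws => u _; rewrite -ws_sum; apply: ler_ws => v _.
    rewrite -mulr_suml ler_piMl//; first by rewrite mulr_ge0 ?expR_ge0.
    apply: sum_disjoint_ind => i j /eqP ei /eqP ej; apply/val_inj => /=.
    have := pickle_invK (T := (seq A1 * seq A2)%type) i; rewrite ei /= => <-.
    by have := pickle_invK (T := (seq A1 * seq A2)%type) j; rewrite ej /= => <-.
  have -> : ws (l (n0 + m)) (fun u => ws (n0 + m) (fun v => (sel (n0 + m)%N u v)%:R * g
    m)) =
      ws (l (n0 + m)) (fun u => ws (n0 + m) (fun v => (sel (n0 + m)%N u v)%:R)) * g m.
    by rewrite -wsZr; apply: eq_ws => u _; rewrite wsZr.
  apply: (le_trans (ler_wpM2r (expR_ge0 _) (hsum _))).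
  rewrite -[leLHS]mulrA /g -expRD [expR (t * L1) * B]mulrC -[leRHS]mulrA -expRD.
  rewrite ler_wpM2l// ler_expR; move: ((n0 + m)%:R) => x; lra.
rewrite -mulr_sumr; apply: le_trans hn2.
apply: (le_trans (ler_wpM2l _ (exp_geometric_sum n0 M k0))).
  by rewrite mulr_ge0 ?expR_ge0.
have -> : expR (t * L1) * B * (expR (- (k * n0%:R)) / (1 - expR (- k))) =
    C * expR (- (k * n0%:R)) by rewrite /C; ring.
by rewrite ler_wpM2r ?expR_ge0// lerDl.
Qed.

End HausdorffUpper.

(** * Weights of approximate squares and the upper bound for level sets *)

Section LevelSetUpper.
Context {R : realType}.
Variables r1 r2 : nat.
Hypothesis (hr1 : (2 <= r1)%N) (hr12 : (r1 <= r2)%N).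
Local Notation A1 := (letter r1).
Local Notation A2 := (letter r2).
Local Notation L1 := (ln r1%:R : R).
Local Notation L2 := (ln r2%:R : R).
Local Notation l := (box_length (R := R) r1 r2).
Local Notation s := (L1 / L2).

Let l1 : 0 < L1. Proof. exact: ln_base_gt0 hr1. Qed.
Let l2 : 0 < L2. Proof. exact: ln_base_gt0 (leq_trans hr1 hr12). Qed.

Lemma base_ratio : 0 < s <= 1.
Proof.
rewrite divr_gt0//= ler_pdivrMr// mul1r ler_ln ?posrE ?ltr0n ?ler_nat//.
  exact: leq_trans hr1.
exact: leq_trans (leq_trans hr1 hr12).
Qed.

(* Otherwise u_n / n would decrease by a fixed amount along the iterates of l. *)
Lemma recurrent_scale (u : nat -> R) (B eps : R) (n0 : nat) : 0 < eps ->
  (forall n, (0 < n)%N -> `|u n| <= B * n%:R) ->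
  exists2 n, (n0 <= n)%N & - (eps * n%:R) <= s * u (l n) - u n.
Proof.
move=> eps0 hu; apply: contrapT => hn.
have hlt n : (n0 <= n)%N -> s * u (l n) < u n - eps * n%:R.
  move=> nn0; rewrite ltNge; apply/negP => h; apply: hn; exists n => //; lra.
(* Beyond N0 the rounding error B in replacing s l(n) by n is at most eps n / 2. *)
pose N0 := maxn n0 (Num.truncn (2 * B / eps)).+1.
have step n : (N0 <= n)%N -> u (l n) / (l n)%:R <= u n / n%:R - eps / 2.
  rewrite geq_max => /andP[/hlt h1 h2].
  have n_gt0 : (0 < n)%N by apply: leq_trans h2.
  have nR : (0 : R) < n%:R by rewrite ltr0n.
  have l_gt0 : (0 < l n)%N := leq_trans n_gt0 (box_length_ge (R := R) hr1 hr12 n).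
  have lR : (0 : R) < (l n)%:R by rewrite ltr0n.
  have hB := hu _ l_gt0; have h3 := lt_of_truncn h2.
  rewrite ltr_pdivrMr// in h3.
  have /andP[b1 b2] := box_length_bounds (R := R) hr1 hr12 n.
  have /andP[s0 s1] := base_ratio.
  rewrite ler_pdivlMr// in b1; rewrite ltr_pdivrMr// -natr1 in b2.
  have c1 : s * (l n)%:R <= n%:R by rewrite mulrAC ler_pdivrMr// mulrC.
  have c2 : n%:R - s < s * (l n)%:R.
    have : n%:R < s * ((l n)%:R + 1) by rewrite mulrAC ltr_pdivlMr// [ltRHS]mulrC.
    by rewrite mulrDr mulr1 => ?; lra.
  rewrite -(ler_pM2l nR) mulrBr [X in _ <= X - _]mulrCA divff ?gt_eqF// mulr1.
  set f := u (l n) / (l n)%:R.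
  have uE : u (l n) = f * (l n)%:R by rewrite /f divfK ?gt_eqF.
  have fB : `|f| <= B by rewrite /f normrM normfV (gtr0_norm lR) ler_pdivrMr.
  have k1 : f * (n%:R - s * (l n)%:R) <= B.
    apply: (le_trans (ler_norm _)); rewrite normrM -[leRHS]mulr1.
    by apply: ler_pM => //; rewrite ger0_norm; lra.
  rewrite uE in h1; move: h1 k1 h3; clearbody f; move: s => s'; lra.
have hN k : (N0 <= iter k l N0)%N.
  elim: k => //= k IH; exact: leq_trans IH (box_length_ge (R := R) hr1 hr12 _).
have dec k : u (iter k l N0) / (iter k l N0)%:R <= u N0 / N0%:R - k%:R * (eps / 2).
  elim: k => [|k IH] /=; first by rewrite mul0r subr0.
  apply: (le_trans (step _ (hN k))); rewrite -[k.+1%:R]natr1; move: IH.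
  by move: (u (iter k l N0) / _) (u N0 / _) => *; lra.
have low k : - B <= u (iter k l N0) / (iter k l N0)%:R.
  have pos : (0 < iter k l N0)%N by apply: leq_trans (hN k); rewrite leq_max orbT.
  have posR : (0 : R) < (iter k l N0)%:R by rewrite ltr0n.
  by rewrite ler_pdivlMr//; have := hu _ pos; rewrite ler_norml mulNr => /andP[].
pose X := (u N0 / N0%:R + B) / (eps / 2).
have h1 := dec (Num.truncn X).+1; have h2 := low (Num.truncn X).+1.
have : X < (Num.truncn X).+1%:R by apply: truncnS_gt.
rewrite ltr_pdivrMr ?divr_gt0//; move: h1 h2.
move: (u (iter _ l N0) / _) (u N0 / _) (_.+1%:R) => x y k; lra.
Qed.

Variables (c : R) (S : pred (A1 * A2)) (psi : seq (A1 * A2) -> R) (a0 : A1 * A2).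
Hypothesis (hpsi : quasi_mult c S psi) (Sa0 : S a0).

Local Notation S1 := (proj1_pred S).
Local Notation J := (fiber_pow psi).
Local Notation P := (skew_pressure s psi).
Variable q : R.

(* Up to a constant, the mass of the approximate square [u] x [v] for the Gibbs-type
   measure associated with I_q^(s-1) psi^q. *)
Definition box_weight (n : nat) (u : seq A1) (v : seq A2) : R :=
  expR (- ((l n)%:R * P q)) *
    (pow0 (psi (zip (take n u) v)) q * (pow0 (J q u) s / J q (take n u))).

Let psi_ge0 w : 0 <= psi w. Proof. exact: quasi_mult_ge0 hpsi w. Qed.

Lemma box_weight_ge0 n u v : 0 <= box_weight n u v.
Proof.
apply: mulr_ge0; first exact: expR_ge0.
by apply: mulr_ge0; rewrite ?divr_ge0 ?pow0_ge0 ?(fiber_pow_ge0 hpsi).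
Qed.

(** Summing psi^q over v cancels the denominator I_q(u|n) and leaves the partition sum of I_q^s at
    length l(n). *)
Lemma box_weight_sum : exists C : R, forall n,
  ws (l n) (fun u => ws n (fun v => box_weight n u v)) <= expR C.
Proof.
have hp := quasi_mult_fiber_pows s hpsi q.
exists (`|s| * (`|q| * c)) => n.
have h := pressure_upper hp (proj1_pred0 Sa0) (l n).
apply: (@le_trans _ _ (ws (l n) (fun u => expR (- ((l n)%:R * P q)) * pow0 (J q u) s))).
  apply: ler_ws => u su; rewrite /box_weight wsZ ler_pM2l ?expR_gt0// wsZr.
  have st : size (take n u) = n by rewrite size_takel// su (box_length_ge (R := R)).
  have -> : ws n (fun v => pow0 (psi (zip (take n u) v)) q) = J q (take n u).
    by rewrite /fiber_pow /fiber_ws st.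
  have := fiber_pow_ge0 hpsi q (take n u); rewrite le_eqVlt => /orP[/eqP <-|h0].
    by rewrite mul0r pow0_ge0.
  by rewrite mulrCA divff ?gt_eqF// mulr1.
rewrite wsZ; apply: (le_trans (ler_wpM2l (expR_ge0 _) h)).
by rewrite -expRD ler_expR -/(P q); move: (P q) => p; lra.
Qed.

Lemma box_weight_point n x y : all S (zip (mkseq x n) (mkseq y n)) ->
  all S1 (mkseq x (l n)) ->
  box_weight n (mkseq x (l n)) (mkseq y n) =
  expR (- ((l n)%:R * P q) + q * ln (psi (zip (mkseq x n) (mkseq y n))) +
    (s * ln (J q (mkseq x (l n))) - ln (J q (mkseq x n)))).
Proof.
move=> Sn Sl; rewrite /box_weight take_mkseq ?(box_length_ge (R := R))//.
have p0 : 0 < psi (zip (mkseq x n) (mkseq y n)) by case: hpsi => -[_ h _] _; apply: h.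
have j1 := fiber_pow_gt0 hpsi q Sl.
have j2 : 0 < J q (mkseq x n).
  by apply: (fiber_pow_gt0 hpsi); apply: all_zip_proj1 Sn; rewrite !size_mkseq.
have e : (J q (mkseq x n))^-1 = expR (- ln (J q (mkseq x n))) by rewrite expRN lnK.
by rewrite e !pow0E// -!expRD; congr expR; rewrite !addrA.
Qed.

Lemma zip_mkseq x y n : zip (mkseq x n) (mkseq y n) = mkseq (fun i => (x i, y i)) n :>
  seq (A1 * A2).
Proof. by rewrite /mkseq; elim: (iota 0 n) => //= i t ->. Qed.

Variable alpha : R.

Lemma level_set_growth z : E_psi psi alpha z ->
  (forall n, all S (zip (mkseq z.1 n) (mkseq z.2 n))) /\
  forall e : R, 0 < e -> exists n0 : nat, forall n, (n0 <= n)%N ->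
    `|ln (psi (zip (mkseq z.1 n) (mkseq z.2 n))) + n%:R * (alpha * L2)| <= e * n%:R.
Proof.
move=> [hsupp hlim]; split.
  move=> n; apply: contraT => nS; have := hsupp n.
  by rewrite /prefix_of /pair_seq -zip_mkseq; case: hpsi => _ ->; rewrite ?ltxx.
move=> e e0; move/cvgrPdist_le : hlim => /(_ _ (divr_gt0 e0 l2)) [n1 _ h1].
exists (maxn n1 1) => n; rewrite geq_max => /andP[/h1 /= + n_gt0].
have nR : (0 : R) < n%:R by rewrite ltr0n.
rewrite /prefix_of; move: (ln (psi _)) => x h.
have -> : x + n%:R * (alpha * L2) = (alpha - x / L2 / - n%:R) * (n%:R * L2).
  by field; rewrite !gt_eqF ?oppr_eq0 ?gt_eqF.
rewrite normrM (gtr0_norm (mulr_gt0 nR l2)).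
have -> : e * n%:R = e / L2 * (n%:R * L2) by field; rewrite gt_eqF.
by rewrite ler_pM2r// mulr_gt0.
Qed.

(** psi^q has its prescribed decay at all large scales, and [recurrent_scale] supplies scales where
    the ratio of fiber sums is not too small. The term |P q| pays for the rounding of l(n). *)
Lemma level_set_weight z (delta : R) n0 : E_psi psi alpha z -> 0 < delta ->
  exists2 n, (n0 <= n)%N &
    expR (- (n%:R * (L2 * (alpha * q + P q / L1) + delta)) - `|P q|) <=
    box_weight n (mkseq z.1 (l n)) (mkseq z.2 n).
Proof.
move=> /level_set_growth[hS hg] d0.
have q1 : 0 < `|q| + 1 by rewrite ltr_wpDl.
pose eps := delta / (`|q| + 1); have eps0 : 0 < eps by rewrite divr_gt0.
have [n1 h1] := hg _ eps0.
pose u n := ln (J q (mkseq z.1 n)).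
have hS1 n : all S1 (mkseq z.1 n).
  by apply: all_zip_proj1 (hS n); rewrite !size_mkseq.
have [K K0 hK] := quasi_mult_on_ln_bound (quasi_mult_fiber_pow hpsi q).1.
set cc := `|q| * c in hK.
have cc0 : 0 <= cc by rewrite mulr_ge0//; case: hpsi => -[].
have hu n : (0 < n)%N -> `|u n| <= (K + cc) * n%:R.
  move=> n_gt0; apply: (le_trans (hK _ (hS1 n))); rewrite size_mkseq mulrDl lerD2l.
  by rewrite ler_peMr// ler1n.
have [n nn hn] := recurrent_scale (maxn n0 n1) eps0 hu.
exists n; first by apply: leq_trans nn; apply: leq_maxl.
rewrite box_weight_point// ler_expR -!/(u _).
have h2 := h1 n (leq_trans (leq_maxr _ _) nn).
have /andP[b1 b2] := box_length_bounds (R := R) hr1 hr12 n; rewrite -natr1 in b2.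
pose X := n%:R * L2 / L1; rewrite -/X in b1 b2.
have k1 : ((l n)%:R - X) * P q <= `|P q|.
  apply: (le_trans (ler_norm _)); rewrite normrM ler_piMl//.
  by rewrite ler_norml; apply/andP; split; lra.
have k2 : - (q * (ln (psi (zip (mkseq z.1 n) (mkseq z.2 n))) + n%:R * (alpha * L2))) <=
    `|q| * (eps * n%:R).
  by rewrite -mulNr; apply: (le_trans (ler_norm _)); rewrite normrM normrN ler_wpM2l.
have k3 : n%:R * (L2 * (alpha * q + P q / L1) + delta) =
    q * (n%:R * (alpha * L2)) + X * P q + (`|q| * (eps * n%:R) + eps * n%:R).
  by rewrite /X /eps; field; rewrite !gt_eqF.
rewrite k3; move: k1 k2 hn; clear b1 b2 k3; clearbody X.
move: (ln (psi _)) (`|P q|) (P q) (`|q|) (s * _) (u n) => *; lra.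
Qed.

(** A point of the level set would lie in single boxes of weight exceeding the bounded total. *)
Lemma level_set_empty : alpha * q + P q / L1 < 0 -> E_psi psi alpha = set0.
Proof.
move=> D0; rewrite -subset0 => z Ez /=.
set D := alpha * q + _ in D0.
have [C hC] := box_weight_sum.
pose delta := - (L2 * D) / 2.
have d0 : 0 < delta by rewrite divr_gt0// oppr_gt0 pmulr_rlt0.
pose X := (C + `|P q|) / delta.
have [n hn] := level_set_weight (Num.truncn X).+1 Ez d0.
apply/negP; rewrite -ltNge.
have h1 : box_weight n (mkseq z.1 (l n)) (mkseq z.2 n) <= expR C.
  apply: le_trans (hC n); apply: le_trans (ws_le_term
    (F := fun u => ws n (fun v => box_weight n u v)) (u := mkseq z.1 (l n)) _ _).
  - apply: (ws_le_term (F := fun v => box_weight n _ v)); last by rewrite size_mkseq.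
    by move=> w _; apply: box_weight_ge0.
  - by move=> w _; apply: ws_ge0 => v _; apply: box_weight_ge0.
  - by rewrite size_mkseq.
apply: (le_lt_trans h1); rewrite ltr_expR.
have := lt_of_truncn hn; rewrite ltr_pdivrMr//.
have -> : L2 * (alpha * q + P q / L1) = - (2 * delta) by rewrite /delta -/D; field.
by move: (`|P q|) => p; lra.
Qed.

Lemma level_set_dim_le t : 0 < t -> alpha * q + P q / L1 < t ->
  (hausdorff_dim (prod_dist r1 r2) (E_psi psi alpha) <= t%:E)%E.
Proof.
move=> t0 Dt; apply: ereal_inf_lbound; exists t => //; split; first exact: ltW.
set D := alpha * q + _ in Dt.
have [C hC] := box_weight_sum.
pose delta := L2 * (t - D) / 2.
have d0 : 0 < delta by rewrite divr_gt0// mulr_gt0// subr_gt0.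
(* Heavy boxes are selected; by Markov's inequality their number is at most the total weight divided
   by the threshold. *)
pose sel n u v := expR (- (n%:R * (L2 * D + delta)) - `|P q|) <= box_weight n u v.
apply: (hausdorff_measure_eq0 hr1 hr12 (k := delta) (B := expR (C + `|P q|)) (sel :=
  sel)) => //.
  by move=> z Ez n0; apply: level_set_weight.
move=> n; have -> : t * L2 * n%:R - delta * n%:R = n%:R * (L2 * D + delta).
  by rewrite /delta; field.
have -> : expR (C + `|P q|) * expR (n%:R * (L2 * D + delta)) =
    expR (n%:R * (L2 * D + delta) + `|P q|) * expR C by rewrite -!expRD; congr expR; ring.
apply: le_trans (ler_wpM2l (expR_ge0 _) (hC n)); rewrite -wsZ.
apply: ler_ws => u _; rewrite -wsZ; apply: ler_ws => v _.
case: (boolP (sel n u v)) => h; last first.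
  by apply: mulr_ge0; [exact: expR_ge0|exact: box_weight_ge0].
apply: le_trans (ler_wpM2l (expR_ge0 _) h); rewrite -expRD -[leLHS]expR0 ler_expR; lra.
Qed.

End LevelSetUpper.

(** * Level sets *)

Section AlmostMultiplicativeSupport.
Context {R : realType} {A : finType}.

(** The two inequalities make psi (u ++ v) positive exactly when both factors are, so positivity is
    decided letter by letter. The empty word has positive value since otherwise psi would vanish
    identically. *)
Lemma almost_multiplicative_quasi_mult (psi : seq A -> R) :
  almost_multiplicative psi ->
  exists c, quasi_mult c (fun a => 0 < psi [:: a]) psi.
Proof.
move=> [psi0 [w0 w0n] [C C0 hC]].
have up u v : psi (u ++ v) <= C * psi u * psi v by case/andP: (hC u v).
have low u v : C^-1 * psi u * psi v <= psi (u ++ v) by case/andP: (hC u v).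
have nil_gt0 : 0 < psi [::].
  rewrite lt_neqAle psi0 andbT eq_sym; apply: contra w0n => /eqP e.
  by have := up w0 [::]; rewrite cats0 e mulr0 => h; rewrite eq_le h psi0.
have CE : C = expR (ln C) by rewrite lnK.
exists `|ln C|; apply: quasi_mult_intro => //.
- elim=> [_|a w IH /= /andP[Sa Sw]]; first exact: nil_gt0.
  by apply: lt_le_trans (low [:: a] w); rewrite !mulr_gt0 ?invr_gt0 ?IH.
- elim=> // a w IH /=; rewrite negb_and => h; apply/eqP; rewrite eq_le psi0 andbT.
  apply: (le_trans (up [:: a] w)); case/orP: h => h; last by rewrite IH// mulr0.
  by move: h; rewrite -leNgt => h; rewrite -mulrA mulr_ge0_le0 ?(ltW C0)// mulr_le0_ge0.
- move=> u v _ _; apply: (le_trans (up u v)); rewrite -mulrA ler_wpM2r ?mulr_ge0//.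
  by rewrite {1}CE ler_expR ler_norm.
- move=> u v _ _; apply: (@le_trans _ _ (C * psi (u ++ v))).
    by rewrite -ler_pdivrMl// mulrA low.
  by rewrite ler_wpM2r// {1}CE ler_expR ler_norm.
Qed.

End AlmostMultiplicativeSupport.

Section ClusterPoint.
Context {R : realType}.

(** The limit is the supremum of the x that admissible e exceed for every eta. It serves to fix one
    split of the entropy between base and fibers for all blocks. *)
Lemma cluster_point (Q : R -> R -> Prop) (lo hi : R) :
  (forall eta eta' e, eta <= eta' -> Q eta e -> Q eta' e) ->
  (forall eta, 0 < eta -> exists2 e, lo <= e <= hi & Q eta e) ->
  exists e0, forall eta, 0 < eta -> exists2 e, `|e - e0| <= eta & Q eta e.
Proof.
move=> Qmono Qex.
pose X := [set x | forall eta, 0 < eta -> exists2 e, x <= e <= hi & Q eta e].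
have Xsup : has_sup X.
  split; first by exists lo.
  by exists hi => x /(_ 1 ltr01)[e /andP[h1 h2] _]; apply: le_trans h1 h2.
exists (sup X) => eta eta0.
have [x Xx hx] := sup_adherent eta0 Xsup.
have nX : ~ X (sup X + eta).
  move=> h; have := ub_le_sup Xsup.2 h; rewrite leNgt => /negP; apply.
  by rewrite ltrDl.
have [eta1 [eta10 h1]] : exists eta1, 0 < eta1 /\
    forall e, sup X + eta <= e <= hi -> ~ Q eta1 e.
  apply: contrapT => hn; apply: nX => eta1 eta10; apply: contrapT => hn2; apply: hn.
  by exists eta1; split => // e he Qe; apply: hn2; exists e.
have m0 : 0 < Num.min eta eta1 by rewrite lt_min eta0.
have [e /andP[xe ehi] Qe] := Xx _ m0.
exists e; last by apply: Qmono Qe; rewrite ge_min lexx.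
rewrite ler_norml; apply/andP; split; first by lra.
rewrite lerBlDl leNgt; apply/negP => h.
have ee : sup X + eta <= e <= hi by rewrite ehi ltW.
by apply: (h1 e ee); apply: Qmono Qe; rewrite ge_min lexx orbT.
Qed.

End ClusterPoint.

Lemma moran_block_weaken {R : realType} {A1 A2 : finType} (S : pred (A1 * A2))
    (psi m : seq (A1 * A2) -> R) (beta e1 e2 eta beta' e1' e2' eta' d : R) N :
  moran_block S psi beta' e1' e2' eta' N m ->
  `|beta - beta'| <= d -> e1 <= e1' + d -> e1 + e2 <= e1' + e2' + d ->
  eta' + d <= eta -> moran_block S psi beta e1 e2 eta N m.
Proof.
move=> [h1 h2 h3 h4 h5] hb he1 he2 heta; split => //.
- move=> w sw mw; have [Sw hw] := h3 w sw mw; split => //.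
  have -> : ln (psi w) + N%:R * beta =
    (ln (psi w) + N%:R * beta') + N%:R * (beta - beta') by ring.
  apply: (le_trans (ler_normD _ _)); rewrite normrM ger0_norm//.
  apply: (@le_trans _ _ (N%:R * eta' + N%:R * d)); first by rewrite lerD// ler_wpM2l.
  by rewrite -mulrDr ler_wpM2l.
- move=> w sw; apply: (le_trans (h4 w sw)).
  by rewrite ler_expR lerN2 ler_wpM2l//; lra.
- move=> u su; apply: (le_trans (h5 u su)).
  by rewrite ler_expR lerN2 ler_wpM2l//; lra.
Qed.

Section LevelSets.
Context {R : realType}.
Variables r1 r2 : nat.
Hypothesis (hr1 : (2 <= r1)%N) (hr12 : (r1 <= r2)%N).
Local Notation A1 := (letter r1).
Local Notation A2 := (letter r2).
Local Notation L1 := (ln r1%:R : R).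
Local Notation L2 := (ln r2%:R : R).
Local Notation s := (L1 / L2).
Variables (c : R) (S : pred (A1 * A2)) (psi : seq (A1 * A2) -> R) (a0 : A1 * A2).
Hypothesis (hpsi : quasi_mult c S psi) (Sa0 : S a0).
Local Notation P := (skew_pressure s psi).

Let l1 : 0 < L1. Proof. exact: ln_base_gt0 hr1. Qed.
Let l2 : 0 < L2. Proof. exact: ln_base_gt0 (leq_trans hr1 hr12). Qed.
Let s01 : 0 < s <= 1. Proof. exact: base_ratio. Qed.

Lemma T_psiE q : T_psi psi q = - (P q / L1).
Proof. by []. Qed.

Lemma T_psi_convex : convex_function [set: R^o] (fun q => - T_psi psi q).
Proof.
have -> : (fun q => - T_psi psi q) = (fun q => P q / L1).
  by apply/funext => q; rewrite T_psiE opprK.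
move=> t x y _ _; rewrite [X in _ <= X]convRE /unstable.onem.
have t01 : 0 <= (t%:num : R) <= 1 by rewrite ge0 le1.
(* [conv t x y] puts the weight t on x, hence the exchanged endpoints. *)
have := skew_pressure_convex hpsi Sa0 s01 y x t01.
have -> : conv t x y = (1 - t%:num) * y + t%:num * x :> R.
  by rewrite [RHS]addrC; exact: (convRE (x : R^o) (y : R^o) t).
have e (p p' u : R) : ((1 - u) * p' + u * p) / L1 = u * (p / L1) + (1 - u) * (p' / L1).
  by ring.
rewrite -(ler_pM2r (_ : 0 < L1^-1)) ?invr_gt0// e => h.
exact: h.
Qed.

Lemma T_psi_derivable q : derivable (T_psi psi) q 1.
Proof.
have [b hb] := skew_pressure_near hpsi Sa0 s01 q.
have [hd _] := convex_near_is_derive (skew_pressure_convex hpsi Sa0 s01) hb.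
have -> : T_psi psi = - (L1^-1 *: (P : R -> R)).
  by apply/funext => x; rewrite T_psiE mulrC.
by apply: derivableN; apply: derivableZ.
Qed.

Lemma T_psi_mono : (forall w, psi w <= 1) -> {homo T_psi psi : q q' / q <= q'}.
Proof.
move=> psi1 q q' qq'; rewrite (T_psiE q) (T_psiE q').
have := skew_pressure_mono hpsi Sa0 s01 psi1 qq'.
by move: (P q) (P q') => p p' h; rewrite lerN2 ler_pM2r ?invr_gt0.
Qed.

Variable alpha : R.

Lemma moran_set_level_set (K : set (nat -> A1 * A2)) :
  (forall e : R, 0 < e -> exists C : R, forall z, K z -> forall n,
    all S (mkseq z n) /\ `|ln (psi (mkseq z n)) + n%:R * (alpha * L2)| <= e * n%:R + C) ->
  forall z, K (pair_seq z) -> E_psi psi alpha z.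
Proof.
move=> hK z Kz; split.
  move=> n; have [C hC] := hK 1 ltr01; have [Sn _] := hC _ Kz n.
  by case: hpsi => -[_ h _] _; apply: h.
apply/cvgrPdist_le => e e0.
have e2 : 0 < e * L2 / 2 by rewrite divr_gt0 ?mulr_gt0.
have [C hC] := hK _ e2.
exists (maxn (Num.truncn (C / (e * L2 / 2))).+1 1) => // n /=.
rewrite geq_max => /andP[n1 n_gt0].
have nR : (0 : R) < n%:R by rewrite ltr0n.
have {}n1 := lt_of_truncn n1; rewrite ltr_pdivrMr// in n1.
have [_] := hC _ Kz n; rewrite /prefix_of zip_mkseq /pair_seq.
move: (ln (psi _)) => x h.
rewrite -(ler_pM2r (mulr_gt0 nR l2)) -[X in _ * X <= _](gtr0_norm (mulr_gt0 nR l2)) -normrM.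
have -> : (alpha - x / L2 / - n%:R) * (n%:R * L2) = x + n%:R * (alpha * L2).
  by field; rewrite !gt_eqF ?oppr_eq0 ?gt_eqF.
apply: (le_trans h); lra.
Qed.

(** The minimiser q, and with it the split of the entropy, varies with eta; the total is controlled
    by [legendre_approx] and the split is stabilised by [cluster_point]. The second entropy is the
    one for which e1 / L1 + e2 / L2 = D. *)
Lemma level_set_blocks (D : R) : (forall q, D <= alpha * q - T_psi psi q) ->
  exists e1, forall eta : R, 0 < eta -> exists N m,
    [/\ (0 < N)%N, c <= N%:R * eta &
        moran_block S psi (alpha * L2) e1 (L2 * D - e1 / s) eta N m].
Proof.
move=> hD; have /andP[s0 s1] := s01.
have [b hb] := choice (skew_pressure_near hpsi Sa0 s01).
pose Q (eta e : R) := exists N m, [/\ (0 < N)%N, c <= N%:R * eta &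
   moran_block S psi (alpha * L2) e (L2 * D - e / s) eta N m].
have Qmono (eta eta' e : R) : eta <= eta' -> Q eta e -> Q eta' e.
  move=> he [N [m [N0 cN hm]]]; exists N, m; split => //.
    by apply: (le_trans cN); rewrite ler_wpM2l.
  apply: (moran_block_weaken (d := 0) hm); rewrite ?subrr ?normr0 ?addr0//.
have Qex (eta : R) : 0 < eta -> exists2 e, -1 <= e <= ln #|A1|%:R + 1 & Q eta e.
  move=> eta0.
  pose eta1 := Num.min (eta / 2) 1.
  have eta10 : 0 < eta1 by rewrite lt_min ltr01 divr_gt0.
  have eta11 : 0 < eta1 <= 1 by rewrite eta10 ge_min lexx orbT.
  have eta12 : eta1 <= eta / 2 by rewrite ge_min lexx.
  have d0 : 0 < eta / 2 / L2 by rewrite !divr_gt0.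
  have T_slope q (e : R) : 0 < e -> exists2 t0 : R, 0 < t0 & forall t, `|t| <= t0 ->
      T_psi psi q + (- (b q / L1)) * t - e * `|t| <= T_psi psi (q + t).
    move=> e0; have [t0 t00 ht] := hb q _ (mulr_gt0 e0 l1).
    exists t0 => // t /ht; rewrite (T_psiE q) (T_psiE (q + t)).
    move: (P q) (P (q + t)) => p p'; rewrite -(ler_pM2r (_ : 0 < L1^-1)) ?invr_gt0//.
    have -> : (p + b q * t + e * L1 * `|t|) / L1 = p / L1 + b q / L1 * t + e * `|t|.
      by field; rewrite gt_eqF.
    by move: (p / L1) (p' / L1) (b q / L1) => *; lra.
  have [q hq1 hq2] := legendre_approx T_psi_derivable T_slope d0 hD.
  have [N [e1 [m [N1 N2 he1 hm]]]] := moran_block_exists hpsi Sa0 s01 (hb q)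
    (Num.truncn (c / eta)).+1 eta11.
  exists e1 => //; exists N, m; split => //.
    by rewrite -ler_pdivrMr//; apply/ltW/lt_of_truncn.
  apply: (moran_block_weaken (d := eta / 2) hm); last by lra.
  - have -> : alpha * L2 - - (b q / s) = - ((- (b q / L1) - alpha) * L2).
      by field; rewrite !gt_eqF.
    by rewrite normrN normrM (gtr0_norm l2) -ler_pdivlMr.
  - by rewrite lerDl ltW// divr_gt0.
  - have : L2 * D <= L2 * (- (b q / L1) * q - T_psi psi q) by rewrite ler_pM2l.
    have -> : L2 * (- (b q / L1) * q - T_psi psi q) = P q / s + q * - (b q / s).
      by rewrite (T_psiE q); move: (P q) => p; field; rewrite !gt_eqF.
    rewrite [(P q - e1) / s]mulrBl.
    have e20 : 0 < eta / 2 by rewrite divr_gt0.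
    by move: (P q / s) (e1 / s) (q * _) (L2 * D) => *; lra.
have [e0 he0] := cluster_point Qmono Qex.
exists e0 => eta eta0.
(* Moving e1 by d moves e1 / s by d / s; together they use half of eta. *)
pose d := eta / (2 * (1 + s^-1)).
have s1' : 0 < 1 + s^-1 by rewrite addr_gt0// invr_gt0.
have d0 : 0 < d by rewrite divr_gt0 ?mulr_gt0.
have dE : d + d * s^-1 = eta / 2.
  by rewrite /d; field; rewrite !gt_eqF ?addr_gt0 ?divr_gt0.
have ds0 : 0 < d * s^-1 by rewrite mulr_gt0 ?invr_gt0.
have [e he [N [m [N0 cN hm]]]] := he0 _ d0.
exists N, m; split => //.
  by apply: (le_trans cN); rewrite ler_wpM2l//; lra.
apply: (moran_block_weaken (d := eta / 2) hm); last by lra.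
- by rewrite subrr normr0 divr_ge0 ?ltW.
- by move: he; rewrite ler_norml => /andP[? ?]; lra.
- move: he; rewrite ler_norml => /andP[h1 h2].
  have h3 : (e - e0) * s^-1 <= d * s^-1 by rewrite ler_pM2r ?invr_gt0.
  move: h3; rewrite mulrBl; move: (e / s) (e0 / s) (L2 * D) => *; lra.
Qed.

Lemma level_set_dim (D : R) : 0 < D -> legendre (T_psi psi) alpha = D%:E ->
  hausdorff_dim (prod_dist r1 r2) (E_psi psi alpha) = D%:E.
Proof.
move=> D0 hD.
have hDq q : D <= alpha * q - T_psi psi q.
  by rewrite -lee_fin -hD; apply: ereal_inf_lbound; exists q.
apply/eqP; rewrite eq_le; apply/andP; split.
  apply/lee_addgt0Pr => e e0.
  have [_ [q _ <-] hq] : exists2 x, [set (alpha * q - T_psi psi q)%:E | q in [set: R]] x &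
      (x < (D + e)%:E)%E.
    by apply/ereal_inf_lt; rewrite -/(legendre _ _) hD lte_fin ltrDl.
  rewrite lte_fin (T_psiE q) opprK in hq.
  by apply: (level_set_dim_le hr1 hr12 hpsi Sa0 _ hq); rewrite addr_gt0.
have [e1 hb] := level_set_blocks hDq.
have [K [hK1 hK2]] := moran_set_exists a0 hpsi hb.
apply: (hausdorff_dim_ge hr1 hr12 hK2 (moran_set_level_set hK1)).
by have -> : e1 / L1 + (L2 * D - e1 / s) / L2 = D by field; rewrite !gt_eqF.
Qed.

End LevelSets.

Unset Implicit Arguments.

Theorem theorem3p1 (R : realType) (r1 r2 : nat) (hr1 : (2 <= r1)%N)
    (hr12 : (r1 <= r2)%N)
    (psi : seq (letter r1 * letter r2) -> R)
    (mu : probability (symbolic_space r1 r2) R)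
    (hAM : almost_multiplicative psi)
    (hP : pressure psi = 0)
    (hmu : is_gibbs_measure psi mu)
    (hrestr : forall w, (psi w)%:E = mu (cylinder w)) :
  (convex_function [set: R^o] (fun q => - T_psi psi q) /\
   (forall q : R, derivable (T_psi psi) q 1) /\
   {homo T_psi psi : q q' / q <= q'}) /\
  (forall alpha : R, 0 <= alpha ->
    ((0 < legendre (T_psi psi) alpha)%E ->
       hausdorff_dim (prod_dist r1 r2) (E_psi psi alpha)
         = legendre (T_psi psi) alpha) /\
    ((legendre (T_psi psi) alpha < 0)%E -> E_psi psi alpha = set0)).
Proof.
have [c hpsi] := almost_multiplicative_quasi_mult hAM.
(* Almost multiplicativity alone allows psi to vanish on all nonempty words; the full mass of the
   support excludes this. *)
have [a0 Sa0] : exists a0, 0 < psi [:: a0].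
  have [_ _ hsupp _] := hmu.
  have /set0P[z zS] : supp psi != set0.
    apply/eqP => e; move: hsupp; rewrite e measure0 => /eqP.
    by rewrite eqe eq_sym oner_eq0.
  by exists (z 0%N); have := zS 1%N.
have psi_le1 w : psi w <= 1.
  rewrite -lee_fin hrestr; apply: probability_le1.
  by apply: sub_sigma_algebra; exists w.
split.
  split; first apply: (T_psi_convex hr1 hr12 hpsi Sa0).
  split; first by move=> q; apply: (T_psi_derivable hr1 hr12 hpsi Sa0).
  by move=> q q'; apply: (T_psi_mono hr1 hr12 hpsi Sa0 psi_le1).
move=> alpha _; split => [hpos|/ereal_inf_lt[_ [q _ <-]]]; last first.
  rewrite lte_fin (T_psiE psi q) opprK => hq.
  by apply: (level_set_empty hr1 hr12 hpsi Sa0 hq).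
(* Together with positivity, the value at q = 0 makes the infimum a real number. *)
have hfin : (legendre (T_psi psi) alpha <= (alpha * 0 - T_psi psi 0)%:E)%E.
  by apply: ereal_inf_lbound; exists 0.
have [D hD] : exists D : R, legendre (T_psi psi) alpha = D%:E.
  by move: hpos hfin; case: (legendre _ _) => // D _ _; exists D.
rewrite hD; apply: (level_set_dim hr1 hr12 hpsi Sa0) => //.
by rewrite -lte_fin -hD.
Qed.
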